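(* Let $1<\alpha\le 2$, let $u\in L^1(\mathbb{R})$, and assume that ${}_{-\infty}D_x^{\alpha+2}u$ and its Fourier transform belong to $L^1(\mathbb{R})$. Let $m\ge 2$ be an integer and let $p_1,\dots,p_m$ and $\lambda_1,\dots,\lambda_m$ be real numbers satisfying the linear system $$\sum_{j=1}^{m}\lambda_j=1,\qquad \sum_{j=1}^{m}\lambda_j\Big(p_j-\frac{\alpha}{2}\Big)=0 .$$ For $h>0$ define the left weighted and shifted Grünwald difference (WSGD) operator by $${}_{L}\mathcal{D}_{h,p_1,\dots,p_m}^{\alpha,\lambda_1,\dots,\lambda_m}u(x)=\sum_{j=1}^{m}\lambda_j A_{h,p_j}^{\alpha}u(x).$$ Then $${}_{L}\mathcal{D}_{h,p_1,\dots,p_m}^{\alpha,\lambda_1,\dots,\lambda_m}u(x)={}_{-\infty}D_x^{\alpha}u(x)+O(h^2)$$ uniformly for $x\in\mathbb{R}$ as $h\to 0$.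
   Context: For $n-1<\alpha<n$ with $n$ a positive integer, the left Riemann–Liouville fractional derivative of order $\alpha$ on $\mathbb{R}$ is ${}_{-\infty}D_x^{\alpha}u(x)=\frac{1}{\Gamma(n-\alpha)}\frac{d^n}{dx^n}\int_{-\infty}^{x}(x-s)^{n-\alpha-1}u(s)\,ds$; for integer $\alpha=n$ it is the ordinary derivative $u^{(n)}$. With the Fourier transform $\mathscr{F}[u](\omega)=\hat u(\omega)=\int_{\mathbb{R}}e^{-i\omega x}u(x)\,dx$ one has $\mathscr{F}[{}_{-\infty}D_x^{\alpha}u](\omega)=(i\omega)^{\alpha}\hat u(\omega)$ (principal branch). The normalized Grünwald weights are $w_k^{(\alpha)}=(-1)^k\binom{\alpha}{k}$, $k\ge 0$ (equal to $\frac{\Gamma(k-\alpha)}{\Gamma(-\alpha)\Gamma(k+1)}$ for non-integer $\alpha$). For $p\in\mathbb{R}$ and $h>0$ the left shifted Grünwald difference operator is $A_{h,p}^{\alpha}u(x)=\frac{1}{h^{\alpha}}\sum_{k=0}^{\infty}w_k^{(\alpha)}u\big(x-(k-p)h\big)$. *)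

(* Defs.v *)
From HB Require Import structures.
From mathcomp Require Import all_boot all_order all_algebra.
From mathcomp Require Import all_classical all_reals all_analysis.
From mathcomp.real_closed Require Export complex.

Set Implicit Arguments.
Unset Strict Implicit.
Unset Printing Implicit Defensive.

Import Order.TTheory GRing.Theory Num.Theory.
Import numFieldNormedType.Exports.

Local Open Scope classical_set_scope.
Local Open Scope ring_scope.
Local Open Scope complex_scope.

Section Defs.
Variable R : realType.
Implicit Types (u f : R -> R) (alpha h p x w : R).

Local Notation mu := (@lebesgue_measure R).

Definition inL1 f : Prop := mu.-integrable setT (EFin \o f).

(* The values of the library's total derivative [derive1n n f] are meaningful when f
   satisfies this predicate. *)
Definition nderivable (n : nat) f : Prop :=
  forall k, (k < n)%N -> forall x, derivable (derive1n k f) x 1.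

(* Euler's integral: the Gamma function on the half-line z > 0 only. *)
Definition Gamma (z : R) : R :=
  \int[mu]_(t in `]0, +oo[) (t `^ (z - 1) * expR (- t)).

(* For alpha > 0 not an integer, the n such that n - 1 < alpha < n. *)
Definition RL_n alpha : nat := (Num.truncn alpha).+1.

Definition RL_integrand alpha u x : R -> R :=
  fun s => (x - s) `^ ((RL_n alpha)%:R - alpha - 1) * u s.

Definition RL_integral alpha u : R -> R :=
  fun x => \int[mu]_(s in `]-oo, x[) RL_integrand alpha u x s.

(* Left Riemann-Liouville derivative of order alpha > 0; a total function, to be
   read together with [RL_derivable]. *)
Definition RL_derivative alpha u : R -> R :=
  if alpha \is a Num.nat then derive1n (Num.truncn alpha) u
  else fun x => (Gamma ((RL_n alpha)%:R - alpha))^-1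
                * derive1n (RL_n alpha) (RL_integral alpha u) x.

(* The derivative of order alpha exists at every point of the line. *)
Definition RL_derivable alpha u : Prop :=
  if alpha \is a Num.nat then nderivable (Num.truncn alpha) u
  else (forall x, mu.-integrable `]-oo, x[ (EFin \o RL_integrand alpha u x))
       /\ nderivable (RL_n alpha) (RL_integral alpha u).

Definition expi (t : R) : R[i] := cos t +i* sin t.

Definition complex_integral (f : R -> R[i]) : R[i] :=
  (\int[mu]_x complex.Re (f x)) +i* (\int[mu]_x complex.Im (f x)).

Definition complex_inL1 (f : R -> R[i]) : Prop :=
  inL1 (fun x => complex.Re (f x)) /\ inL1 (fun x => complex.Im (f x)).

Definition fourier f : R -> R[i] :=
  fun w => complex_integral (fun x => expi (- (w * x)) * (f x)%:C).

Definition gen_binomial alpha (k : nat) : R :=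
  (\prod_(i < k) (alpha - i%:R)) / k`!%:R.

Definition grunwald_weight alpha (k : nat) : R :=
  (-1) ^+ k * gen_binomial alpha k.

Definition grunwald_term alpha h p u x : R^nat :=
  fun k => grunwald_weight alpha k * u (x - (k%:R - p) * h).

(* The sum of the series is the library's total [limn]: it has the intended
   meaning when [series (grunwald_term alpha h p u x)] converges. *)
Definition grunwald alpha h p u x : R :=
  (h `^ alpha)^-1 * limn (series (grunwald_term alpha h p u x)).

Definition WSGD (m : nat) alpha (p lambda : 'I_m -> R) h u x : R :=
  \sum_(j < m) lambda j * grunwald alpha h (p j) u x.

End Defs.

(* Main.v *)
Require Import Defs.
From mathcomp Require Import all_boot all_order all_algebra.
From mathcomp Require Import all_classical all_reals all_analysis.
From mathcomp Require Import measurable_realfun.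
From mathcomp Require Import ring lra.

Set Implicit Arguments.
Unset Strict Implicit.
Unset Printing Implicit Defensive.

Import Order.TTheory GRing.Theory Num.Theory.
Import numFieldNormedType.Exports.

Local Open Scope classical_set_scope.
Local Open Scope ring_scope.

(** Write [alpha = 1 + a]. For [0 < a < 1] let [g] be the fractional integral of [u] of order
    [1 - a], that is [abel a u] divided by [Gamma (1 - a)]. The derivative of [u] of order
    [alpha] is [g''] and that of order [alpha + 2] is [g'''']. The theorem follows from the
    expansion, for one shift and with [y = x + p * h],

      grunwald alpha h p u x = g'' y - alpha / 2 * h * g''' y + O(h^2),

    because the Taylor expansions of [g''] and [g'''] about [x] and the two conditions on
    [lambda] and [p] then cancel the term of order [h] ([WSGD_estimate]).

    The expansion needs a bound on [g'''']. By [bounded_of_fourier_integrable] it comes from the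
    integrability of its Fourier transform: Poisson integrals of [g''''] are bounded, hence its
    averages over intervals, hence its values almost everywhere, hence all its values because
    it is the derivative of [g''']. Inequalities of Landau type ([landau_bound],
    [landau_bound1]) then bound [g] and [g'].

    The expansion itself is proved on the line rather than on the Fourier side. Fractional
    integrals of orders [a] and [1 - a] compose to the ordinary primitive [U] of [u], which
    up to constants reads

      U (x - h * k) = h^a * (integral over t > k of (t - k)^(a - 1) * g (x - h * t))

    ([integral_kappa_abel]). So the sum of [w k * U (x - k * h)], with the weights [w] of order [a],
    is an integral of [g (x - h * t)] against the kernel [K t], the sum of [w k * (t - k)^(a - 1)]
    over [k < t]. The weights [w] are inverse, for convolution, to the coefficients of
    [(1 - x)^-a], and Watson's lemma compares the latter with powers of [j + a / 2]
    ([gw_watson]). As a consequence the second primitive of [K] at [t] is a constant multiple of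
    [t - a / 2], up to a summable error ([kernel_bound]). Two integrations by parts give

      h^-a * (sum of w k * U (x - k * h)) = g x - a / 2 * h * g' x + O(h^2)

    with an error controlled by the supremum of [g''] ([grunwald_kernel_estimate]).

    To reach the order [1 + a] with an error controlled by [g''''], this is applied to second
    differences of [U], over [h] and over a small step [e]. When [e] tends to 0 the difference
    quotients of [U] become [u] at the nodes where [U] has derivative [u]; the limit may be
    taken term by term because [U] is Lipschitz. The difference over [h] turns the weights of
    order [a] into those of order [1 + a] ([grunwald_one_step]). For almost every [x], and for
    every [x] if [u] is continuous, all the nodes qualify ([second_order_of_estimate]).

    For [alpha = 2] the operator is a second difference, and Taylor's formula suffices
    ([grunwald2_estimate]). *)

(** * Integration on open intervals *)

Section real_valued.
Context d (T : measurableType d) (R : realType).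
Variables (mu : {measure set T -> \bar R}) (D : set T).
Implicit Types f g : T -> R.

Lemma measurable_fun_EFin f :
  measurable_fun D f -> measurable_fun D (fun x => (f x)%:E).
Proof. by move=> mf; exact/measurable_EFinP. Qed.

Hypothesis mD : measurable D.

Lemma integrable_dominated f g : measurable_fun D f ->
  mu.-integrable D (EFin \o g) -> (forall x, D x -> `|f x| <= g x) ->
  mu.-integrable D (EFin \o f).
Proof.
move=> mf gi fg; apply: (le_integrable mD _ _ gi); first exact/measurable_EFinP.
by move=> x Dx /=; rewrite lee_fin (le_trans (fg x Dx))// ler_norm.
Qed.

Lemma integrable_scale (k : R) f : mu.-integrable D (EFin \o f) ->
  mu.-integrable D (EFin \o (fun x => k * f x)).
Proof. by move=> fi; exact: (integrableZl mD k fi). Qed.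

Lemma integrable_add f g : mu.-integrable D (EFin \o f) ->
  mu.-integrable D (EFin \o g) -> mu.-integrable D (EFin \o (fun x => f x + g x)).
Proof. by move=> fi gi; exact: (integrableD mD fi gi). Qed.

Lemma integrable_sub f g : mu.-integrable D (EFin \o f) ->
  mu.-integrable D (EFin \o g) -> mu.-integrable D (EFin \o (fun x => f x - g x)).
Proof. by move=> fi gi; exact: (integrableB mD fi gi). Qed.

Lemma ge0_integrable_of_integral f (l : R) : measurable_fun D f ->
  (forall x, D x -> 0 <= f x) -> (\int[mu]_(x in D) (f x)%:E = l%:E)%E ->
  mu.-integrable D (EFin \o f).
Proof.
move=> mf f0 fl; apply/integrableP; split; first exact/measurable_EFinP.
rewrite (_ : \int[mu]_(x in D) _ = l%:E)%E ?ltry// -fl.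
by apply: eq_integral => x; rewrite inE => Dx /=; rewrite ger0_norm// f0.
Qed.

Lemma EFin_Rintegral f : mu.-integrable D (EFin \o f) ->
  ((\int[mu]_(x in D) f x)%:E = \int[mu]_(x in D) (f x)%:E)%E.
Proof. by move=> fi; rewrite /Rintegral fineK//; exact: integrable_fin_num. Qed.

Lemma Rintegral_dominated f g : mu.-integrable D (EFin \o f) ->
  mu.-integrable D (EFin \o g) -> (forall x, D x -> `|f x| <= g x) ->
  `|\int[mu]_(x in D) f x| <= \int[mu]_(x in D) g x.
Proof.
move=> fi gi fg; apply: (le_trans (le_normr_Rintegral mD fi)).
apply: le_Rintegral => //.
exact: (integrable_abse fi).
Qed.

End real_valued.

Section integral_tools.
Variable R : realType.
Local Notation mu := (@lebesgue_measure R).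
Implicit Types (f F G : R -> R) (A : set R).

Lemma is_derive1_continuous f (x df : R) :
  is_derive x (1 : R) f df -> {for x, continuous f}.
Proof.
move=> [dfx _]; apply: differentiable_continuous.
exact/derivable1_diffP.
Qed.

Lemma is_derive1_powR_comp f (s x df : R) : 0 < f x ->
  is_derive x (1 : R) f df ->
  is_derive x (1 : R) (fun y => f y `^ s) (s * f x `^ (s - 1) * df).
Proof.
by move=> fx0 Df; have H := is_derive1_powR s fx0; exact: is_derive1_comp.
Qed.

Lemma is_derive1_powR_1p (s x : R) : 0 < 1 + x ->
  is_derive x (1 : R) (fun y : R => (1 + y) `^ s) (s * (1 + x) `^ (s - 1)).
Proof.
move=> x0; have H : is_derive x (1 : R) (cst 1 + id : R -> R) 1.
  by apply: is_derive_eq; rewrite add0r.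
by have := is_derive1_comp (is_derive1_powR s x0) H; rewrite mulr1.
Qed.

Lemma is_derive_reflect f (x t df : R) : is_derive (x - t) (1 : R) f df ->
  is_derive t (1 : R) (fun t => f (x - t)) (- df).
Proof.
move=> H; have H1 : is_derive t (1 : R) (fun t => x - t) (- 1).
  by apply: is_derive_eq; ring.
by have := @is_derive1_comp _ f (fun t => x - t) t _ _ H H1; rewrite mulrN1.
Qed.

Lemma ler_powR_npos (r x y : R) : r <= 0 -> 0 < x <= y -> y `^ r <= x `^ r.
Proof.
move=> r0 /andP[x0 xy]; have y0 := lt_le_trans x0 xy.
rewrite -(opprK r) !(powRN _ (- r)) lef_pV2 ?posrE ?powR_gt0//.
by apply: ge0_ler_powR; rewrite ?nnegrE ?oppr_ge0 ?(ltW x0) ?(ltW y0).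
Qed.

Lemma integrable_oo_of_continuous f (c d : R) :
  (forall x, c <= x <= d -> {for x, continuous f}) -> mu.-integrable `]c, d[ (EFin \o f).
Proof.
move=> cf; have H : mu.-integrable `[c, d] (EFin \o f).
  apply: continuous_compact_integrable; first exact: segment_compact.
  by apply: continuous_in_subspaceT => x; rewrite inE/= in_itv/=; exact: cf.
by apply: (integrableS _ _ _ H) => // x /=; rewrite !in_itv/= => /andP[/ltW -> /ltW ->].
Qed.

Lemma integral_seg_FTC f F (c d : R) : c < d ->
  {in `[c, d], forall x, is_derive x (1 : R) F (f x)} ->
  {in `[c, d], continuous f} ->
  (\int[mu]_(x in `[c, d]) (f x)%:E = (F d - F c)%:E)%E.
Proof.
move=> cd dF cf.
have FE x : x \in `[c, d] -> {for x, continuous F}.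
  move=> xcd; apply: differentiable_continuous; apply/derivable1_diffP.
  by have [] := dF _ xcd.
rewrite EFinB; apply: continuous_FTC2 => //.
- by apply: continuous_in_subspaceT => x; rewrite inE => /= xcd; exact: cf.
- split.
  + by move=> x xcd; have [] := dF x (subset_itv_oo_cc xcd).
  + have /FE h : c \in `[c, d] by rewrite in_itv/= lexx ltW.
    exact: cvg_at_right_filter.
  + have /FE h : d \in `[c, d] by rewrite in_itv/= lexx ltW.
    exact: cvg_at_left_filter.
- move=> x xcd; rewrite derive1E; have := dF x (subset_itv_oo_cc xcd).
  by move=> /@derive_val.
Qed.

Section exhaustion.
Variables (A : set R) (c d : R^nat).
Hypotheses (cd : forall n, c n < d n)
  (ndc : forall n, c n.+1 <= c n) (ndd : forall n, d n <= d n.+1)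
  (AE : A = \bigcup_n `[c n, d n]%classic).

Let nd : nondecreasing_seq (fun n => `[c n, d n]%classic).
Proof.
apply/nondecreasing_seqP => n; rewrite subsetEset => x /=.
by rewrite !in_itv/= => /andP[cx xd]; rewrite (le_trans (ndc n))// (le_trans xd).
Qed.

Lemma exhaustion_measurable : measurable A.
Proof. by rewrite AE; apply: bigcup_measurable => n _; exact: measurable_itv. Qed.

Lemma exhaustion_measurable_fun f :
  {in A, continuous f} -> measurable_fun A f.
Proof.
move=> cf; rewrite AE; apply/measurable_fun_bigcup => [n|n]//.
apply: subspace_continuous_measurable_fun => //.
apply: continuous_in_subspaceT => x; rewrite inE => /= xcd; apply: cf.
by rewrite inE AE; exists n.
Qed.

Lemma ge0_integral_exhaustion_cvg f :
  {in A, continuous f} -> (forall x, A x -> 0 <= f x) ->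
  (\int[mu]_(x in `[c n, d n]) (f x)%:E)%E @[n --> \oo]
    --> (\int[mu]_(x in A) (f x)%:E)%E.
Proof.
move=> cf f0; rewrite AE; apply: ge0_nondecreasing_set_cvg_integral => //.
- move=> n; apply/measurable_EFinP; apply: (@measurable_funS _ _ _ _ A).
  + exact: exhaustion_measurable.
  + by move=> x xn; rewrite AE; exists n.
  + exact: exhaustion_measurable_fun.
- by move=> i x Six; rewrite lee_fin f0// AE; exists i.
Qed.

Lemma integrable_exhaustion_cvg f : mu.-integrable A (EFin \o f) ->
  (\int[mu]_(x in `[c n, d n]) (f x)%:E)%E @[n --> \oo]
    --> (\int[mu]_(x in A) (f x)%:E)%E.
Proof.
move=> fi.
have mA := exhaustion_measurable.
have := @dominated_convergence _ _ _ mu A mA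
  (fun n => (EFin \o f) \_ `[c n, d n]) (EFin \o f) (abse \o (EFin \o f)).
case.
- move=> n; apply/measurable_restrict => //.
  apply: (@measurable_funS _ _ _ _ A) => //; last exact: measurable_int fi.
- exact: measurable_int fi.
- apply: aeW => x; rewrite {1}AE => -[n _ xn].
  apply: cvg_near_cst; exists n => // m /= nm; rewrite patchE mem_set//.
  by have := nd nm; rewrite subsetEset; exact.
- exact: integrable_abse.
- by apply: aeW => x n Ax; rewrite patchE; case: ifPn => // _ /=; rewrite normr0 lee_fin.
move=> _ _; rewrite /=.
have -> : (fun n => \int[mu]_(x in `[c n, d n]) (f x)%:E)%E =
    (fun n => \int[mu]_(x in A) ((EFin \o f) \_ `[c n, d n]) x)%E; last by [].
apply/funext => n; rewrite -integral_mkcondr setIidr//.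
by move=> x xn; rewrite AE; exists n.
Qed.

(** The integrand may be singular at both ends of [A]; on each compact interval
    of the exhaustion it is continuous, and only the convergence of the integrals,
    monotone or dominated, depends on the case. *)
Let integral_FTC_of_cvg f F (l : R) :
  (\int[mu]_(x in `[c n, d n]) (f x)%:E)%E @[n --> \oo] --> (\int[mu]_(x in A) (f x)%:E)%E ->
  {in A, continuous f} -> {in A, forall x, is_derive x (1 : R) F (f x)} ->
  F (d n) - F (c n) @[n --> \oo] --> l ->
  (\int[mu]_(x in A) (f x)%:E = l%:E)%E.
Proof.
move=> + cf dF Fl.
have -> : (fun n => \int[mu]_(x in `[c n, d n]) (f x)%:E)%E =
    (fun n => (F (d n) - F (c n))%:E).
  apply/funext => n; apply: integral_seg_FTC => // x xcd.
  - by apply: dF; rewrite inE AE; exists n.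
  - by apply: cf; rewrite inE AE; exists n.
have H : (F (d n) - F (c n))%:E @[n --> \oo] --> l%:E.
  by apply: cvg_EFin => //; exact: nearW.
by move=> /cvg_unique; apply.
Qed.

Lemma ge0_integral_FTC f F (l : R) :
  {in A, continuous f} -> (forall x, A x -> 0 <= f x) ->
  {in A, forall x, is_derive x (1 : R) F (f x)} ->
  F (d n) - F (c n) @[n --> \oo] --> l ->
  (\int[mu]_(x in A) (f x)%:E = l%:E)%E.
Proof. by move=> cf f0; apply: integral_FTC_of_cvg => //; exact: ge0_integral_exhaustion_cvg. Qed.

Lemma integral_FTC f F (l : R) :
  {in A, continuous f} -> mu.-integrable A (EFin \o f) ->
  {in A, forall x, is_derive x (1 : R) F (f x)} ->
  F (d n) - F (c n) @[n --> \oo] --> l ->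
  (\int[mu]_(x in A) (f x)%:E = l%:E)%E.
Proof. by move=> cf fi; apply: integral_FTC_of_cvg => //; exact: integrable_exhaustion_cvg. Qed.

End exhaustion.

Section substitution.
Variables (A : set R) (c d : R^nat).
Hypotheses (cd : forall n, c n < d n)
  (ndc : forall n, c n.+1 <= c n) (ndd : forall n, d n <= d n.+1)
  (AE : A = \bigcup_n `[c n, d n]%classic).

(** The rule is applied on the compact intervals that exhaust [A]: their images
    exhaust [B] because [F] is a decreasing bijection. *)
Lemma ge0_integral_substitution_decreasing F f G (B : set R) :
  open A -> {in A &, {homo F : x y /~ x < y}} ->
  {in A, forall x, is_derive x (1 : R) F (f x)} -> {in A, continuous f} ->
  (forall x, A x -> f x <= 0) ->
  is_interval B -> {homo F : x / A x >-> B x} ->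
  (forall y, B y -> exists2 x, A x & F x = y) ->
  {in B, continuous G} -> (forall y, B y -> 0 <= G y) ->
  (\int[mu]_(y in B) (G y)%:E = \int[mu]_(x in A) (G (F x) * - f x)%:E)%E.
Proof.
move=> oA Fdec dF cf f0 iB FAB FBA cG G0.
have SA n x : x \in `[c n, d n] -> x \in A by move=> xn; rewrite inE AE; exists n.
have cA n : c n \in A by apply: (SA n); rewrite in_itv/= lexx ltW.
have dA n : d n \in A by apply: (SA n); rewrite in_itv/= lexx ltW.
have SAB n x : x \in `[c n, d n] -> F x \in `[F (d n), F (c n)].
  move=> xn; have xA := SA _ _ xn; move: xn; rewrite !in_itv/= => /andP[cx xd].
  apply/andP; split.
  - move: xd; rewrite le_eqVlt => /predU1P[->//|xd]; apply: ltW.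
    by apply: Fdec.
  - move: cx; rewrite le_eqVlt => /predU1P[->//|cx']; apply: ltW.
    by apply: Fdec.
have BE : B = \bigcup_n `[F (d n), F (c n)]%classic.
  apply/seteqP; split => [y /FBA[x]|y [n _]].
    by rewrite AE => -[n _ xn] <-; exists n => //; exact: SAB.
  have : B (F (c n)) by apply: FAB; rewrite -inE.
  have : B (F (d n)) by apply: FAB; rewrite -inE.
  by move=> Bd Bc; rewrite /= in_itv/=; exact: iB.
have SB n x : x \in `[F (d n), F (c n)] -> x \in B.
  by move=> xn; rewrite inE BE; exists n.
have F'E x : x \in A -> derive1 F x = f x.
  by move=> xA; rewrite derive1E; have /@derive_val := dF x xA.
have cF' x : x \in A -> {for x, continuous (derive1 F)}.
  move=> xA; rewrite /prop_for /continuous_at F'E//.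
  apply: cvg_trans (cf x xA); apply: near_eq_cvg.
  have : \forall y \near x, A y by apply: open_nbhs_nbhs; split=> //; rewrite -inE.
  by apply: filterS => y Ay; rewrite F'E ?inE.
have FE x : x \in A -> {for x, continuous F}.
  move=> xcd; apply: differentiable_continuous; apply/derivable1_diffP.
  by have [] := dF _ xcd.
have segE n : (\int[mu]_(y in `[F (d n), F (c n)]) (G y)%:E =
    \int[mu]_(x in `[c n, d n]) (G (F x) * - f x)%:E)%E.
  rewrite integration_by_substitution_decreasing//.
  - apply: eq_integral => x; rewrite inE/= => xn; rewrite fctE/=.
    by congr (_ * - _)%:E; apply: F'E; exact: SA xn.
  - exact: ltW.
  - by move=> x y xn yn; apply: Fdec; [exact: SA xn|exact: SA yn].
  - by move=> x /subset_itv_oo_cc xn; apply: cF'; exact: SA xn.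
  - by apply/cvg_ex; exists (derive1 F (c n)); apply: cvg_at_right_filter; exact: cF'.
  - by apply/cvg_ex; exists (derive1 F (d n)); apply: cvg_at_left_filter; exact: cF'.
  - split; [|by apply: cvg_at_right_filter; exact: FE|by apply: cvg_at_left_filter; exact: FE].
    by move=> x /subset_itv_oo_cc xn; have [] := dF x (SA _ _ xn).
  - by apply: continuous_in_subspaceT => x; rewrite inE => /= xn; apply: cG; exact: SB xn.
have cGF x : x \in A -> {for x, continuous (fun x => G (F x) * - f x)}.
  move=> xA; have : x \in A by []; rewrite inE AE => -[n _ xn].
  apply: continuousM; last by apply: continuousN; exact: cf.
  by apply: continuous_comp; [exact: FE|apply/cG/SB/SAB/xn].
have /cvg_unique : (\int[mu]_(y in `[F (d n), F (c n)]) (G y)%:E)%E @[n --> \oo]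
    --> (\int[mu]_(y in B) (G y)%:E)%E.
  apply: (@ge0_integral_exhaustion_cvg B (F \o d) (F \o c)) => //.
  - by move=> n/=; have := ndd n; rewrite le_eqVlt => /predU1P[->//|h]; apply/ltW/Fdec.
  - by move=> n/=; have := ndc n; rewrite le_eqVlt => /predU1P[->//|h]; apply/ltW/Fdec.
apply => //.
have -> : (fun n => \int[mu]_(y in `[F (d n), F (c n)]) (G y)%:E)%E =
  (fun n => \int[mu]_(x in `[c n, d n]) (G (F x) * - f x)%:E)%E.
  by apply/funext => n; exact: segE.
apply: ge0_integral_exhaustion_cvg => // x Ax.
rewrite mulr_ge0 ?oppr_ge0 ?f0//; apply: G0.
by move: (Ax); rewrite AE => -[n _ xn]; have := SB n _ (SAB _ _ xn); rewrite inE.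
Qed.

End substitution.

Let cy (n : nat) : R := n.+2%:R^-1.
Let dy (n : nat) : R := n.+1%:R.

Let cdy n : cy n < dy n.
Proof.
rewrite /cy /dy (@lt_le_trans _ _ 1)// ?ler1n// invf_lt1// ltr1n//.
Qed.

Let ndcy n : cy n.+1 <= cy n.
Proof. by rewrite lef_pV2 ?posrE ?ltr0n// ler_nat. Qed.

Let nddy n : dy n <= dy n.+1. Proof. by rewrite ler_nat. Qed.

Let AEy : `]0, +oo[%classic = \bigcup_n `[cy n, dy n]%classic.
Proof.
apply/seteqP; split => [x/=|x [n _]/=]; rewrite !in_itv/= andbT; last first.
  by move=> /andP[+ _]; apply: lt_le_trans; rewrite invr_gt0 ltr0n.
move=> x0; exists (maxn (Num.truncn x) (Num.truncn x^-1)) => //=.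
rewrite in_itv/=; apply/andP; split.
- rewrite invf_ple ?posrE ?ltr0n//; apply: ltW.
  apply: (@lt_le_trans _ _ (Num.truncn x^-1).+1%:R).
    by rewrite truncnS_gt.
  by rewrite ler_nat ltnS (@leq_trans (maxn (Num.truncn x) (Num.truncn x^-1)))// leq_maxr.
- apply: ltW; apply: (@lt_le_trans _ _ (Num.truncn x).+1%:R).
    by rewrite truncnS_gt.
  by rewrite ler_nat ltnS leq_maxl.
Qed.

Let cy_cvg : cy n @[n --> \oo] --> 0.
Proof.
have := @cvg_harmonic R; rewrite -(cvg_shiftS (@harmonic R)); exact: cvg_trans.
Qed.

Let dy_cvg : dy n @[n --> \oo] --> +oo.
Proof.
have := @cvgr_idn R; rewrite -(cvg_shiftS (fun n => n%:R : R^o)); exact: cvg_trans.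
Qed.

Let Fcdy F l0 l1 : F x @[x --> 0^'+] --> l0 -> F x @[x --> +oo] --> l1 ->
  F (dy n) - F (cy n) @[n --> \oo] --> l1 - l0.
Proof.
move=> /cvg_at_rightP F0 /cvg_pinftyP F1; apply: cvgB.
- by apply: F1; exact: dy_cvg.
- by apply: F0; split; [move=> n; rewrite /cy invr_gt0 ltr0n|exact: cy_cvg].
Qed.

Lemma ge0_integral_FTC_0y f F (l0 l1 : R) :
  (forall x : R, 0 < x -> {for x, continuous f}) -> (forall x : R, 0 < x -> 0 <= f x) ->
  (forall x : R, 0 < x -> is_derive x (1 : R) F (f x)) ->
  F x @[x --> 0^'+] --> l0 -> F x @[x --> +oo] --> l1 ->
  (\int[mu]_(x in `]0%R, +oo[) (f x)%:E = (l1 - l0)%:E)%E.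
Proof.
move=> cf f0 dF F0 F1; apply: (ge0_integral_FTC cdy ndcy nddy AEy) => //.
- by move=> x; rewrite inE/= in_itv/= andbT; exact: cf.
- by move=> x /=; rewrite in_itv/= andbT; exact: f0.
- by move=> x; rewrite inE/= in_itv/= andbT; exact: dF.
- exact: Fcdy.
Qed.

Lemma integral_FTC_0y f F (l0 l1 : R) :
  (forall x : R, 0 < x -> {for x, continuous f}) ->
  mu.-integrable `]0, +oo[ (EFin \o f) ->
  (forall x : R, 0 < x -> is_derive x (1 : R) F (f x)) ->
  F x @[x --> 0^'+] --> l0 -> F x @[x --> +oo] --> l1 ->
  (\int[mu]_(x in `]0%R, +oo[) (f x)%:E = (l1 - l0)%:E)%E.
Proof.
move=> cf f0 dF F0 F1; apply: (integral_FTC cdy ndcy nddy AEy) => //.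
- by move=> x; rewrite inE/= in_itv/= andbT; exact: cf.
- by move=> x; rewrite inE/= in_itv/= andbT; exact: dF.
- exact: Fcdy.
Qed.

Lemma measurable_fun_0y f : (forall x : R, 0 < x -> {for x, continuous f}) ->
  measurable_fun (`]0, +oo[ : set R) f.
Proof.
move=> cf; apply: (@exhaustion_measurable_fun _ cy dy AEy) => x.
by rewrite inE/= in_itv/= andbT; exact: cf.
Qed.

Section bounded_interval.
Variables c d : R.
Hypothesis cd : c < d.
Let eX (n : nat) : R := (d - c) / n.+3%:R.
Let cX (n : nat) : R := c + eX n.
Let dX (n : nat) : R := d - eX n.

Let dc0 : 0 < d - c. Proof. by rewrite subr_gt0. Qed.

Let eX_gt0 n : 0 < eX n. Proof. by rewrite divr_gt0. Qed.

Let cdX n : cX n < dX n.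
Proof.
rewrite /cX /dX ltrBrDr -addrA addrC -ltrBrDr /eX -mulrDr gtr_pMr//.
have -> : n.+3%:R^-1 + n.+3%:R^-1 = 2 / n.+3%:R :> R by rewrite mulrDl !mul1r.
by rewrite ltr_pdivrMr ?ltr0n// mul1r ltr_nat.
Qed.

Let neX n : eX n.+1 <= eX n.
Proof. by rewrite ler_pM2l// lef_pV2 ?posrE ?ltr0n// ler_nat. Qed.

Let ndcX n : cX n.+1 <= cX n. Proof. by rewrite lerD2l; exact: neX. Qed.

Let nddX n : dX n <= dX n.+1. Proof. by rewrite lerD2l lerN2; exact: neX. Qed.

Let AEX : `]c, d[%classic = \bigcup_n `[cX n, dX n]%classic.
Proof.
apply/seteqP; split => [x/=|x [n _]/=]; rewrite !in_itv/=; last first.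
  move=> /andP[cx xd]; rewrite (lt_le_trans _ cx)//= ?ltrDl ?eX_gt0// (le_lt_trans xd)//.
  by rewrite gtrBl eX_gt0.
move=> /andP[cx xd].
pose m := Num.min (x - c) (d - x); have m0 : 0 < m by rewrite lt_min !subr_gt0 cx.
exists (Num.truncn ((d - c) / m)) => //=.
have h : eX (Num.truncn ((d - c) / m)) <= m.
  rewrite /eX ler_pdivrMr// mulrC -ler_pdivrMr//; apply: ltW.
  apply: (@lt_le_trans _ _ (Num.truncn ((d - c) / m)).+1%:R); first by rewrite truncnS_gt.
  by rewrite ler_nat !ltnS (leq_trans (leqnSn _)).
move: h; rewrite le_min => /andP[h1 h2].
by rewrite in_itv/= /cX /dX addrC -lerBrDr h1/= lerBrDr addrC -lerBrDr.
Qed.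

Let eX_cvg : eX n @[n --> \oo] --> 0.
Proof.
rewrite -(mulr0 (d - c)); apply: cvgMr.
have := cy_cvg; rewrite -(cvg_shiftS cy); exact: cvg_trans.
Qed.

Let FcdX F l0 l1 : F x @[x --> c^'+] --> l0 -> F x @[x --> d^'-] --> l1 ->
  F (dX n) - F (cX n) @[n --> \oo] --> l1 - l0.
Proof.
move=> /cvg_at_rightP F0 /cvg_at_leftP F1; apply: cvgB.
- apply: F1; split => [n|]; first by rewrite gtrBl eX_gt0.
  by rewrite -[X in _ --> X]subr0; apply: cvgB; [exact: cvg_cst|exact: eX_cvg].
- apply: F0; split => [n|]; first by rewrite ltrDl eX_gt0.
  by rewrite -[X in _ --> X]addr0; apply: cvgD; [exact: cvg_cst|exact: eX_cvg].
Qed.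

Lemma ge0_integral_FTC_oo f F (l0 l1 : R) :
  (forall x, c < x < d -> {for x, continuous f}) -> (forall x, c < x < d -> 0 <= f x) ->
  (forall x, c < x < d -> is_derive x (1 : R) F (f x)) ->
  F x @[x --> c^'+] --> l0 -> F x @[x --> d^'-] --> l1 ->
  (\int[mu]_(x in `]c, d[) (f x)%:E = (l1 - l0)%:E)%E.
Proof.
move=> cf f0 dF F0 F1; apply: (ge0_integral_FTC cdX ndcX nddX AEX (f := f) (F := F)) => //.
- by move=> x; rewrite inE/= in_itv/=; exact: cf.
- by move=> x; rewrite inE/= in_itv/=; exact: dF.
- exact: FcdX.
Qed.

Lemma integral_FTC_oo f F (l0 l1 : R) :
  (forall x, c < x < d -> {for x, continuous f}) ->
  mu.-integrable `]c, d[ (EFin \o f) ->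
  (forall x, c < x < d -> is_derive x (1 : R) F (f x)) ->
  F x @[x --> c^'+] --> l0 -> F x @[x --> d^'-] --> l1 ->
  (\int[mu]_(x in `]c, d[) (f x)%:E = (l1 - l0)%:E)%E.
Proof.
move=> cf f0 dF F0 F1; apply: (integral_FTC cdX ndcX nddX AEX) => //.
- by move=> x; rewrite inE/= in_itv/=; exact: cf.
- by move=> x; rewrite inE/= in_itv/=; exact: dF.
- exact: FcdX.
Qed.

Lemma measurable_fun_oo f : (forall x, c < x < d -> {for x, continuous f}) ->
  measurable_fun (`]c, d[ : set R) f.
Proof.
move=> cf; apply: (@exhaustion_measurable_fun _ cX dX AEX) => x.
by rewrite inE/= in_itv/=; exact: cf.
Qed.

(** This substitution sends the two end points to infinity and to 0, and turns the
    Beta integrand into a power of [expR y - 1]. *)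
Lemma ge0_integral_expR_substitution (G : R -> R) :
  (forall t : R, c < t < d -> {for t, continuous G}) ->
  (forall t : R, c < t < d -> 0 <= G t) ->
  (\int[mu]_(t in `]c, d[) (G t)%:E =
   \int[mu]_(y in `]0%R, +oo[) (G (c + (d - c) * expR (- y)) * ((d - c) * expR (- y)))%:E)%E.
Proof.
move=> cG G0.
rewrite (@ge0_integral_substitution_decreasing _ _ _ cdy ndcy nddy AEy
  (fun y => c + (d - c) * expR (- y)) (fun y => - ((d - c) * expR (- y)))) //.
- by apply: eq_integral => y _; rewrite opprK.
- by move=> x y _ _ xy; rewrite ltrD2l ltr_pM2l// ltr_expR ltrN2.
- move=> x _; apply: is_derive_eq; rewrite /GRing.scale/=; ring.
- move=> x _; exact: is_derive1_continuous.
- by move=> x _; rewrite oppr_le0 mulr_ge0 ?expR_ge0// ltW.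
- exact: interval_is_interval.
- move=> y /=; rewrite !in_itv/= andbT => y0.
  rewrite ltrDl mulr_gt0 ?expR_gt0//= addrC -ltrBrDr gtr_pMr// expR_lt1 oppr_lt0//.
- move=> y /=; rewrite in_itv/= => /andP[y0 yX].
  have yc : 0 < (y - c) / (d - c) by rewrite divr_gt0// subr_gt0.
  exists (- ln ((y - c) / (d - c))).
  + rewrite /= in_itv/= andbT oppr_gt0 ln_lt0// yc/=.
    by rewrite ltr_pdivrMr// mul1r ltrD2r.
  + rewrite opprK lnK ?posrE// mulrCA divff ?gt_eqF// mulr1; ring.
- by move=> x; rewrite inE/= in_itv/=; exact: cG.
Qed.

End bounded_interval.

Lemma ge0_integral_inv_substitution (s : R) (G : R -> R) : 0 < s ->
  (forall t : R, 0 < t -> {for t, continuous G}) -> (forall t : R, 0 < t -> 0 <= G t) ->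
  (\int[mu]_(t in `]0%R, +oo[) (G t)%:E =
   \int[mu]_(y in `]0%R, +oo[) (G (s * y)^-1 * (s * y ^+ 2)^-1)%:E)%E.
Proof.
move=> s0 cG G0.
rewrite (@ge0_integral_substitution_decreasing _ _ _ cdy ndcy nddy AEy
  (fun y => (s * y)^-1) (fun y => - (s * y ^+ 2)^-1)) //.
- by apply: eq_integral => y _; rewrite opprK.
- move=> x y; rewrite !inE/= !in_itv/= !andbT => x0 y0 xy.
  by rewrite ltf_pV2 ?posrE ?mulr_gt0 ?ltr_pM2l.
- move=> x; rewrite inE/= in_itv/= andbT => x0.
  have sx0 : s * x != 0 by rewrite gt_eqF// mulr_gt0.
  apply: is_derive_eq; rewrite /GRing.scale/=; field.
  by rewrite !gt_eqF.
- move=> x; rewrite inE/= in_itv/= andbT => x0.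
  have sx0 : s * x ^+ 2 != 0 by rewrite gt_eqF// mulr_gt0// exprn_gt0.
  exact: is_derive1_continuous.
- move=> x /=; rewrite in_itv/= andbT => x0.
  by rewrite oppr_le0 invr_ge0 mulr_ge0 ?exprn_ge0// ltW.
- exact: interval_is_interval.
- by move=> y /=; rewrite !in_itv/= !andbT => y0; rewrite invr_gt0 mulr_gt0.
- move=> y /=; rewrite in_itv/= andbT => y0; exists (s * y)^-1.
  + by rewrite /= in_itv/= andbT invr_gt0 mulr_gt0.
  + by field; rewrite !gt_eqF.
- by move=> x; rewrite inE/= in_itv/= andbT; exact: cG.
- by move=> x; rewrite /= in_itv/= andbT; exact: G0.
Qed.

(** A dilation is the composite of two inversions, which are decreasing. *)
Lemma ge0_integral_scale_0y (t : R) (G : R -> R) : 0 < t ->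
  (forall t : R, 0 < t -> {for t, continuous G}) -> (forall t : R, 0 < t -> 0 <= G t) ->
  (\int[mu]_(y in `]0%R, +oo[) (G y)%:E =
   \int[mu]_(y in `]0%R, +oo[) (G (t * y) * t)%:E)%E.
Proof.
move=> t0 cG G0.
rewrite (@ge0_integral_inv_substitution 1)//.
rewrite (@ge0_integral_inv_substitution t)//.
- apply: eq_integral => y; rewrite inE/= in_itv/= andbT => y0.
  have y_neq0 : y != 0 by rewrite gt_eqF.
  have t_neq0 : t != 0 by rewrite gt_eqF.
  by rewrite mul1r invrK; congr (_ %:E); field; rewrite y_neq0.
- move=> y y0; have y_neq0 : y != 0 by rewrite gt_eqF.
  apply: continuousM.
    apply: continuous_comp; last by apply: cG; rewrite invr_gt0 mulr_gt0.
    apply: continuousV; first by rewrite mul1r.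
    by apply: continuousM; [exact: cvg_cst|exact: cvg_id].
  apply: continuousV; first by rewrite mul1r expf_neq0.
  by apply: continuousM; [exact: cvg_cst|exact: exprn_continuous].
- move=> y y0; rewrite mulr_ge0 ?G0 ?invr_gt0 ?mul1r//.
  by rewrite invr_ge0 exprn_ge0// ltW.
Qed.

End integral_tools.

(** * The Gamma integral and an expansion of sinh *)

Section gamma.
Variable R : realType.
Local Notation mu := (@lebesgue_measure R).
Implicit Types a s t x y z : R.

Lemma le_derivative_bound (f g df dg : R -> R) (x : R) : 0 <= x ->
  (forall t : R, 0 <= t -> is_derive t (1 : R) f (df t)) ->
  (forall t : R, 0 <= t -> is_derive t (1 : R) g (dg t)) ->
  f 0 <= g 0 -> (forall t : R, 0 <= t <= x -> df t <= dg t) -> f x <= g x.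
Proof.
rewrite le_eqVlt => /predU1P[<-//|x0] Df Dg fg0 dfg.
have D (t : R) : 0 <= t -> is_derive t (1 : R) (g - f) (dg t - df t).
  by move=> t0; have := Df t t0; have := Dg t t0 => ? ?; exact: is_deriveB.
have [t /[!in_itv]/= /andP[t0 tx] E] : exists2 t, t \in `]0, x[ &
    (g - f) x - (g - f) 0 = (dg t - df t) * (x - 0).
  apply: (@MVT _ _ (fun t => dg t - df t)) => //.
    by move=> t /[!in_itv]/= /andP[t0 _]; apply: D; exact: ltW.
  apply: continuous_in_subspaceT => t /[!inE]/= /[!in_itv]/= /andP[t0 _].
  exact: (is_derive1_continuous (D t t0)).
have : 0 <= (dg t - df t) * (x - 0).
  by rewrite subr0 mulr_ge0 ?(ltW x0)// subr_ge0; apply: dfg; lra.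
by rewrite -E; change (0 <= (g x - f x) - (g 0 - f 0) -> f x <= g x); lra.
Qed.

Let sh (z : R) := (expR z - expR (- z)) / 2.
Let ch (z : R) := (expR z + expR (- z)) / 2.

Let dsh (z : R) : is_derive z (1 : R) sh (ch z).
Proof. by apply: is_derive_eq; rewrite /GRing.scale/= /ch; field. Qed.

Let dch (z : R) : is_derive z (1 : R) ch (sh z).
Proof. by apply: is_derive_eq; rewrite /GRing.scale/= /sh; field. Qed.

Let sh0 : sh 0 = 0. Proof. by rewrite /sh oppr0 subrr mul0r. Qed.
Let ch0 : ch 0 = 1. Proof. by rewrite /ch oppr0 expR0; lra. Qed.

Let sh_ge z : 0 <= z -> z + z ^+ 3 / 6 <= sh z.
Proof.
move=> z0; have ch1 t : 1 <= ch t.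
  rewrite /ch; have := expR_ge1Dx t; have := expR_ge1Dx (- t); lra.
have sh1 t : 0 <= t -> t <= sh t.
  move=> t0; apply: (@le_derivative_bound id sh (fun=> 1) ch) => //.
  by rewrite sh0.
have ch2 t : 0 <= t -> 1 + t ^+ 2 / 2 <= ch t.
  move=> t0; apply: (@le_derivative_bound (fun t => 1 + t ^+ 2 / 2) ch id sh) => //.
  - by move=> u u0; apply: is_derive_eq; rewrite /GRing.scale/=; field.
  - by rewrite ch0 expr0n/= mul0r addr0.
  - by move=> u /andP[u0 _]; exact: sh1.
apply: (@le_derivative_bound (fun t => t + t ^+ 3 / 6) sh (fun t => 1 + t ^+ 2 / 2) ch) => //.
- by move=> u u0; apply: is_derive_eq; rewrite /GRing.scale/=; field.
- by rewrite sh0 expr0n/= mul0r addr0.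
- by move=> u /andP[u0 _]; exact: ch2.
Qed.

Let sh_le z : 0 <= z <= 2^-1 -> sh z <= z + z ^+ 3 / 6 + z ^+ 4 / 24.
Proof.
move=> /andP[z0 z1].
have sh1 t : 0 <= t <= z -> sh t <= 1.
  move=> /andP[t0 tz]; rewrite /sh.
  have : expR t <= 2.
    have := expR_ge1Dx (- t); rewrite expRN => h.
    have e0 := expR_gt0 t.
    have h2 : 2^-1 <= (expR t)^-1 by apply: le_trans h; lra.
    by rewrite -(@lef_pV2 R) ?posrE.
  have := expR_ge0 (- t); lra.
have ch1 t : 0 <= t <= z -> ch t <= 1 + t.
  move=> /andP[t0 tz]; apply: (@le_derivative_bound ch (fun t => 1 + t) sh (fun=> 1)) => //.
  - by move=> u u0; apply: is_derive_eq; rewrite /GRing.scale/=; ring.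
  - by rewrite ch0 addr0.
  - by move=> u /andP[u0 ut]; apply: sh1; rewrite u0 (le_trans ut).
have sh2 t : 0 <= t <= z -> sh t <= t + t ^+ 2 / 2.
  move=> /andP[t0 tz]; apply: (@le_derivative_bound sh (fun t => t + t ^+ 2 / 2) ch (fun t => 1 + t)) => //.
  - by move=> u u0; apply: is_derive_eq; rewrite /GRing.scale/=; field.
  - by rewrite sh0 expr0n/= mul0r addr0.
  - by move=> u /andP[u0 ut]; apply: ch1; rewrite u0 (le_trans ut).
have ch2 t : 0 <= t <= z -> ch t <= 1 + t ^+ 2 / 2 + t ^+ 3 / 6.
  move=> /andP[t0 tz]; apply: (@le_derivative_bound ch (fun t => 1 + t ^+ 2 / 2 + t ^+ 3 / 6) sh (fun t => t + t ^+ 2 / 2)) => //.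
  - by move=> u u0; apply: is_derive_eq; rewrite /GRing.scale/=; field.
  - by rewrite ch0 !expr0n/= !mul0r !addr0.
  - by move=> u /andP[u0 ut]; apply: sh2; rewrite u0 (le_trans ut).
apply: (@le_derivative_bound sh (fun t => t + t ^+ 3 / 6 + t ^+ 4 / 24) ch (fun t => 1 + t ^+ 2 / 2 + t ^+ 3 / 6)) => //.
- by move=> u u0; apply: is_derive_eq; rewrite /GRing.scale/=; field.
- by rewrite sh0 !expr0n/= !mul0r !addr0.
Qed.

(** This is [sinh (y / 2) / (y / 2)], the even factor of [expR y - 1]. *)
Definition sinhc (y : R) : R := (expR (y / 2) - expR (- (y / 2))) / y.

Lemma sinhc_ge y : 0 < y -> 1 + y ^+ 2 / 24 <= sinhc y.
Proof.
move=> y0; have := @sh_ge (y / 2); rewrite /sh /sinhc => h0; have {h0}h := h0 ltac:(lra).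
rewrite ler_pdivlMr//; move: h; rewrite !expr_div_n; set e := _ - _.
have -> : (1 + y ^+ 2 / 24) * y = 2 * (y / 2 + y ^+ 3 / 2 ^+ 3 / 6) by field.
lra.
Qed.

Lemma sinhc_le y : 0 < y <= 1 -> sinhc y <= 1 + y ^+ 2 / 24 + y ^+ 3 / 192.
Proof.
move=> /andP[y0 y1]; have := @sh_le (y / 2); rewrite /sh /sinhc => h0; have {h0}h := h0 ltac:(lra).
rewrite ler_pdivrMr//; move: h; rewrite !expr_div_n; set e := _ - _.
have -> : (1 + y ^+ 2 / 24 + y ^+ 3 / 192) * y =
  2 * (y / 2 + y ^+ 3 / 2 ^+ 3 / 6 + y ^+ 4 / 2 ^+ 4 / 24) by field.
lra.
Qed.

Lemma onePx_powRN (a x : R) : 0 < a -> 0 <= x ->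
  1 - a * x <= (1 + x) `^ (- a) <= 1 - a * x + a * (a + 1) / 2 * x ^+ 2.
Proof.
move=> a0 x0.
have D (s t : R) : 0 <= t -> is_derive t (1 : R) (fun u => (1 + u) `^ s) (s * (1 + t) `^ (s - 1)).
  by move=> t0; apply: is_derive1_powR_1p; lra.
apply/andP; split.
- apply: (@le_derivative_bound (fun t => 1 - a * t) (fun t => (1 + t) `^ (- a)) (fun=> - a)
    (fun t => - a * (1 + t) `^ (- a - 1))) => //.
  + by move=> t t0; apply: is_derive_eq; rewrite /GRing.scale/=; ring.
  + by rewrite mulr0 subr0 addr0 powR1.
  + move=> t /andP[t0 _].
    rewrite ler_nMr ?oppr_lt0// -[leRHS](powRr0 (1 + t)) ler_powR//; lra.
- apply: (@le_derivative_bound (fun u => (1 + u) `^ (- a)) (fun t => 1 - a * t + a * (a + 1) / 2 * t ^+ 2)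
    (fun t => - a * (1 + t) `^ (- a - 1)) (fun t => - a + a * (a + 1) * t)) => //.
  + by move=> t t0; apply: is_derive_eq; rewrite /GRing.scale/=; field.
  + by rewrite addr0 powR1 !mulr0 expr0n/= mulr0; lra.
  + move=> t /andP[t0 _].
    apply: (@le_derivative_bound (fun u => - a * (1 + u) `^ (- a - 1)) (fun t => - a + a * (a + 1) * t)
      (fun u => - a * ((- a - 1) * (1 + u) `^ (- a - 1 - 1))) (fun=> a * (a + 1))) => //.
    * move=> u u0; have H := D (- a - 1) u u0.
      by apply: is_derive_eq; rewrite /GRing.scale/=; ring.
    * by move=> u u0; apply: is_derive_eq; rewrite /GRing.scale/=; ring.
    * by rewrite addr0 powR1; lra.
    * move=> u /andP[u0 _].
      rewrite [leLHS](_ : _ = a * (a + 1) * (1 + u) `^ (- a - 1 - 1)); last by ring.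
      rewrite ler_piMr ?mulr_ge0//; [lra|lra|].
      rewrite -[leRHS](powRr0 (1 + u)) ler_powR//; lra.
Qed.

(** The expansion at 0 that is integrated in [gw_watson]. Up to 1 it combines the
    expansions of sinh and of a negative power of [1 + x]; beyond 1 it holds because
    the power lies between 0 and 1 while [y ^+ 3] dominates [y ^+ 2]. *)
Lemma sinhc_powRN (a y : R) : 0 < a < 1 -> 0 < y ->
  `|sinhc y `^ (- a) - 1 + a / 24 * y ^+ 2| <= 2 * y ^+ 3.
Proof.
move=> /andP[a0 a1] y0; set x := sinhc y - 1.
have xE : sinhc y = 1 + x by rewrite /x; lra.
have xge : y ^+ 2 / 24 <= x by have := sinhc_ge y0; rewrite xE; lra.
have y2 : 0 < y ^+ 2 by rewrite exprn_gt0.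
have y3 : 0 < y ^+ 3 by rewrite exprn_gt0.
have x0 : 0 <= x by lra.
rewrite xE; have [y1|y1] := leP y 1.
- have xle : x <= y ^+ 2 / 24 + y ^+ 3 / 192.
    by have := @sinhc_le y; rewrite xE y0 y1 => /(_ isT); lra.
  have /andP[lo hi] := onePx_powRN a0 x0.
  have y32 : y ^+ 3 <= y ^+ 2 by rewrite exprSr ler_piMr// ltW.
  have xx : x ^+ 2 <= y ^+ 3.
    have -> : y ^+ 3 = y * y ^+ 2 by rewrite exprS.
    have xy : x <= y ^+ 2 by lra.
    have yy : y ^+ 2 <= y by rewrite expr2 ler_piMr// ltW.
    rewrite expr2 ler_pM//; lra.
  have aa : a * (a + 1) / 2 * x ^+ 2 <= y ^+ 3.
    apply: le_trans xx; rewrite ler_piMl ?sqr_ge0//; nra.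
  rewrite ler_norml; apply/andP; split; nra.
- have px : (1 + x) `^ (- a) <= 1.
    by rewrite -[leRHS](powRr0 (1 + x)) ler_powR//; lra.
  have px0 := powR_ge0 (1 + x) (- a).
  have y32 : y ^+ 2 <= y ^+ 3 by rewrite [leRHS]exprSr ler_peMr// ltW.
  have y21 : 1 <= y ^+ 2 by rewrite exprn_ege1// ltW.
  rewrite ler_norml; apply/andP; split; nra.
Qed.

Lemma Gamma_integrand_continuous s t y : 0 < y ->
  {for y, continuous (fun y => y `^ (s - 1) * expR (- (t * y)))}.
Proof.
move=> y0; have H := is_derive1_powR (s - 1) y0.
exact: is_derive1_continuous.
Qed.

Lemma Gamma_integrand_measurable s t : measurable_fun (`]0, +oo[ : set R)
  (fun y => y `^ (s - 1) * expR (- (t * y))).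
Proof. by apply: measurable_fun_0y => y; exact: Gamma_integrand_continuous. Qed.

(** This is the derivative of [(y / (1 + y)) `^ s], whose limits at 0 and at infinity
    are 0 and 1. It behaves like the integrand of Gamma at 0 and decays like a power
    at infinity, so one majorant serves both ends. *)
Let Gamma_majorant (s y : R) := s * y `^ (s - 1) * (1 + y) `^ (- s - 1).

Let Gamma_majorant_continuous s y : 0 < y -> {for y, continuous (Gamma_majorant s)}.
Proof.
move=> y0; have y1 : 0 < 1 + y by lra.
have H := is_derive1_powR (s - 1) y0.
have H1 := is_derive1_powR_1p (- s - 1) y1.
apply: continuousM; last exact: (is_derive1_continuous H1).
exact: is_derive1_continuous.
Qed.

Let Gamma_majorant_integral s : 0 < s ->
  (\int[mu]_(y in `]0%R, +oo[) (Gamma_majorant s y)%:E = 1%:E)%E.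
Proof.
move=> s0.
have D (y : R) : 0 < y -> is_derive y (1 : R) (fun y => y `^ s * (1 + y) `^ (- s))
    (Gamma_majorant s y).
  move=> y0; have y1 : 0 < 1 + y by lra.
  have H := is_derive1_powR s y0.
  have H3 := is_derive1_powR_1p (- s) y1.
  apply: (is_derive_eq (is_deriveM H H3)).
  rewrite /GRing.scale/= /Gamma_majorant.
  have -> : y `^ s = y * y `^ (s - 1) by rewrite mulr_powRB1// ltW.
  have -> : (1%R + y) `^ (- s) = (1 + y) * (1 + y) `^ (- s - 1).
    by rewrite -{2}(powRr1 (ltW y1)) -powRD ?(gt_eqF y1) ?implybT//; congr (_ `^ _); ring.
  ring.
rewrite (@ge0_integral_FTC_0y _ _ (fun y => y `^ s * (1 + y) `^ (- s)) 0 1) ?subr0//.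
- by move=> y y0; exact: Gamma_majorant_continuous.
- by move=> y y0; rewrite /Gamma_majorant !mulr_ge0 ?powR_ge0// ltW.
- rewrite -[X in _ --> X](mul0r (1 `^ (- s))); apply: cvgM; first exact: powR_cvg0.
  apply: cvg_at_right_filter.
  have H1 := is_derive1_powR (- s) (@ltr01 R).
  have := is_derive1_continuous H1; rewrite /continuous_at => h.
  apply: (@cvg_comp _ _ _ (fun y : R => 1 + y) (fun y => y `^ (- s)) _ _ _ _ h).
  have : (1 + y : R) @[y --> (0 : R)] --> (1 + 0 : R).
    by apply: cvgD; [exact: cvg_cst|exact: cvg_id].
  by rewrite addr0.
- have E : {near +oo, (fun y : R => (1 - (1 + y)^-1) `^ s) =1 (fun y => y `^ s * (1 + y) `^ (- s))}.
    near=> y; have y0 : 0 < y by near: y; exact: nbhs_pinfty_gt.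
    have -> : 1 - (1 + y)^-1 = y * (1 + y)^-1 by field; lra.
    rewrite powRM ?invr_ge0; [|lra|lra]; congr (_ * _).
    by rewrite -powR_inv1 -?powRrM ?mulN1r//; lra.
  apply: cvg_trans (near_eq_cvg E) _.
  have H1 := is_derive1_powR s (@ltr01 R).
  have := is_derive1_continuous H1; rewrite /continuous_at => h.
  have {}h : (y `^ s) @[y --> (1 : R)] --> (1 : R) by move: h; rewrite /prop_for powR1.
  have h2 : (1 - (1 + y)^-1) @[y --> +oo] --> (1 : R).
    have h3 : ((1 + y)^-1 : R) @[y --> +oo] --> (0 : R).
      apply/gtr0_cvgV0; first by near=> y; have : 0 < y by []; lra.
      by apply/cvgryPge => A; near=> y; have : A <= y by []; lra.
    have : ((1 : R) - (1 + y)^-1) @[y --> +oo] --> (1 - 0 : R).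
      by apply: cvgB => //; exact: cvg_cst.
    by rewrite subr0.
  exact: (cvg_comp _ _ h2 h).
Unshelve. all: by end_near. Qed.

Let Gamma_majorantP s : 0 < s -> exists K, 0 <= K /\
  forall y, 0 < y -> y `^ (s - 1) * expR (- y) <= K * Gamma_majorant s y.
Proof.
move=> s0; pose n := (Num.truncn (s + 1)).+1.
have sn : s + 1 < n%:R by exact: truncnS_gt.
have n0 : (0 : R) < n%:R by rewrite ltr0n.
exists (n%:R ^+ n / s); split; first by rewrite divr_ge0 ?exprn_ge0// ltW.
move=> y y0; have y1 : 0 < 1 + y by lra.
have h : (1 + y) / n%:R <= expR (y / n%:R).
  apply: le_trans (expR_ge1Dx _); rewrite mulrDl lerD2r mul1r.
  by rewrite invf_le1// ler1n.
have h2 : ((1 + y) / n%:R) ^+ n <= expR y.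
  have -> : expR y = expR (y / n%:R) ^+ n.
    by rewrite -expRM_natr mulfVK// gt_eqF.
  apply: lerXn2r => //; rewrite qualifE/=.
    by rewrite divr_ge0// ltW.
  exact: expR_ge0.
have h3 : (1 + y) `^ (s + 1) <= (1 + y) ^+ n.
  by rewrite -powR_mulrn ?ler_powR; lra.
have p0 : 0 < (1 + y) `^ (s + 1) by rewrite powR_gt0.
have n0' : 0 < n%:R ^+ n :> R by rewrite exprn_gt0.
have key : expR (- y) <= n%:R ^+ n * (1 + y) `^ (- s - 1).
  rewrite -opprD powRN expRN ler_pdivlMr// ler_pdivrMl ?expR_gt0//.
  rewrite (le_trans h3)// -ler_pdivrMr//.
  by move: h2; rewrite expr_div_n.
rewrite /Gamma_majorant.
have -> : n%:R ^+ n / s * (s * y `^ (s - 1) * (1 + y) `^ (- s - 1)) =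
    y `^ (s - 1) * (n%:R ^+ n * (1 + y) `^ (- s - 1)) by field; rewrite gt_eqF.
by rewrite ler_pM2l ?powR_gt0.
Qed.

Lemma integrable_Gamma s : 0 < s ->
  mu.-integrable `]0%R, +oo[ (EFin \o (fun y => y `^ (s - 1) * expR (- y))).
Proof.
move=> s0; have [K [K0 HK]] := Gamma_majorantP s0.
have mD : measurable (`]0, +oo[ : set R) by exact: measurable_itv.
have mF : measurable_fun (`]0, +oo[ : set R) (fun y => y `^ (s - 1) * expR (- y)).
  have := Gamma_integrand_measurable s 1; apply: eq_measurable_fun => y _.
  by rewrite mul1r.
have Mi : mu.-integrable `]0%R, +oo[ (EFin \o Gamma_majorant s).
  apply: (ge0_integrable_of_integral _ _ (Gamma_majorant_integral s0)) => //.
  - by apply: measurable_fun_0y => y y0; exact: Gamma_majorant_continuous.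
  - move=> y /=; rewrite in_itv/= andbT => y0.
    by rewrite /Gamma_majorant !mulr_ge0 ?powR_ge0// ltW.
have KMi : mu.-integrable `]0%R, +oo[ (EFin \o (fun y => K * Gamma_majorant s y)).
  exact: integrable_scale.
apply: (integrable_dominated _ _ KMi) => //.
move=> y /=; rewrite in_itv/= andbT => y0.
by rewrite ger0_norm ?HK// mulr_ge0 ?powR_ge0 ?expR_ge0.
Qed.

Lemma Gamma_scale s t : 0 < s -> 0 < t ->
  (\int[mu]_(y in `]0%R, +oo[) (y `^ (s - 1) * expR (- (t * y)))%:E
    = (Gamma s * t `^ (- s))%:E)%E.
Proof.
move=> s0 t0.
have E : ((t `^ s)%:E * \int[mu]_(y in `]0%R, +oo[) (y `^ (s - 1) * expR (- (t * y)))%:E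
    = (Gamma s)%:E)%E.
  rewrite /Gamma /Rintegral fineK; last first.
    by apply: integrable_fin_num => //; exact: integrable_Gamma.
  rewrite [RHS](ge0_integral_scale_0y t0)//.
  - rewrite -ge0_integralZl ?lee_fin ?powR_ge0//.
    + apply: eq_integral => y; rewrite inE/= in_itv/= andbT => y0.
      rewrite -EFinM powRM ?(ltW t0) ?(ltW y0)//.
      by congr (_%:E); rewrite -(mulr_powRB1 (ltW t0) s0); ring.
    + by apply: measurable_fun_EFin; exact: Gamma_integrand_measurable.
    + by move=> y _; rewrite lee_fin mulr_ge0 ?powR_ge0 ?expR_ge0.
  - move=> y y0; have H := is_derive1_powR (s - 1) y0.
    exact: is_derive1_continuous.
  - by move=> y _; rewrite mulr_ge0 ?powR_ge0 ?expR_ge0.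
have ts : t `^ s != 0 by rewrite gt_eqF// powR_gt0.
rewrite powRN EFinM -E muleC muleA -EFinM mulVf// mul1e//.
Qed.

Lemma integrable_Gamma_integrand s t : 0 < s -> 0 < t ->
  mu.-integrable `]0%R, +oo[ (EFin \o (fun y => y `^ (s - 1) * expR (- (t * y)))).
Proof.
move=> s0 t0; apply: (ge0_integrable_of_integral _ _ (Gamma_scale s0 t0)) => //.
- exact: Gamma_integrand_measurable.
- by move=> y _; rewrite mulr_ge0 ?powR_ge0 ?expR_ge0.
Qed.

Lemma ge0_integral_gt0_0y (f : R -> R) (c : R) : 0 < c ->
  measurable_fun (`]0, +oo[ : set R) f -> (forall y : R, 0 < y -> 0 <= f y) ->
  (forall y : R, 1 <= y <= 2 -> c <= f y) ->
  (c%:E <= \int[mu]_(y in `]0%R, +oo[) (f y)%:E)%E.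
Proof.
move=> c0 mf f0 fc.
have S : `[1, 2] `<=` (`]0, +oo[ : set R).
  by move=> y /=; rewrite !in_itv/= => /andP[]; lra.
apply: (@le_trans _ _ (\int[mu]_(y in `[1%R, 2%R]) (f y)%:E)%E); last first.
  apply: ge0_subset_integral => //; first exact/measurable_EFinP.
  by move=> y /=; rewrite in_itv/= andbT lee_fin; exact: f0.
apply: (@le_trans _ _ (\int[mu]_(y in `[1%R, 2%R]) c%:E)%E).
  rewrite integral_cst//= lebesgue_measure_itv/= lte_fin ltr1n.
  by rewrite -EFinB -EFinM lee_fin; lra.
apply: ge0_le_integral => //.
- by move=> y _; rewrite lee_fin ltW.
- by apply: measurable_fun_EFin; exact: measurable_funS mf.
Qed.

Lemma Gamma_gt0 s : 0 < s <= 1 -> 0 < Gamma s.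
Proof.
move=> /andP[s0 s1].
have c0 : 0 < 2 `^ (s - 1) * expR (- 2) :> R by rewrite mulr_gt0 ?powR_gt0 ?expR_gt0.
apply: (lt_le_trans c0); rewrite -lee_fin /Gamma /Rintegral fineK; last first.
  by apply: integrable_fin_num => //; exact: integrable_Gamma.
apply: ge0_integral_gt0_0y => //.
- have := Gamma_integrand_measurable s 1; apply: eq_measurable_fun => y _.
  by rewrite mul1r.
- by move=> y _; rewrite mulr_ge0 ?powR_ge0 ?expR_ge0.
- move=> y /andP[y1 y2]; rewrite ler_pM ?powR_ge0 ?expR_ge0 ?ler_expR ?lerN2//.
  by apply: ler_powR_npos; lra.
Qed.

End gamma.

(** * The coefficients of (1 - x)^-a *)

Section watson.
Variable R : realType.
Local Notation mu := (@lebesgue_measure R).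
Implicit Types a s t x y z : R.

Lemma sinhc_ge1 y : 0 < y -> 1 <= sinhc y.
Proof.
move=> y0; apply: le_trans (sinhc_ge y0); rewrite lerDl.
by rewrite divr_ge0// exprn_ge0// ltW.
Qed.

Lemma sinhc_gt0 y : 0 < y -> 0 < sinhc y.
Proof. by move=> y0; exact: lt_le_trans (sinhc_ge1 y0). Qed.

Section laplace.
Variable a : R.
Hypothesis a01 : 0 < a < 1.
Let a0 : 0 < a. Proof. by case/andP : a01. Qed.
Let a1 : a < 1. Proof. by case/andP : a01. Qed.

Let expm1_gt0 y : 0 < y -> 0 < expR y - 1.
Proof. by move=> y0; rewrite subr_gt0 expR_gt1. Qed.

(** Splitting off [expR (- (a / 2 * y))] leaves a factor that is even in [y]: its
    expansion has no term of order 1. *)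
Lemma expm1_powRN y : 0 < y ->
  (expR y - 1) `^ (- a) = expR (- (a / 2 * y)) * y `^ (- a) * sinhc y `^ (- a).
Proof.
move=> y0; have y2 : 0 < y / 2 by rewrite divr_gt0.
have sy := sinhc_gt0 y0.
have -> : expR y - 1 = expR (y / 2) * (y * sinhc y).
  have -> : y * sinhc y = expR (y / 2) - expR (- (y / 2)).
    by rewrite /sinhc mulrC divfK// gt_eqF.
  rewrite mulrBr -!expRD subrr expR0.
  by congr (expR _ - _); field.
have ys0 : 0 <= y * sinhc y := mulr_ge0 (ltW y0) (ltW sy).
rewrite (powRM _ (expR_ge0 _) ys0) (powRM _ (ltW y0) (ltW sy)) mulrA.
congr (_ * _ * _).
by rewrite -expRM; congr expR; field.
Qed.

Let expm1_le y : 0 < y -> (expR y - 1) `^ (- a) <= y `^ (1 - a - 1) * expR (- (a / 2 * y)).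
Proof.
move=> y0; rewrite expm1_powRN// (_ : 1 - a - 1 = - a); last by ring.
have h : sinhc y `^ (- a) <= 1.
  apply: (@le_trans _ _ (sinhc y `^ 0)); last by rewrite powRr0.
  by apply: ler_powR; [exact: sinhc_ge1|rewrite oppr_le0 ltW].
have h0 : 0 <= expR (- (a / 2 * y)) * y `^ (- a) by rewrite mulr_ge0 ?powR_ge0 ?expR_ge0.
by rewrite [leRHS]mulrC ler_piMr.
Qed.

Lemma expm1_continuous s y : 0 < y ->
  {for y, continuous (fun y => (expR y - 1) `^ s)}.
Proof.
move=> y0; have H2 : is_derive y (1 : R) (fun y => expR y - 1) (expR y).
  by apply: is_derive_eq; rewrite subr0.
exact: (is_derive1_continuous (@is_derive1_powR_comp _ (fun y => expR y - 1) s _ _ (expm1_gt0 y0) H2)).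
Qed.

Definition lap (j : nat) (y : R) := expR (- (j%:R * y)) * (expR y - 1) `^ (- a).

Let expN_continuous (c y : R) : {for y, continuous (fun y => expR (- (c * y)))}.
Proof. exact: is_derive1_continuous. Qed.

Lemma lap_continuous j y : 0 < y -> {for y, continuous (lap j)}.
Proof.
move=> y0; apply: continuousM; first exact: expN_continuous.
exact: expm1_continuous.
Qed.

Lemma lap_ge0 j y : 0 <= lap j y.
Proof. by rewrite mulr_ge0 ?expR_ge0 ?powR_ge0. Qed.

Lemma integrable_lap j : mu.-integrable `]0%R, +oo[ (EFin \o lap j).
Proof.
have s0 : 0 < 1 - a by rewrite subr_gt0.
have t0 : 0 < a / 2 by rewrite divr_gt0.
have Gi := integrable_Gamma_integrand s0 t0.
apply: (integrable_dominated _ _ Gi) => //.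
- by apply: measurable_fun_0y => y; exact: lap_continuous.
- move=> y /=; rewrite in_itv/= andbT => y0.
  rewrite ger0_norm ?lap_ge0// (le_trans _ (expm1_le y0))// ler_piMl ?powR_ge0//.
  by rewrite expR_le1 oppr_le0 mulr_ge0// ltW.
Qed.

(** Its value is [Gamma a * Gamma (1 - a)]. *)
Definition beta_const : R := \int[mu]_(y in `]0%R, +oo[) (expR y - 1) `^ (- a).

Lemma beta_constE : beta_const = \int[mu]_(y in `]0%R, +oo[) lap 0 y.
Proof.
by apply: eq_Rintegral => y _; rewrite /lap mul0r oppr0 expR0 mul1r.
Qed.

Lemma EFin_beta_const :
  (beta_const%:E = \int[mu]_(y in `]0%R, +oo[) ((expR y - 1) `^ (- a))%:E)%E.
Proof.
rewrite beta_constE EFin_Rintegral//; last exact: integrable_lap.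
by apply: eq_integral => y _; rewrite /lap mul0r oppr0 expR0 mul1r.
Qed.

Lemma beta_const_gt0 : 0 < beta_const.
Proof.
pose c := 2 : R; have c1 : 1 < c by rewrite ltr1n.
have c0 : 0 < (expR c - 1) `^ (- a) by rewrite powR_gt0// expm1_gt0// (lt_trans _ c1).
apply: (lt_le_trans c0); rewrite -lee_fin EFin_beta_const.
apply: (ge0_integral_gt0_0y c0).
- by apply: measurable_fun_0y => y; exact: expm1_continuous.
- by move=> y _; exact: powR_ge0.
- move=> y /andP[y1 y2]; have y0 : 0 < y by rewrite (lt_le_trans _ y1).
  have e2 := expm1_gt0 (lt_trans ltr01 c1); have e1 := expm1_gt0 y0.
  apply: ler_powR_npos; rewrite ?oppr_le0 ?(ltW a0)// expm1_gt0//=.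
  by rewrite lerD2r ler_expR.
Qed.

(** With [t = c + (d - c) * expR (- y)] the powers of [d - c] cancel, since the
    exponents [a - 1] and [- a] of the two factors add up to [- 1]. *)
Lemma beta_integral (c d : R) : c < d ->
  (\int[mu]_(t in `]c, d[) ((t - c) `^ (a - 1) * (d - t) `^ (- a))%:E = beta_const%:E)%E.
Proof.
move=> cd; have X0 : 0 < d - c by rewrite subr_gt0.
rewrite (ge0_integral_expR_substitution cd (G := fun t => (t - c) `^ (a - 1) * (d - t) `^ (- a))).
- rewrite EFin_beta_const; apply: eq_integral => y.
  rewrite inE/= in_itv/= andbT => y0; congr (_%:E).
  have e0 := expR_gt0 (- y).
  have e1 : 0 < 1 - expR (- y) by rewrite subr_gt0 expR_lt1 oppr_lt0.
  have -> : c + (d - c) * expR (- y) - c = (d - c) * expR (- y) by ring.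
  have -> : d - (c + (d - c) * expR (- y)) = (d - c) * (1 - expR (- y)) by ring.
  move: (d - c) X0 => X X0.
  rewrite !powRM ?(ltW X0) ?(ltW e0) ?(ltW e1)//.
  have -> : expR y - 1 = expR y * (1 - expR (- y)).
    by rewrite mulrBr mulr1 -expRD subrr expR0.
  rewrite powRM ?expR_ge0 ?(ltW e1)//.
  rewrite -!expRM.
  have XE : X `^ (a - 1) * X `^ (- a) * X = 1.
    rewrite -{3}(powRr1 (ltW X0)) -!powRD ?(gt_eqF X0) ?implybT//.
    by rewrite (_ : _ + 1 = 0) ?powRr0//; ring.
  have EE : expR (- y * (a - 1)) * expR (- y) = expR (y * - a).
    by rewrite -expRD; congr expR; ring.
  transitivity ((X `^ (a - 1) * X `^ (- a) * X) * (expR (- y * (a - 1)) * expR (- y)) * (1 - expR (- y)) `^ (- a)); first ring.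
  by rewrite XE EE mul1r.
- move=> t /andP[t0 tX]; have Xt0 : 0 < d - t by rewrite subr_gt0.
  have ct0 : 0 < t - c by rewrite subr_gt0.
  have H1 : is_derive t (1 : R) (fun t => t - c) (1 - 0) by exact: is_deriveB.
  have H2 := @is_derive1_powR_comp _ (fun t => t - c) (a - 1) t _ ct0 H1.
  have H3 : is_derive t (1 : R) (fun t => d - t) (0 - 1) by exact: is_deriveB.
  have H4 := @is_derive1_powR_comp _ (fun t => d - t) (- a) t _ Xt0 H3.
  apply: continuousM; last exact: (is_derive1_continuous H4).
  exact: (is_derive1_continuous H2).
- by move=> t _; rewrite mulr_ge0 ?powR_ge0.
Qed.

(** The coefficient of [x ^+ j] in the power series of [(1 - x) `^ (- a)]. *)
Definition gw (j : nat) : R := \prod_(i < j) ((i%:R + a) / i.+1%:R).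

Lemma gw0 : gw 0 = 1. Proof. by rewrite /gw big_ord0. Qed.
Lemma gwS j : gw j.+1 = gw j * ((j%:R + a) / j.+1%:R).
Proof. by rewrite /gw big_ord_recr. Qed.

(** Integrate the derivative of [expR (- (j.+1%:R * y)) * (expR y - 1) `^ (1 - a)],
    which vanishes at both ends. *)
Let lap_rec j : j.+1%:R * (\int[mu]_(y in `]0%R, +oo[) lap j.+1 y)
  = (j%:R + a) * (\int[mu]_(y in `]0%R, +oo[) lap j y).
Proof.
pose F y := expR (- (j.+1%:R * y)) * (expR y - 1) `^ (1 - a).
pose f y := j.+1%:R * lap j.+1 y - (j%:R + a) * lap j y.
have mD : measurable (`]0, +oo[ : set R) by [].
have ij : mu.-integrable `]0%R, +oo[ (EFin \o (fun y => (j%:R + a) * lap j y)).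
  by apply: integrable_scale => //; exact: integrable_lap.
have ij1 : mu.-integrable `]0%R, +oo[ (EFin \o (fun y => j.+1%:R * lap j.+1 y)).
  by apply: integrable_scale => //; exact: integrable_lap.
have fi : mu.-integrable `]0%R, +oo[ (EFin \o f).
  exact: integrable_sub.
have : (\int[mu]_(y in `]0%R, +oo[) (f y)%:E = (0 - 0)%:E)%E.
  apply: (integral_FTC_0y (F := F)) => //.
  - move=> y y0; apply: continuousB; apply: continuousM; [exact: cvg_cst| |exact: cvg_cst|].
    + exact: lap_continuous.
    + exact: lap_continuous.
  - move=> y y0; have e0 := expm1_gt0 y0.
    have H2 : is_derive y (1 : R) (fun y => expR y - 1) (expR y).
      by apply: is_derive_eq; rewrite subr0.
    have H3 := @is_derive1_powR_comp _ (fun y => expR y - 1) (1 - a) _ _ e0 H2.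
    have H4 : is_derive y (1 : R) (fun y => expR (- (j.+1%:R * y))) (- j.+1%:R * expR (- (j.+1%:R * y))).
      by apply: is_derive_eq; rewrite /GRing.scale/=; ring.
    apply: (is_derive_eq (is_deriveM H4 H3)).
    rewrite /GRing.scale/= /f /lap.
    have p1 : 0 < 1 - a by rewrite subr_gt0.
    have E0 : 1 - a - 1 = - a by ring.
    have E1 : (expR y - 1) `^ (1 - a) = (expR y - 1) * (expR y - 1) `^ (- a).
      by rewrite -(mulr_powRB1 (ltW e0) p1) E0.
    have E2 : expR (- (j%:R * y)) = expR (- (j.+1%:R * y)) * expR y.
      by rewrite -expRD; congr expR; rewrite -natr1; ring.
    rewrite E0 E1 E2 -natr1; ring.
  - suff : F y @[y --> 0^'+] --> expR (- (j.+1%:R * 0)) * 0 by rewrite mulr0.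
    apply: cvgM.
      by apply: cvg_at_right_filter; exact: expN_continuous.
    have ea : 0 < 1 - a by rewrite subr_gt0.
    have h := powR_cvg0 ea; apply: (cvg_comp _ _ _ h).
    have h2 : expR y - 1 @[y --> (0 : R)] --> (0 : R).
      have : expR y - 1 @[y --> (0 : R)] --> (expR 0 - 1 : R).
        by apply: cvgB; [exact: continuous_expR|exact: cvg_cst].
      by rewrite expR0 subrr.
    move=> A /h2 [e /= e0 he]; exists e => // y ye y0.
    by apply: he => //; exact: expm1_gt0.
  - apply: (@squeeze_cvgr _ _ _ _ (cst 0) (fun y => expR (- (a * y)))).
    + near=> y; rewrite mulr_ge0 ?expR_ge0 ?powR_ge0//=.
      have y0 : 0 < y by [].
      have h : (expR y - 1) `^ (1 - a) <= expR (y * (1 - a)).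
        rewrite expRM; apply: ge0_ler_powR; rewrite ?nnegrE ?expR_ge0 ?(ltW (expm1_gt0 y0))//.
        - by rewrite subr_ge0 ltW.
        - by rewrite gerBl.
      apply: (le_trans (ler_wpM2l (expR_ge0 _) h)); rewrite -expRD ler_expR.
      have -> : - (j.+1%:R * y) + y * (1 - a) = - (a * y) - j%:R * y.
        by rewrite -natr1; ring.
      by rewrite gerBl mulr_ge0// ltW.
    + exact: cvg_cst.
    + have h : a * y @[y --> +oo] --> +oo.
        by apply/cvgryPge => A; near=> y; rewrite -ler_pdivrMl//.
      exact: (cvg_comp _ _ h (@cvgr_expR R)).
rewrite subr0 -EFin_Rintegral// RintegralB// RintegralZl//; last exact: integrable_lap.
rewrite RintegralZl//; last exact: integrable_lap.
move=> [] /eqP; rewrite subr_eq0 => /eqP; exact.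
Unshelve. all: by end_near. Qed.

(** Both sides satisfy the same recurrence in [j]. *)
Lemma gw_laplace j : beta_const * gw j = \int[mu]_(y in `]0%R, +oo[) lap j y.
Proof.
elim: j => [|j ih]; first by rewrite gw0 mulr1 beta_constE.
have j0 : j.+1%:R != 0 :> R by rewrite pnatr_eq0.
apply: (mulfI j0); rewrite lap_rec -ih gwS.
have -> : j.+1%:R * (beta_const * (gw j * ((j%:R + a) / j.+1%:R))) =
  (j%:R + a) * (beta_const * gw j) * (j.+1%:R / j.+1%:R) by ring.
by rewrite divff// mulr1.
Qed.

(** Watson's lemma for the Laplace integral of [gw_laplace]. Measured from
    [j%:R + a / 2] instead of [j%:R], the expansion has no term of relative
    order 1, because the integrand is then an even function times a power. *)
Lemma gw_watson j (t := j%:R + a / 2) :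
  `|beta_const * gw j - Gamma (1 - a) * t `^ (a - 1)
     + a / 24 * Gamma (3 - a) * t `^ (a - 3)| <= 2 * Gamma (4 - a) * t `^ (a - 4).
Proof.
have t0 : 0 < t by rewrite ltr_wpDl// divr_gt0.
pose gk s y := y `^ (s - 1) * expR (- (t * y)).
have gki s : 0 < s -> mu.-integrable `]0%R, +oo[ (EFin \o gk s).
  by move=> s0; exact: integrable_Gamma_integrand.
have gkE s : 0 < s -> \int[mu]_(y in `]0%R, +oo[) gk s y = Gamma s * t `^ (- s).
  by move=> s0; rewrite /Rintegral (Gamma_scale s0 t0).
have p1 : 0 < 1 - a by rewrite subr_gt0.
have p3 : 0 < 3 - a by rewrite subr_gt0 (lt_trans a1)// ltr1n.
have p4 : 0 < 4 - a by rewrite subr_gt0 (lt_trans a1)// ltr1n.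
have -> : a - 1 = - (1 - a) by ring.
have -> : a - 3 = - (3 - a) by ring.
have -> : a - 4 = - (4 - a) by ring.
rewrite -!mulrA -!gkE// gw_laplace.
have i1 : mu.-integrable `]0%R, +oo[ (EFin \o (fun y => lap j y - gk (1 - a) y)).
  by apply: integrable_sub => //; [exact: integrable_lap|exact: gki].
have i3 : mu.-integrable `]0%R, +oo[ (EFin \o (fun y => a / 24 * gk (3 - a) y)).
  by apply: integrable_scale => //; exact: gki.
have i4 : mu.-integrable `]0%R, +oo[ (EFin \o (fun y => 2 * gk (4 - a) y)).
  by apply: integrable_scale => //; exact: gki.
rewrite mulrA -(RintegralB _ (integrable_lap j) (gki _ p1))//.
rewrite -(RintegralZl (a / 24) _ (gki _ p3))// -(RintegralZl 2 _ (gki _ p4))//.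
rewrite -(RintegralD _ i1 i3)//.
apply: Rintegral_dominated => //; first exact: integrable_add.
move=> y /=; rewrite in_itv/= andbT => y0.
rewrite /gk /lap expm1_powRN//.
have E3 : y `^ (3 - a - 1) = y `^ (- a) * y ^+ 2.
  rewrite -powR_mulrn ?(ltW y0)// -powRD ?(gt_eqF y0) ?implybT//.
  by congr (_ `^ _); ring.
have E4 : y `^ (4 - a - 1) = y `^ (- a) * y ^+ 3.
  rewrite -powR_mulrn ?(ltW y0)// -powRD ?(gt_eqF y0) ?implybT//.
  by congr (_ `^ _); ring.
have E1 : y `^ (1 - a - 1) = y `^ (- a) by congr (_ `^ _); ring.
have Ee : expR (- (t * y)) = expR (- (j%:R * y)) * expR (- (a / 2 * y)).
  by rewrite -expRD; congr expR; rewrite /t; ring.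
rewrite E1 E3 E4.
have key := sinhc_powRN a01 y0.
set P := y `^ (- a); set S := sinhc y `^ (- a) in key *; set X := expR (- (t * y)).
have X0 : 0 <= X by exact: expR_ge0.
have P0 : 0 <= P by exact: powR_ge0.
have -> : expR (- (j%:R * y)) * (expR (- (a / 2 * y)) * P * S) - P * X +
   a / 24 * (P * y ^+ 2 * X) = (P * X) * (S - 1 + a / 24 * y ^+ 2).
  by rewrite /X Ee; ring.
rewrite normrM ger0_norm ?mulr_ge0//.
have -> : 2 * (P * y ^+ 3 * X) = (P * X) * (2 * y ^+ 3) by ring.
by rewrite ler_wpM2l// mulr_ge0.
Qed.

End laplace.
End watson.

(** * Taylor's formula *)

Section taylor.
Variable R : realType.
Implicit Types (f g : R -> R) (s t x C : R).

(** Iterating this step produces the factorials in Taylor's formula. *)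
Lemma norm_le_of_derive f df C n :
  (forall t : R, 0 <= t <= 1 -> is_derive t (1 : R) f (df t)) -> f 0 = 0 ->
  (forall t : R, 0 <= t <= 1 -> `|df t| <= C * t ^+ n) ->
  forall t : R, 0 <= t <= 1 -> `|f t| <= C / n.+1%:R * t ^+ n.+1.
Proof.
move=> Df f0 dfC t /andP[]; rewrite le_eqVlt => /predU1P[<- _|t0 t1].
  by rewrite f0 normr0 expr0n/= mulr0.
have n0 : n.+1%:R != 0 :> R by rewrite pnatr_eq0.
have main (e : R) : `|e| = 1 -> e * f t <= C / n.+1%:R * t ^+ n.+1.
  move=> e1; pose h (s : R) := C / n.+1%:R * s ^+ n.+1 - e * f s.
  have Dh s : 0 <= s <= 1 -> is_derive s (1 : R) h (C * s ^+ n - e * df s).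
    move=> s01; have H := Df s s01.
    have Hx : is_derive s (1 : R) (fun s => s ^+ n.+1) (n.+1%:R * s ^+ n).
      have := is_deriveX n.+1 (is_derive_id s (1 : R)).
      rewrite /GRing.scale/= mulr1.
      by have -> : (id : R -> R) ^+ n.+1 = (fun s => s ^+ n.+1) by rewrite exprfctE.
    rewrite /h; apply: is_derive_eq; rewrite /GRing.scale/=.
    by field; rewrite addrC natr1.
  have [s /[!in_itv]/= /andP[s0 st] E] : exists2 s, s \in `]0, t[ &
      h t - h 0 = (C * s ^+ n - e * df s) * (t - 0).
    apply: (@MVT _ _ (fun s => C * s ^+ n - e * df s)) => //.
      by move=> s /[!in_itv]/= /andP[s0 st]; apply: Dh; rewrite !ltW//= (lt_le_trans st).
    apply: continuous_in_subspaceT => s /[!inE]/= /[!in_itv]/= /andP[s0 st].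
    by apply: (is_derive1_continuous (Dh s _)); rewrite s0 (le_trans st).
  have : 0 <= (C * s ^+ n - e * df s) * (t - 0).
    rewrite subr0 mulr_ge0 ?(ltW t0)// subr_ge0.
    have s01 : 0 <= s <= 1 by rewrite !ltW//= (lt_le_trans st).
    apply: le_trans (dfC s s01); apply: (le_trans (ler_norm _)).
    by rewrite normrM e1 mul1r.
  by rewrite -E /h f0 expr0n/= !mulr0 subr0 subr0 subr_ge0.
rewrite ler_norml; apply/andP; split.
- by have := main (-1); rewrite normrN1 mulN1r => /(_ erefl); rewrite lerNl.
- by have := main 1; rewrite normr1 mul1r => /(_ erefl).
Qed.

Lemma is_derive_line f (df x d s : R) : is_derive (x + s * d) (1 : R) f df ->
  is_derive s (1 : R) (fun s => f (x + s * d)) (d * df).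
Proof.
move=> H; have H2 : is_derive s (1 : R) (fun s => x + s * d) d.
  by apply: is_derive_eq; rewrite /GRing.scale/=; ring.
by have := @is_derive1_comp _ f (fun s => x + s * d) s _ _ H H2; rewrite mulrC.
Qed.

(** Differentiability is asked for along the segment only, since powers and local
    antiderivatives are differentiable on an interval only. *)
Lemma taylor (F : nat -> R -> R) n C x y :
  (forall k, (k < n)%N -> forall s : R, 0 <= s <= 1 ->
     is_derive (x + s * (y - x)) (1 : R) (F k) (F k.+1 (x + s * (y - x)))) ->
  (forall s : R, 0 <= s <= 1 -> `|F n (x + s * (y - x))| <= C) ->
  `|F 0%N y - \sum_(k < n) (y - x) ^+ k / k`!%:R * F k x| <= C / n`!%:R * `|y - x| ^+ n.
Proof.
set d := y - x => DF FC.
suff /(_ 1) : forall t : R, 0 <= t <= 1 -> `|F 0%N (x + t * d) - \sum_(k < n) (t * d) ^+ k / k`!%:R * F k x|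
    <= C * `|d| ^+ n / n`!%:R * t ^+ n.
  by rewrite ler01 lexx mul1r subrKC expr1n mulr1 mulrAC; apply.
elim: n F DF FC => [|n ih] F DF FC t t01.
  by rewrite big_ord0 subr0 !expr0 fact0 divr1 !mulr1; exact: FC.
have -> : C * `|d| ^+ n.+1 / n.+1`!%:R = C * `|d| ^+ n.+1 / n`!%:R / n.+1%:R.
  by rewrite factS natrM invfM; ring.
pose S (G : nat -> R -> R) (m : nat) (s : R) := \sum_(k < m) (s * d) ^+ k / k`!%:R * G k x.
have DS m (s : R) : is_derive s (1 : R) (S F m.+1) (d * S (fun k => F k.+1) m s).
  elim: m => [|m ihm].
    rewrite /S big_ord0 mulr0 (_ : (fun s => _) = cst (F 0%N x)); first exact: is_derive_cst.
    by apply/funext => r; rewrite big_ord_recl big_ord0 expr0 fact0 divr1 mul1r addr0.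
  rewrite (_ : S F m.+2 = fun s => S F m.+1 s + (s * d) ^+ m.+1 / m.+1`!%:R * F m.+1 x); last first.
    by apply/funext => r; rewrite /S big_ord_recr.
  have H1 : is_derive s (1 : R) (fun s => s * d) d by apply: is_derive_eq; rewrite /GRing.scale/=; ring.
  have H2 : is_derive s (1 : R) (fun s => (s * d) ^+ m.+1) (m.+1%:R * (s * d) ^+ m * d).
    have := is_deriveX m.+1 H1; rewrite /GRing.scale/=.
    by have -> : (fun s : R => s * d) ^+ m.+1 = (fun s => (s * d) ^+ m.+1) by rewrite exprfctE.
  apply: is_derive_eq; rewrite /GRing.scale/= /S big_ord_recr/= factS natrM.
  have m0 : m`!%:R != 0 :> R by rewrite pnatr_eq0 -lt0n fact_gt0.
  have m1 : m.+1%:R != 0 :> R by rewrite pnatr_eq0.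
  move: (\sum_(i < m) _) (m.+1%:R) (m`!%:R) m0 m1 => T f N f0 N0.
  by field; rewrite f0.
move: t t01; apply: (@norm_le_of_derive (fun s => F 0%N (x + s * d) - S F n.+1 s)
  (fun s => d * (F 1%N (x + s * d) - S (fun k => F k.+1) n s))).
- move=> t t01; have H1 := is_derive_line (DF 0%N isT t t01); have H2 := DS n t.
  by apply: is_derive_eq; ring.
- rewrite /S mul0r addr0 big_ord_recl/= expr0 fact0 divr1 mul1r big1 ?addr0 ?subrr// => k _.
  by rewrite expr0n/= !mul0r.
- move=> t t01; rewrite normrM exprS.
  have := ih (fun k => F k.+1) (fun k kn => DF k.+1 kn) FC t t01.
  have -> : C * (`|d| * `|d| ^+ n) / n`!%:R * t ^+ n = `|d| * (C * `|d| ^+ n / n`!%:R * t ^+ n) by ring.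
  by move=> h; rewrite ler_wpM2l.
Qed.

Lemma taylor1 f f1 C x y :
  (forall s : R, 0 <= s <= 1 -> is_derive (x + s * (y - x)) (1 : R) f (f1 (x + s * (y - x)))) ->
  (forall s : R, 0 <= s <= 1 -> `|f1 (x + s * (y - x))| <= C) ->
  `|f y - f x| <= C * `|y - x|.
Proof.
move=> D1 B; have := @taylor (fun k => if k is 1%N then f1 else f) 1 C x y.
rewrite big_ord_recl big_ord0 addr0 expr0 !fact0 (_ : 1`! = 1%N)// !divr1 mul1r; apply => // k.
by case: k.
Qed.

Lemma taylor2 f f1 f2 C x y :
  (forall s : R, 0 <= s <= 1 -> is_derive (x + s * (y - x)) (1 : R) f (f1 (x + s * (y - x)))) ->
  (forall s : R, 0 <= s <= 1 -> is_derive (x + s * (y - x)) (1 : R) f1 (f2 (x + s * (y - x)))) ->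
  (forall s : R, 0 <= s <= 1 -> `|f2 (x + s * (y - x))| <= C) ->
  `|f y - f x - (y - x) * f1 x| <= C / 2 * `|y - x| ^+ 2.
Proof.
move=> D1 D2 B; have := @taylor (nth f [:: f; f1; f2]) 2 C x y.
rewrite !big_ord_recr big_ord0/= add0r (_ : 0`! = 1%N)// (_ : 1`! = 1%N)// (_ : 2`! = 2%N)//.
have -> : f y - ((y - x) ^+ 0 / 1%:R * f x + (y - x) ^+ 1 / 1%:R * f1 x) = f y - f x - (y - x) * f1 x.
  by field.
by apply => // -[|[|]].
Qed.

Lemma taylor3 f f1 f2 f3 C x y :
  (forall s : R, 0 <= s <= 1 -> is_derive (x + s * (y - x)) (1 : R) f (f1 (x + s * (y - x)))) ->
  (forall s : R, 0 <= s <= 1 -> is_derive (x + s * (y - x)) (1 : R) f1 (f2 (x + s * (y - x)))) ->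
  (forall s : R, 0 <= s <= 1 -> is_derive (x + s * (y - x)) (1 : R) f2 (f3 (x + s * (y - x)))) ->
  (forall s : R, 0 <= s <= 1 -> `|f3 (x + s * (y - x))| <= C) ->
  `|f y - f x - (y - x) * f1 x - (y - x) ^+ 2 / 2 * f2 x| <= C / 6 * `|y - x| ^+ 3.
Proof.
move=> D1 D2 D3 B; have := @taylor (nth f [:: f; f1; f2; f3]) 3 C x y.
rewrite !big_ord_recr big_ord0/= add0r (_ : 0`! = 1%N)// (_ : 1`! = 1%N)// (_ : 2`! = 2%N)// (_ : 3`! = 6%N)//.
have -> : f y - ((y - x) ^+ 0 / 1%:R * f x + (y - x) ^+ 1 / 1%:R * f1 x + (y - x) ^+ 2 / 2%:R * f2 x) =
  f y - f x - (y - x) * f1 x - (y - x) ^+ 2 / 2 * f2 x by field.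
by apply => // -[|[|[|]]].
Qed.

Lemma taylor4 f f1 f2 f3 f4 C x y :
  (forall z : R, is_derive z (1 : R) f (f1 z)) -> (forall z : R, is_derive z (1 : R) f1 (f2 z)) ->
  (forall z : R, is_derive z (1 : R) f2 (f3 z)) -> (forall z : R, is_derive z (1 : R) f3 (f4 z)) ->
  (forall z, `|f4 z| <= C) ->
  `|f y - f x - (y - x) * f1 x - (y - x) ^+ 2 / 2 * f2 x - (y - x) ^+ 3 / 6 * f3 x|
    <= C / 24 * `|y - x| ^+ 4.
Proof.
move=> D1 D2 D3 D4 B; have := @taylor (nth f [:: f; f1; f2; f3; f4]) 4 C x y.
rewrite !big_ord_recr big_ord0/= add0r (_ : 0`! = 1%N)// (_ : 1`! = 1%N)// (_ : 2`! = 2%N)// (_ : 3`! = 6%N)// (_ : 4`! = 24%N)//.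
have -> : f y - ((y - x) ^+ 0 / 1%:R * f x + (y - x) ^+ 1 / 1%:R * f1 x + (y - x) ^+ 2 / 2%:R * f2 x
    + (y - x) ^+ 3 / 6%:R * f3 x) =
  f y - f x - (y - x) * f1 x - (y - x) ^+ 2 / 2 * f2 x - (y - x) ^+ 3 / 6 * f3 x by field.
by apply => // -[|[|[|[|]]]].
Qed.

End taylor.

(** * The weights and their convolution inverses *)

Section weights.
Variable R : realType.

Lemma grunwald_weight0 (a : R) : grunwald_weight a 0 = 1.
Proof. by rewrite /grunwald_weight /gen_binomial big_ord0 fact0 divr1 mulr1 expr0. Qed.

Lemma grunwald_weightS (a : R) k :
  grunwald_weight a k.+1 = grunwald_weight a k * ((k%:R - a) / k.+1%:R).
Proof.
rewrite /grunwald_weight /gen_binomial big_ord_recr/= factS natrM exprS invfM; ring.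
Qed.

Variable a : R.
Local Notation w := (grunwald_weight a).

Lemma grunwald_weight_pascal k :
  grunwald_weight (1 + a) k.+1 = w k.+1 - w k.
Proof.
elim: k => [|k ih].
  by rewrite !grunwald_weightS !grunwald_weight0; field.
rewrite grunwald_weightS ih !grunwald_weightS -(natr1 k.+1) -(natr1 k).
have k1 : k%:R + 1 != 0 :> R by rewrite natr1 pnatr_eq0.
have k2 : k%:R + 1 + 1 != 0 :> R by rewrite !natr1 pnatr_eq0.
by field; apply/andP.
Qed.

Hypothesis a01 : 0 < a < 1.
Let a0 : 0 < a. Proof. by case/andP : a01. Qed.
Let a1 : a < 1. Proof. by case/andP : a01. Qed.

Lemma grunwald_weight_le0 k : w k.+1 <= 0.
Proof.
elim: k => [|k ih]; first by rewrite grunwald_weightS grunwald_weight0 sub0r mul1r divr1 oppr_le0 ltW.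
rewrite grunwald_weightS mulr_le0_ge0// divr_ge0// subr_ge0.
by rewrite (le_trans (ltW a1))// ler1n.
Qed.

Lemma sum_grunwald_weight n : \sum_(k < n.+1) w k = - (n.+1%:R / a) * w n.+1.
Proof.
have a_neq0 : a != 0 by rewrite gt_eqF.
elim: n => [|n ih].
  by rewrite big_ord_recl big_ord0 grunwald_weightS grunwald_weight0; field.
rewrite big_ord_recr/= ih [in RHS]grunwald_weightS -(natr1 n.+1).
have n2 : 1 + n%:R + 1 != 0 :> R by rewrite (addrC 1) !natr1 pnatr_eq0.
by field; apply/andP.
Qed.

(** The first weight is 1, the others are nonpositive and the partial sums are
    nonnegative, so the negative part does not exceed 1. *)
Lemma sum_norm_grunwald_weight n : \sum_(k < n) `|w k| <= 2.
Proof.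
case: n => [|n]; first by rewrite big_ord0.
have : 0 <= \sum_(k < n.+1) w k.
  by rewrite sum_grunwald_weight mulNr -mulrN mulr_ge0 ?oppr_ge0 ?grunwald_weight_le0// divr_ge0// ltW.
rewrite !big_ord_recl grunwald_weight0 normr1.
rewrite [X in _ -> _ + X <= _](eq_bigr (fun k : 'I_n => - w (lift ord0 k))); last first.
  by move=> k _; rewrite ler0_norm// grunwald_weight_le0.
rewrite sumrN; lra.
Qed.

Let conv (A : nat -> R) n := \sum_(k < n.+1) w k * A (n - k)%N.

(** The identity [(1 - x) `^ a * (1 - x) `^ (- a) = 1] on coefficients. The
    logarithmic derivatives of the two factors are opposite, so [(1 - x) * f' = 0] for
    their product [f]: its coefficients satisfy [(m + 1) c_(m + 1) = m c_m]. *)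
Lemma conv_gw n : \sum_(k < n.+1) w k * gw a (n - k)%N = (n == 0)%:R.
Proof.
have key m : m.+1%:R * conv (gw a) m.+1 = m%:R * conv (gw a) m.
  transitivity (\sum_(k < m.+2) (k%:R * w k) * gw a (m.+1 - k)%N +
                \sum_(k < m.+2) w k * ((m.+1 - k)%:R * gw a (m.+1 - k)%N)).
    rewrite -big_split mulr_sumr; apply: eq_bigr => k _ /=.
    have km : (k <= m.+1)%N by rewrite -ltnS.
    have -> : m.+1%:R = k%:R + (m.+1 - k)%:R :> R by rewrite -natrD subnKC.
    by ring.
  rewrite big_ord_recl /= mul0r mul0r add0r.
  rewrite [X in _ + X]big_ord_recr/= subnn mul0r mulr0 addr0.
  rewrite -big_split mulr_sumr; apply: eq_bigr => k _ /=.
  have km : (k <= m)%N by rewrite -ltnS.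
  rewrite /bump/= add1n subSS grunwald_weightS.
  rewrite subSn// gwS.
  have k1 : k%:R + 1 != 0 :> R by rewrite natr1 pnatr_eq0.
  have k2 : (m - k)%:R + 1 != 0 :> R by rewrite natr1 pnatr_eq0.
  have -> : m%:R = k%:R + (m - k)%:R :> R by rewrite -natrD subnKC.
  rewrite -[in LHS](natr1 k) -[in LHS](natr1 (m - k)%N).
  by field; apply/andP.
elim: n => [|m ih].
  by rewrite big_ord_recl big_ord0 subn0 gw0 grunwald_weight0 mul1r addr0.
have m1 : m.+1%:R != 0 :> R by rewrite pnatr_eq0.
apply: (mulfI m1); have := key m; rewrite /conv ih => ->.
rewrite mulr0; case: m {ih m1} => [|m]; first by rewrite mul0r.
by rewrite mulr0.
Qed.

Let conv_cumul (A B : nat -> R) n : B 0 = A 0 -> (forall j, B j.+1 = B j + A j.+1) ->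
  conv B n.+1 = conv B n + conv A n.+1.
Proof.
move=> B0 BS; rewrite /conv big_ord_recr/= [X in _ = _ + X]big_ord_recr/= subnn B0 addrA; congr (_ + _).
rewrite -big_split/=; apply: eq_bigr => k _ /=.
have kn : (k <= n)%N by rewrite -ltnS.
by rewrite subSn// BS mulrDr.
Qed.

(** The coefficients of [(1 - x) `^ (- a - 1)] and of [(1 - x) `^ (- a - 2)], that
    is, the once and twice iterated partial sums of [gw a]. *)
Definition gw1 j := gw a j * ((j%:R + a) / a).
Definition gw2 j := gw a j * ((j%:R + a) * (j%:R + a + 1) / (a * (a + 1))).

Let a_neq0 : a != 0. Proof. by rewrite gt_eqF. Qed.
Let a1_neq0 : a + 1 != 0. Proof. by rewrite gt_eqF// addr_gt0. Qed.

Lemma conv_gw1 n : \sum_(k < n.+1) w k * gw1 (n - k)%N = 1.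
Proof.
have g0 : gw1 0 = gw a 0 by rewrite /gw1 gw0 add0r divff// mulr1.
elim: n => [|n ih].
  by rewrite big_ord_recl big_ord0 subn0 g0 gw0 grunwald_weight0 mul1r addr0.
have := @conv_cumul (gw a) gw1 n g0; rewrite /conv ih conv_gw/= addr0; apply => j.
rewrite /gw1 gwS -(natr1 j); have j1 : j%:R + 1 != 0 :> R by rewrite natr1 pnatr_eq0.
by field; apply/andP.
Qed.

Lemma conv_gw2 n : \sum_(k < n.+1) w k * gw2 (n - k)%N = n.+1%:R.
Proof.
have g0 : gw2 0 = gw1 0.
  by rewrite /gw1 /gw2 gw0; field; apply/andP.
have g1 : gw1 0 = 1 by rewrite /gw1 gw0 add0r divff// mulr1.
elim: n => [|n ih].
  by rewrite big_ord_recl big_ord0 subn0 g0 g1 grunwald_weight0 mul1r addr0.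
have := @conv_cumul gw1 gw2 n g0; rewrite /conv ih conv_gw1 natr1; apply => j.
rewrite /gw1 /gw2 gwS -(natr1 j); have j1 : j%:R + 1 != 0 :> R by rewrite natr1 pnatr_eq0.
by field; apply/and3P; split.
Qed.

End weights.

(** * Convolving the weights with powers *)

Section remainder.
Variable R : realType.
Implicit Types (s t x y : R).

Lemma sum_conv_le (u v : nat -> R) (U V : R) :
  (forall i, 0 <= u i) -> (forall i, 0 <= v i) ->
  (forall n, \sum_(i < n) u i <= U) -> (forall n, \sum_(i < n) v i <= V) ->
  forall n, \sum_(i < n) \sum_(k < i.+1) u k * v (i - k)%N <= U * V.
Proof.
move=> u0 v0 uU vV n.
have V0 : 0 <= V by have := vV 0; rewrite big_ord0.
have inner k m : \sum_(i < m | (k <= i)%N) v (i - k)%N <= V.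
  have [mk|/ltnW km] := leqP m k.
    by rewrite big1// => i ki; have := leq_trans (ltn_ord i) mk; rewrite ltnNge ki.
  rewrite -(subnKC km) big_split_ord/= [X in X + _]big1 ?add0r; last first.
    by move=> i ki; have := ltn_ord i; rewrite ltnNge ki.
  apply: le_trans (vV (m - k)%N); rewrite le_eqVlt; apply/orP; left; apply/eqP.
  by apply: eq_big => [i|i _]; rewrite ?leq_addr// addKn.
have -> : \sum_(i < n) \sum_(k < i.+1) u k * v (i - k)%N =
    \sum_(k < n) u k * \sum_(i < n | (k <= i)%N) v (i - k)%N.
  under [RHS]eq_bigr do rewrite mulr_sumr big_mkcond/=.
  rewrite exchange_big/=; apply: eq_bigr => i _.
  rewrite (big_ord_widen n (fun k => u k * v (i - k)%N))//= big_mkcond/=.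
  by apply: eq_bigr => k _; rewrite ltnS.
apply: (@le_trans _ _ (\sum_(k < n) u k * V)).
  by apply: ler_sum => k _; rewrite ler_wpM2l.
by rewrite -mulr_suml ler_wpM2r.
Qed.

(** By the mean value theorem the terms are dominated by the differences of
    [j.+1%:R `^ (s - 1)], which telescope. *)
Lemma sum_powR_le s n : 0 < s < 1 -> \sum_(j < n) j.+1%:R `^ (s - 2) <= 1 + (1 - s)^-1.
Proof.
move=> /andP[s0 s1]; have s1' : 0 < 1 - s by lra.
have step j : j.+2%:R `^ (s - 2) <= (1 - s)^-1 * (j.+1%:R `^ (s - 1) - j.+2%:R `^ (s - 1)).
  have j1 : 0 < j.+1%:R :> R by rewrite ltr0n.
  have j12 : j.+1%:R < j.+2%:R :> R by rewrite ltr_nat.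
  have [x /[!in_itv]/= /andP[x1 x2] E] : exists2 x : R, x \in `]j.+1%:R, j.+2%:R[ &
      j.+2%:R `^ (s - 1) - j.+1%:R `^ (s - 1) = (s - 1) * x `^ (s - 1 - 1) * (j.+2%:R - j.+1%:R).
    apply: (@MVT _ (fun x => x `^ (s - 1)) (fun x => (s - 1) * x `^ (s - 1 - 1))) => //.
      move=> x /[!in_itv]/= /andP[x1 x2]; apply: is_derive1_powR.
      exact: lt_trans x1.
    apply: continuous_in_subspaceT => x /[!inE]/= /[!in_itv]/= /andP[x1 x2].
    apply: (is_derive1_continuous (is_derive1_powR _ _)).
    exact: lt_le_trans x1.
  have x0 : 0 < x by exact: lt_trans x1.
  have -> : j.+1%:R `^ (s - 1) - j.+2%:R `^ (s - 1) = (1 - s) * x `^ (s - 2).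
    rewrite -opprB E -(natr1 j.+1) (_ : s - 1 - 1 = s - 2); last by ring.
    by ring.
  rewrite mulKf ?gt_eqF//.
  by apply: ler_powR_npos; [lra | rewrite x0 ltW].
case: n => [|n]; first by rewrite big_ord0; have := invr_ge0 (1 - s); rewrite (ltW s1'); lra.
rewrite big_ord_recl/= powR1 lerD2l.
suff : \sum_(i < n) i.+2%:R `^ (s - 2) <= (1 - s)^-1 * (1 - n.+1%:R `^ (s - 1)).
  move=> h; apply: (le_trans h).
  have i0 : 0 <= (1 - s)^-1 by rewrite invr_ge0 ltW.
  have := powR_ge0 n.+1%:R (s - 1); set z := powR _ _ => z0; nra.
elim: n => [|n ih]; first by rewrite big_ord0 powR1 subrr mulr0.
rewrite big_ord_recr/=; apply: (le_trans (lerD ih (step n))).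
by rewrite -mulrDr subrKA.
Qed.

Variable a : R.
Hypothesis a01 : 0 < a < 1.

(** Up to normalization, the kernel of the fractional integral of order [a] and its
    first two primitives vanishing at 0. *)
Definition kappa t : R := Gamma (1 - a) * t `^ (a - 1).
Definition kappa1 t : R := Gamma (1 - a) / a * t `^ a.
Definition kappa2 t : R := Gamma (1 - a) / (a * (a + 1)) * t `^ (a + 1).

Lemma Gamma_ge0 s : 0 <= Gamma s.
Proof. by apply: Rintegral_ge0 => y _; rewrite mulr_ge0 ?powR_ge0 ?expR_ge0. Qed.

Section constants.
Variables Gb b dd E : R.
Hypotheses (GbE : Gb = Gamma (1 - a)) (Gb0 : 0 < Gb) (b0 : 0 < b) (dd0 : 0 <= dd) (E0 : 0 <= E).
Hypothesis watson : forall j, let t := j%:R + a / 2 in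
  `|b * gw a j - Gb * t `^ (a - 1) + dd * t `^ (a - 3)| <= E * t `^ (a - 4).

(** The coefficient of [gw] for which the terms of order [t `^ (a - 1)] cancel in
    [remainder2]. *)
Let psi2 s : R := (s ^+ 2 * ((a + 1) * a / 2) + dd / Gb - a / 2 * (a / 2 + 1)
  - (s - 1) * ((a + 1) * a / 2)) / (a * (a + 1)).

Section at_j.
Variable j : nat.
Let t : R := j.+1%:R + a / 2.
Let J : R := j.+1%:R `^ (a - 2).
(* Every power of [t] below is [P] times a power with a natural exponent, so that
   identities between the expansions become polynomial identities. *)
Let P : R := t `^ (a - 4).

Let t1 : 1 <= t.
Proof.
have : 1 <= j.+1%:R :> R by rewrite ler1n.
by rewrite /t; case/andP: a01 => a0 a1 h; lra.
Qed.

Let j1 : 1 <= j.+1%:R :> R. Proof. by rewrite ler1n. Qed.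

Let tP (n : nat) (s : R) : s = a - 4 + n%:R -> t `^ s = P * t ^+ n.
Proof.
move=> ->; have t0 : 0 < t by exact: lt_le_trans t1.
by rewrite powRD ?(gt_eqF t0) ?implybT// powR_mulrn// ltW.
Qed.

Let PJ : P * t ^+ 2 <= J.
Proof.
rewrite -(@tP 2 (a - 2)); last by ring.
have t0 : 0 < t by exact: lt_le_trans t1.
have j0 : 0 < j.+1%:R :> R by exact: lt_le_trans j1.
by case/andP: a01 => a0 a1; apply: ler_powR_npos; rewrite ?j0 /t; lra.
Qed.

Let pow_le (x c : R) : j.+1%:R <= x -> `|c| <= 1 -> `|c * x `^ (a - 2)| <= J.
Proof.
move=> jx c1; have j0 : 0 < j.+1%:R :> R by exact: lt_le_trans j1.
have x0 : 0 < x by exact: lt_le_trans jx.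
rewrite normrM (ger0_norm (powR_ge0 _ _)).
apply: (@le_trans _ _ (x `^ (a - 2))); first by rewrite ler_piMl ?powR_ge0.
by case/andP: a01 => a0 a1; apply: ler_powR_npos; rewrite ?j0//; lra.
Qed.

Let seg (y s : R) : j.+1%:R <= y -> 0 <= s <= 1 -> j.+1%:R <= t + s * (y - t).
Proof.
move=> jy /andP[s0 s1]; have jt : j.+1%:R <= t by rewrite /t; case/andP: a01 => a0 a1; lra.
nra.
Qed.

Let X : R := b * gw a j.+1.

Let XE : exists2 e, X = Gb * (P * t ^+ 3) - dd * (P * t) + e & `|e| <= E * P.
Proof.
exists (X - Gb * (P * t ^+ 3) + dd * (P * t)); first by ring.
have := watson j.+1; rewrite /= -/t -/X.
rewrite (@tP 3 (a - 1)); last by ring.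
rewrite (@tP 1 (a - 3)); last by ring.
by rewrite expr1 -/P.
Qed.

(** Both terms are expanded about the centre [t] of Watson's expansion. The
    combination of [gw1] and [gw] is the one for which the orders [t `^ a] and
    [t `^ (a - 1)] cancel; what is left is of order [t `^ (a - 2)], the general term
    of a convergent series. *)
Lemma remainder1 : `|kappa1 j.+1%:R - b * (gw1 a j.+1 - (a + 1) / 2 * gw a j.+1)|
  <= (Gb + 2 * dd + 2 * E) / a * J.
Proof.
case/andP: a01 => a0 a1.
have [e Xe eE] := XE.
have tay := @taylor2 _ (fun x => x `^ a) (fun x => a * x `^ (a - 1))
  (fun x => a * ((a - 1) * x `^ (a - 1 - 1))) J t j.+1%:R.
have jj : j.+1%:R <= j.+1%:R :> R by [].
have pos s : 0 <= s <= 1 -> 0 < t + s * (j.+1%:R - t).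
  by move=> s01; apply: lt_le_trans (seg jj s01); exact: lt_le_trans j1.
have {}tay : `|j.+1%:R `^ a - t `^ a - (j.+1%:R - t) * (a * t `^ (a - 1))| <= J / 2 * `|j.+1%:R - t| ^+ 2.
  apply: tay => s s01; have p0 := pos s s01.
  - exact: is_derive1_powR.
  - have H := is_derive1_powR (a - 1) p0.
    by apply: is_derive_eq; rewrite /GRing.scale/=.
  - rewrite mulrA (_ : a - 1 - 1 = a - 2); last by ring.
    apply: pow_le; first exact: seg.
    by rewrite ler_norml; apply/andP; split; nra.
have P0 : 0 <= P by exact: powR_ge0.
have J0 : 0 <= J by exact: powR_ge0.
have jt : j.+1%:R - t = - (a / 2) by rewrite /t; ring.
move: tay; rewrite jt (@tP 4 a); last by ring.
rewrite (@tP 3 (a - 1)); last by ring.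
rewrite normrN (ger0_norm (divr_ge0 (ltW a0) (ler0n _ 2))).
set pj := j.+1%:R `^ a => tay.
have eq1 : a * (kappa1 j.+1%:R - b * (gw1 a j.+1 - (a + 1) / 2 * gw a j.+1))
   = Gb * (pj - P * t ^+ 4 - - (a / 2) * (a * (P * t ^+ 3)))
     + dd * (P * (t * (t - a ^+ 2 / 2))) - e * (t - a ^+ 2 / 2).
  have -> : b * (gw1 a j.+1 - (a + 1) / 2 * gw a j.+1) = X * ((t - a ^+ 2 / 2) / a).
    by rewrite /gw1 /X /t; field; rewrite gt_eqF.
  rewrite Xe /kappa1 -GbE -/pj; field; rewrite gt_eqF//.
have key : `|a * (kappa1 j.+1%:R - b * (gw1 a j.+1 - (a + 1) / 2 * gw a j.+1))|
    <= (Gb + 2 * dd + 2 * E) * J.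
  rewrite eq1.
  have n1 : `|Gb * (pj - P * t ^+ 4 - - (a / 2) * (a * (P * t ^+ 3)))| <= Gb * J.
    rewrite normrM (ger0_norm (ltW Gb0)) ler_wpM2l ?(ltW Gb0)//; apply: (le_trans tay).
    by rewrite -mulrA ler_piMr//; nra.
  have ta : 0 <= t - a ^+ 2 / 2 <= t.
    have h1 : a ^+ 2 <= 1 by nra.
    have h2 : 0 <= a ^+ 2 by exact: sqr_ge0.
    by have := t1; lra.
  have t0 : 1 <= t by exact: t1.
  have n2 : `|dd * (P * (t * (t - a ^+ 2 / 2)))| <= 2 * dd * J.
    have tp : 0 <= t by lra.
    rewrite ger0_norm; last by rewrite (mulr_ge0 dd0)// (mulr_ge0 P0)// (mulr_ge0 tp)//; case/andP: ta.
    apply: (@le_trans _ _ (dd * J)); last by rewrite -mulrA; have := mulr_ge0 dd0 J0; lra.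
    rewrite ler_wpM2l//; apply: le_trans PJ; rewrite ler_wpM2l// expr2 ler_wpM2l//; lra.
  have n3 : `|e * (t - a ^+ 2 / 2)| <= 2 * E * J.
    rewrite normrM (ger0_norm (proj1 (andP ta))).
    apply: (@le_trans _ _ (E * P * t ^+ 2)).
      by rewrite ler_pM// ?(proj1 (andP ta))//; case/andP: ta => _ h; apply: (le_trans h); rewrite expr2 ler_peMl//; lra.
    rewrite -[E * P * _]mulrA; have := ler_wpM2l E0 PJ; have := mulr_ge0 E0 J0; lra.
  apply: (le_trans (ler_normB _ _)); apply: (le_trans (lerD (ler_normD _ _) (lexx _))).
  lra.
rewrite normrM (ger0_norm (ltW a0)) mulrC -ler_pdivlMr// in key.
by rewrite [leRHS]mulrAC.
Qed.

(** As in [remainder1], with three orders to cancel and three coefficients. *)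
Lemma remainder2 s : 0 <= s <= 1 ->
  `|kappa2 (j.+1%:R + s) - b * (gw2 a j.+1 + (s - 1 - a / 2) * gw1 a j.+1
      + psi2 (s - a / 2) * gw a j.+1)|
  <= (Gb + 2 * dd + dd * (1 + dd / Gb) + E * (4 + dd / Gb)) / (a * (a + 1)) * J.
Proof.
move=> /andP[s0 s1]; case/andP: a01 => a0 a1.
have [e Xe eE] := XE.
pose y : R := j.+1%:R + s.
have jj : j.+1%:R <= y by rewrite lerDl.
have tay := @taylor3 _ (fun x => x `^ (a + 1)) (fun x => (a + 1) * x `^ (a + 1 - 1))
  (fun x => (a + 1) * (a * x `^ (a - 1))) (fun x => (a + 1) * (a * ((a - 1) * x `^ (a - 1 - 1)))) J t y.
have pos r : 0 <= r <= 1 -> 0 < t + r * (y - t).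
  by move=> r01; apply: lt_le_trans (seg jj r01); exact: lt_le_trans j1.
have {}tay : `|y `^ (a + 1) - t `^ (a + 1) - (y - t) * ((a + 1) * t `^ (a + 1 - 1))
    - (y - t) ^+ 2 / 2 * ((a + 1) * (a * t `^ (a - 1)))| <= J / 6 * `|y - t| ^+ 3.
  apply: tay => r r01; have p0 := pos r r01.
  - exact: is_derive1_powR.
  - have H := is_derive1_powR a p0; rewrite (_ : a + 1 - 1 = a); last by ring.
    by apply: is_derive_eq; rewrite /GRing.scale/=.
  - have H := is_derive1_powR (a - 1) p0.
    by apply: is_derive_eq; rewrite /GRing.scale/=.
  - rewrite !mulrA (_ : a - 1 - 1 = a - 2); last by ring.
    apply: pow_le; first exact: seg.
    have aa : 0 <= a ^+ 2 <= 1 by nra.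
    by rewrite ler_norml; apply/andP; split; nra.
have P0 : 0 <= P by exact: powR_ge0.
have J0 : 0 <= J by exact: powR_ge0.
pose sg := s - a / 2.
have yt : y - t = sg by rewrite /sg /y /t; ring.
have t0 : 1 <= t by exact: t1.
have sg1 : `|sg| <= 1 by rewrite ler_norml /sg; lra.
move: tay; rewrite yt (@tP 5 (a + 1)); last by ring.
rewrite (@tP 4 (a + 1 - 1)); last by ring.
rewrite (@tP 3 (a - 1)); last by ring.
set pj := y `^ (a + 1) => tay.
have aa0 : 0 < a * (a + 1) by rewrite mulr_gt0// addr_gt0.
pose q0 := (a + 1) * a / 2 * sg ^+ 2 + dd / Gb.
have q0b : 0 <= q0 <= 1 + dd / Gb.
  have h1 : 0 <= dd / Gb by rewrite divr_ge0// ltW.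
  have h2 : 0 <= sg ^+ 2 <= 1.
    by rewrite sqr_ge0/=; move: sg1; rewrite ler_norml => /andP[]; nra.
  have h3 : 0 <= (a + 1) * a / 2 <= 1 by nra.
  by rewrite /q0; nra.
pose Q := t ^+ 2 + (a + 1) * sg * t + q0.
have eq1 : a * (a + 1) * (kappa2 y - b * (gw2 a j.+1 + (s - 1 - a / 2) * gw1 a j.+1
      + psi2 sg * gw a j.+1))
   = Gb * (pj - P * t ^+ 5 - sg * ((a + 1) * (P * t ^+ 4)) - sg ^+ 2 / 2 * ((a + 1) * (a * (P * t ^+ 3))))
     + (dd * ((a + 1) * sg) * (P * t ^+ 2) + dd * q0 * (P * t)) - e * Q.
  have -> : b * (gw2 a j.+1 + (s - 1 - a / 2) * gw1 a j.+1 + psi2 sg * gw a j.+1) = X * (Q / (a * (a + 1))).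
    rewrite /gw1 /gw2 /X /Q /q0 /psi2 -/sg.
    have -> : j.+1%:R = t - a / 2 by rewrite /t; ring.
    have -> : s = sg + a / 2 by rewrite /sg; ring.
    by field; rewrite !gt_eqF// addr_gt0.
  rewrite Xe /kappa2 -GbE -/pj /Q /q0; field.
  by rewrite !gt_eqF// addr_gt0.
have key : `|a * (a + 1) * (kappa2 y - b * (gw2 a j.+1 + (s - 1 - a / 2) * gw1 a j.+1
      + psi2 sg * gw a j.+1))| <= (Gb + 2 * dd + dd * (1 + dd / Gb) + E * (4 + dd / Gb)) * J.
  rewrite eq1.
  have n1 : `|Gb * (pj - P * t ^+ 5 - sg * ((a + 1) * (P * t ^+ 4)) - sg ^+ 2 / 2 * ((a + 1) * (a * (P * t ^+ 3))))| <= Gb * J.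
    rewrite normrM (ger0_norm (ltW Gb0)) ler_wpM2l ?(ltW Gb0)//; apply: (le_trans tay).
    rewrite -mulrA ler_piMr// mulr_ile1 ?exprn_ge0 ?exprn_ile1 ?invr_ge0//; lra.
  have n2 : `|dd * ((a + 1) * sg) * (P * t ^+ 2)| <= 2 * dd * J.
    rewrite normrM [`|P * _|]ger0_norm; last by rewrite mulr_ge0// exprn_ge0//; lra.
    rewrite ler_pM ?normr_ge0//; first by rewrite mulr_ge0// exprn_ge0//; lra.
    rewrite normrM (ger0_norm dd0) [leRHS]mulrC ler_wpM2l// normrM ger0_norm; last lra.
    have := normr_ge0 sg; nra.
  have n3 : `|dd * q0 * (P * t)| <= dd * (1 + dd / Gb) * J.
    have q00 : 0 <= q0 by case/andP: q0b.
    have tp : 0 <= t by lra.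
    have dq : 0 <= dd * q0 by exact: mulr_ge0.
    have pt : 0 <= P * t by exact: mulr_ge0.
    rewrite ger0_norm; last exact: mulr_ge0.
    apply: ler_pM => //; first by rewrite ler_wpM2l//; case/andP: q0b.
    by apply: le_trans PJ; rewrite ler_wpM2l// expr2 ler_peMl//; lra.
  have Qb : `|Q| <= (4 + dd / Gb) * t ^+ 2.
    case/andP: q0b => q00 q01.
    have tt : 1 <= t ^+ 2 by rewrite exprn_ege1.
    have tt2 : t <= t ^+ 2 by rewrite expr2 ler_peMl//; lra.
    have m : `|(a + 1) * sg * t| <= 2 * t ^+ 2.
      rewrite -mulrA normrM ger0_norm; last lra.
      rewrite normrM (@ger0_norm _ t); last lra.
      have := normr_ge0 sg => sg0.
      have h : `|sg| * t <= t by rewrite ler_piMl//; lra.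
      have h0 : 0 <= `|sg| * t by rewrite mulr_ge0//; lra.
      nra.
    rewrite /Q; apply: (le_trans (ler_normD _ _)).
    apply: (le_trans (lerD (ler_normD _ _) (lexx _))).
    rewrite (ger0_norm (sqr_ge0 _)) (ger0_norm q00).
    have h1 : 0 <= dd / Gb by rewrite divr_ge0// ltW.
    have h2 : dd / Gb <= dd / Gb * t ^+ 2 by rewrite ler_peMr.
    have -> : (4 + dd / Gb) * t ^+ 2 = t ^+ 2 + 2 * t ^+ 2 + (t ^+ 2 + dd / Gb * t ^+ 2) by ring.
    apply: lerD; first exact: lerD.
    by apply: (le_trans q01); exact: lerD.
  have n4 : `|e * Q| <= E * (4 + dd / Gb) * J.
    have h1 : 0 <= 4 + dd / Gb by rewrite addr_ge0// divr_ge0// ltW.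
    rewrite normrM; apply: (@le_trans _ _ (E * P * ((4 + dd / Gb) * t ^+ 2))).
      by rewrite ler_pM.
    have -> : E * P * ((4 + dd / Gb) * t ^+ 2) = E * (4 + dd / Gb) * (P * t ^+ 2) by ring.
    by rewrite ler_wpM2l// (mulr_ge0 E0).
  apply: (le_trans (ler_normB _ _)); apply: (le_trans (lerD (ler_normD _ _) (lexx _))).
  apply: (le_trans (lerD (lerD (lexx _) (ler_normD _ _)) (lexx _))).
  have -> : (Gb + 2 * dd + dd * (1 + dd / Gb) + E * (4 + dd / Gb)) * J =
    Gb * J + (2 * dd * J + dd * (1 + dd / Gb) * J) + E * (4 + dd / Gb) * J by ring.
  exact: lerD (lerD n1 (lerD n2 n3)) n4.
rewrite normrM (ger0_norm (ltW aa0)) mulrC -ler_pdivlMr// in key.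
by rewrite [leRHS]mulrAC.
Qed.

End at_j.

Let w := grunwald_weight a.
Let K1 := (Gb + 2 * dd + 2 * E) / a.
Let K2 := (Gb + 2 * dd + dd * (1 + dd / Gb) + E * (4 + dd / Gb)) / (a * (a + 1)).
Let c1 := (a + 1) * a / 2.
Let c2 := dd / Gb - a / 2 * (a / 2 + 1).
Let M := (3 * c1 + `|c2|) / (a * (a + 1)).
(* The expansions hold from index 1 on; [K0] bounds the remainders at index 0. *)
Let K0 := kappa2 1 + b * (3 + M).

Let rho n := if n is j.+1 then (K1 + K2) * j.+1%:R `^ (a - 2) else K0.
Let r1 n := kappa1 n%:R - b * (gw1 a n - (a + 1) / 2 * gw a n).
Let r2 n s := kappa2 (n%:R + s) - b * (gw2 a n + (s - 1 - a / 2) * gw1 a n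
      + psi2 (s - a / 2) * gw a n).

Let aa0 : 0 < a * (a + 1).
Proof. by case/andP: a01 => a0 a1; rewrite mulr_gt0// addr_gt0. Qed.

Let c10 : 0 <= c1.
Proof. by case/andP: a01 => a0 a1; rewrite /c1; nra. Qed.

Let psi2_le s : 0 <= s <= 1 -> `|psi2 (s - a / 2)| <= M.
Proof.
case/andP: a01 => a0 a1 /andP[s0 s1]; pose sg := s - a / 2.
have [g1 g2] : -1 <= sg /\ sg <= 1 by rewrite /sg; split; lra.
rewrite -/sg normrM [`|_^-1|]gtr0_norm ?invr_gt0// ler_pM2r ?invr_gt0//.
have -> : sg ^+ 2 * ((a + 1) * a / 2) + dd / Gb - a / 2 * (a / 2 + 1)
  - (sg - 1) * ((a + 1) * a / 2) = (sg ^+ 2 - sg + 1) * c1 + c2 by rewrite /c1 /c2; ring.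
apply: (le_trans (ler_normD _ _)); rewrite lerD2r normrM (ger0_norm c10).
by rewrite ler_wpM2r// ler_norml; apply/andP; split; nra.
Qed.

Let M0 : 0 <= M.
Proof. by rewrite divr_ge0 ?(ltW aa0)// addr_ge0// mulr_ge0. Qed.

Let kappa2_ge0 x : 0 <= kappa2 x.
Proof. by rewrite mulr_ge0 ?powR_ge0// -GbE divr_ge0 ?ltW. Qed.

Let gw10 : gw1 a 0 = 1.
Proof. by case/andP: a01 => a0 a1; rewrite /gw1 gw0 add0r divff ?mulr1// gt_eqF. Qed.

Let gw20 : gw2 a 0 = 1.
Proof. by rewrite /gw2 gw0 !add0r divff ?mulr1// gt_eqF. Qed.

Let r2_le n s : 0 <= s <= 1 -> `|r2 n s| <= rho n.
Proof.
case: n => [|j] s01; last first.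
  apply: (le_trans (remainder2 j s01)); rewrite ler_wpM2r ?powR_ge0// lerDr.
  by case/andP: a01 => a0 a1; rewrite divr_ge0 ?(ltW a0)// !addr_ge0 ?(ltW Gb0)// mulr_ge0.
rewrite /r2 /rho gw10 gw20 gw0 !mulr1 add0r; apply: (le_trans (ler_normB _ _)).
have /andP[s0 s1] := s01; case/andP: a01 => a0 a1.
apply: lerD.
  rewrite ger0_norm// /kappa2 -GbE; apply: ler_wpM2l; first by rewrite divr_ge0 ?(ltW aa0) ?(ltW Gb0).
  by apply: ge0_ler_powR; rewrite ?nnegrE//; lra.
rewrite normrM (gtr0_norm b0) ler_wpM2l ?(ltW b0)//.
apply: (le_trans (ler_normD _ _)); apply: lerD; last exact: psi2_le.
by rewrite ler_norml; lra.
Qed.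

Let r1_le n : `|r1 n| <= rho n.
Proof.
case: n => [|j]; last first.
  apply: (le_trans (remainder1 j)); rewrite ler_wpM2r ?powR_ge0// lerDl.
  have h : 0 <= dd / Gb by rewrite divr_ge0 ?(ltW Gb0).
  by rewrite divr_ge0 ?(ltW aa0)// !addr_ge0 ?(ltW Gb0)// mulr_ge0 ?addr_ge0.
case/andP: a01 => a0 a1.
rewrite /r1 /rho gw10 gw0 mulr1 /kappa1 powR0 ?gt_eqF// mulr0 sub0r normrN.
rewrite normrM (gtr0_norm b0); apply: (@le_trans _ _ (b * (3 + M))); last by rewrite lerDr.
rewrite ler_wpM2l ?(ltW b0)// ler_norml; apply/andP; split; have := M0; lra.
Qed.

Let rho_ge0 n : 0 <= rho n.
Proof. exact: le_trans (r1_le n). Qed.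

Let sum_rho n : \sum_(i < n) rho i <= K0 + (K1 + K2) * (1 + (1 - a)^-1).
Proof.
have K0' : 0 <= K1 + K2 by have := rho_ge0 1; rewrite /rho powR1 mulr1.
have s0 : 0 <= (1 + (1 - a)^-1).
  by case/andP: a01 => a0 a1; rewrite addr_ge0// invr_ge0 subr_ge0 ltW.
case: n => [|n]; first by rewrite big_ord0 addr_ge0 ?(rho_ge0 0)// mulr_ge0.
rewrite big_ord_recl lerD2l -mulr_sumr ler_wpM2l//.
exact: sum_powR_le.
Qed.

(** Replace powers by [gw], [gw1] and [gw2]: their convolutions with the weights are
    explicit and add up to [b * (n%:R + s - a / 2)] and to [b], except at [n = 0]. The
    remainders are summable, and so are their convolutions with the weights. *)
Lemma kernel_bound_of_watson : exists d : nat -> R, exists B : R,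
  [/\ forall n, 0 <= d n, forall n, \sum_(i < n) d i <= B,
   forall n s, 0 <= s <= 1 ->
    `|\sum_(k < n.+1) w k * kappa2 ((n - k)%:R + s) - b * (n%:R + s - a / 2)| <= d n &
   forall n, `|\sum_(k < n.+1) w k * kappa1 (n - k)%:R - b| <= d n].
Proof.
pose d n : R := \sum_(k < n.+1) `|w k| * rho (n - k)%N + (b * (2 + M)) * (n == 0%N)%:R.
exists d, (2 * (K0 + (K1 + K2) * (1 + (1 - a)^-1)) + b * (2 + M)).
have bM : 0 <= b * (2 + M) by rewrite mulr_ge0 ?(ltW b0)// addr_ge0.
have sumw n (r : nat -> R) : (forall i, `|r i| <= rho i) ->
    `|\sum_(k < n.+1) w k * r (n - k)%N| <= \sum_(k < n.+1) `|w k| * rho (n - k)%N.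
  move=> h; apply: (le_trans (ler_norm_sum _ _ _)); apply: ler_sum => k _.
  by rewrite normrM ler_wpM2l.
split.
- move=> n; apply: addr_ge0; last exact: mulr_ge0.
  by apply: sumr_ge0 => k _; exact: mulr_ge0.
- move=> n; rewrite /d big_split/=; apply: lerD.
    by apply: (@sum_conv_le (fun k => `|w k|) rho) => // m; exact: (sum_norm_grunwald_weight a01).
  rewrite -mulr_sumr -[leRHS]mulr1 ler_wpM2l//.
  case: n => [|n]; first by rewrite big_ord0.
  by rewrite big_ord_recl/= big1 ?addr0.
- move=> n s s01.
  have -> : \sum_(k < n.+1) w k * kappa2 ((n - k)%:R + s) - b * (n%:R + s - a / 2) =
    \sum_(k < n.+1) w k * r2 (n - k) s + b * psi2 (s - a / 2) * (n == 0%N)%:R.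
    have -> : \sum_(k < n.+1) w k * r2 (n - k) s = \sum_(k < n.+1) w k * kappa2 ((n - k)%:R + s)
      - b * (\sum_(k < n.+1) w k * gw2 a (n - k) + (s - 1 - a / 2) * (\sum_(k < n.+1) w k * gw1 a (n - k))
         + psi2 (s - a / 2) * \sum_(k < n.+1) w k * gw a (n - k)).
      rewrite [(s - 1 - a / 2) * _]mulr_sumr [psi2 _ * _]mulr_sumr -!big_split/= mulr_sumr -sumrB/=; apply: eq_bigr => k _.
      by rewrite /r2; ring.
    rewrite conv_gw conv_gw1// conv_gw2// -natr1; ring.
  apply: (le_trans (ler_normD _ _)); apply: lerD; first by apply: (sumw n (fun i => r2 i s)) => i; exact: r2_le.
  rewrite normrM normr_nat ler_wpM2r// normrM (gtr0_norm b0) ler_wpM2l ?(ltW b0)//.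
  by apply: (le_trans (psi2_le s01)); rewrite lerDr.
- move=> n.
  have -> : \sum_(k < n.+1) w k * kappa1 (n - k)%:R - b =
    \sum_(k < n.+1) w k * r1 (n - k) - b * ((a + 1) / 2) * (n == 0%N)%:R.
    have -> : \sum_(k < n.+1) w k * r1 (n - k) = \sum_(k < n.+1) w k * kappa1 (n - k)%:R
      - b * (\sum_(k < n.+1) w k * gw1 a (n - k) - (a + 1) / 2 * \sum_(k < n.+1) w k * gw a (n - k)).
      rewrite [(a + 1) / 2 * _]mulr_sumr -sumrB/= mulr_sumr -sumrB/=; apply: eq_bigr => k _.
      by rewrite /r1; ring.
    rewrite conv_gw conv_gw1//; ring.
  apply: (le_trans (ler_normB _ _)); apply: lerD; first exact: (sumw n r1).
  rewrite normrM normr_nat ler_wpM2r// normrM (gtr0_norm b0) ler_wpM2l ?(ltW b0)//.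
  by case/andP: a01 => a0 a1; rewrite ger0_norm; have := M0; lra.
Qed.

End constants.

(** At [t = n%:R + s] the two sums are the second and first primitives of the kernel
    [\sum_k w k * kappa a (t - k%:R)], where only the terms with [k%:R < t] count. Up to
    a summable error these are [b * (t - a / 2)] and [b], so to first order the kernel
    acts on smooth functions like [b] times the evaluation at [a / 2]. *)
Lemma kernel_bound (w := grunwald_weight a) (b := beta_const a) :
  exists d : nat -> R, exists B : R,
  [/\ forall n, 0 <= d n, forall n, \sum_(i < n) d i <= B,
   forall n s, 0 <= s <= 1 ->
    `|\sum_(k < n.+1) w k * kappa2 ((n - k)%:R + s) - b * (n%:R + s - a / 2)| <= d n &
   forall n, `|\sum_(k < n.+1) w k * kappa1 (n - k)%:R - b| <= d n].
Proof.
case/andP: (a01) => a0 a1.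
have Gb0 : 0 < Gamma (1 - a) by apply: Gamma_gt0; lra.
have dd0 : 0 <= a / 24 * Gamma (3 - a).
  by rewrite mulr_ge0 ?Gamma_ge0// divr_ge0// ltW.
have E0 : 0 <= 2 * Gamma (4 - a) by rewrite mulr_ge0 ?Gamma_ge0.
exact: (kernel_bound_of_watson erefl Gb0 (beta_const_gt0 a01) dd0 E0 (gw_watson a01)).
Qed.

End remainder.

(** * Finite sums, integrals and limits *)

Section sums.
Variable R : realType.
Local Notation mu := (@lebesgue_measure R).
Implicit Types (f : R -> R) (c d : R).

Lemma Rintegral_sum_scale (D : set R) (mD : measurable D) (w : nat -> R) (F : nat -> R -> R) n :
  (forall k, (k < n)%N -> mu.-integrable D (EFin \o F k)) ->
  mu.-integrable D (EFin \o (fun t => \sum_(k < n) w k * F k t)) /\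
  \int[mu]_(t in D) (\sum_(k < n) w k * F k t) = \sum_(k < n) w k * \int[mu]_(t in D) F k t.
Proof.
elim: n => [|n ih] Fi.
  rewrite big_ord0 (_ : (fun t => _) = cst 0); last by apply/funext => t; rewrite big_ord0.
  by split; [exact: integrable0 | rewrite /Rintegral integral0_eq].
have [i1 e1] := ih (fun k kn => Fi k (ltnW kn)).
have i2 : mu.-integrable D (EFin \o (fun t => w n * F n t)) by apply: integrable_scale => //; exact: Fi.
rewrite (_ : (fun t => _) = (fun t => \sum_(k < n) w k * F k t + w n * F n t)); last first.
  by apply/funext => t; rewrite big_ord_recr.
split; first exact: integrable_add.
by rewrite RintegralD// e1 big_ord_recr/= RintegralZl//; exact: Fi.
Qed.

Lemma Rintegral_itv_cvg f c : mu.-integrable `]c, +oo[ (EFin \o f) ->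
  \int[mu]_(x in `]c, n%:R]) f x @[n --> \oo] --> \int[mu]_(x in `]c, +oo[) f x.
Proof.
move=> fi; have mA : measurable (`]c, +oo[ : set R) by exact: measurable_itv.
apply: fine_cvg; rewrite fineK; last exact: integrable_fin_num.
have := @dominated_convergence _ _ _ mu _ mA
  (fun n => (EFin \o f) \_ `]c, n%:R]) (EFin \o f) (abse \o (EFin \o f)).
case.
- move=> n; apply/measurable_restrict => //.
  by apply: (@measurable_funS _ _ _ _ `]c, +oo[%classic) => //; exact: measurable_int fi.
- exact: measurable_int fi.
- apply: aeW => x /=; rewrite in_itv/= andbT => cx.
  have xr : x \is Num.real by exact: num_real.
  apply: cvg_near_cst; exists (Num.truncn x).+1 => // m /= xm; rewrite patchE mem_set//=.
  rewrite in_itv/= cx/=; apply: ltW; apply: (lt_le_trans (Num.Theory.truncnS_gt _)) => //.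
  by rewrite ler_nat.
- exact: integrable_abse.
- by apply: aeW => x n Ax; rewrite patchE; case: ifPn => // _ /=; rewrite normr0 lee_fin.
move=> _ _; rewrite /=.
have -> : (fun n => \int[mu]_(x in `]c, n%:R]) (f x)%:E)%E =
    (fun n => \int[mu]_(x in `]c, +oo[) ((EFin \o f) \_ `]c, n%:R]) x)%E; last by [].
apply/funext => n; rewrite -integral_mkcondr setIidr//.
by move=> x /=; rewrite !in_itv/= andbT => /andP[].
Qed.

Lemma integrable_cst_oo (c d k : R) : mu.-integrable `]c, d[ (EFin \o cst k).
Proof. by apply: integrable_oo_of_continuous => x _; exact: cst_continuous. Qed.

Lemma is_derive_shift (k t : R) : is_derive t (1 : R) (fun x : R => x - k) 1.
Proof. by apply: is_derive_eq; rewrite subr0. Qed.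

Lemma is_derive_powR_shift (s k t : R) : k < t ->
  is_derive t (1 : R) (fun x : R => (x - k) `^ s) (s * (t - k) `^ (s - 1)).
Proof.
move=> kt; have tk : 0 < t - k by rewrite subr_gt0.
have := @is_derive1_powR_comp R (fun x => x - k) s t 1 tk (is_derive_shift k t).
by rewrite mulr1.
Qed.

Lemma cvg_sum_ord (T : Type) (F : set_system T) (FF : Filter F) (f : nat -> T -> R) (l : nat -> R) n :
  (forall k, (k < n)%N -> f k x @[x --> F] --> l k) ->
  \sum_(k < n) f k x @[x --> F] --> \sum_(k < n) l k.
Proof.
elim: n => [|n ih] h.
  rewrite big_ord0 (_ : (fun x => _) = cst 0); first exact: cvg_cst.
  by apply/funext => x; rewrite big_ord0.
rewrite big_ord_recr/= (_ : (fun x => _) = (fun x => \sum_(k < n) f k x + f n x)).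
  by apply: cvgD; [apply: ih => k kn; exact: h (ltnW kn) | exact: h].
by apply/funext => x; rewrite big_ord_recr.
Qed.

Lemma ge0_bounded_cvg_series (u : nat -> R) (B : R) :
  (forall k, 0 <= u k) -> (forall n, \sum_(k < n) u k <= B) -> cvgn (series u).
Proof.
move=> u0 uB; apply: nondecreasing_is_cvgn.
  by apply/nondecreasing_seqP => n; rewrite !seriesEord/= big_ord_recr/= lerDl.
by exists B => _ [n _ <-]; rewrite seriesEord; exact: uB.
Qed.

Lemma norm_bounded_cvg_series (u : nat -> R) (B : R) :
  (forall n, \sum_(k < n) `|u k| <= B) -> cvgn (series u).
Proof.
move=> uB; apply: normed_cvg; change (cvgn (series (fun k => `|u k|))).
exact: ge0_bounded_cvg_series uB.
Qed.

Lemma powR_shift_cvg_right (s c k : R) : 0 < s -> k <= c ->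
  (x - k) `^ s @[x --> c^'+] --> (c - k) `^ s.
Proof.
move=> s0; rewrite le_eqVlt => /predU1P[->|kc]; last first.
  apply: cvg_at_right_filter.
  exact: (is_derive1_continuous (is_derive_powR_shift s kc)).
rewrite subrr powR0 ?gt_eqF//; apply/cvg_at_rightP => u [uc cu].
have /cvg_at_rightP h := @powR_cvg0 R s s0.
apply: (h (fun n => u n - c)); split; first by move=> n; rewrite subr_gt0.
by rewrite -(subrr c); apply: cvgB => //; exact: cvg_cst.
Qed.

Section tannery.
Variables (w : nat -> R) (W B : R).
Hypothesis wW : forall n, \sum_(k < n) `|w k| <= W.

(** Tannery's theorem, uniformly in the number of terms: the tail is small with that
    of the series of [`|w k|], and the head tends to 0 term by term. *)
Lemma tannery_unif (z : nat -> nat -> R) :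
  (forall k n, `|z k n| <= B) -> (forall k, z k n @[n --> \oo] --> 0) ->
  forall e, 0 < e -> \forall n \near \oo, forall m, `|\sum_(k < m) w k * z k n| <= e.
Proof.
move=> zB z0 e e0.
have B0 : 0 <= B := le_trans (normr_ge0 _) (zB 0%N 0%N).
have cw : cvgn (series (fun k => `|w k|)) by exact: ge0_bounded_cvg_series wW.
have /cauchy_cvgP/cauchy_seriesP cs := cw.
have e2 : 0 < e / 2 / (B + 1) by rewrite !divr_gt0// ltr_pwDr.
have [[A1 A2] [[m1 _ H1] [m2 _ H2]] HA] := cs _ e2.
pose K := maxn m1 m2.
have tail n : (K <= n)%N -> \sum_(K <= k < n) `|w k| < e / 2 / (B + 1).
  move=> Kn; have := HA (K, n); rewrite /= ger0_norm ?sumr_ge0//; apply.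
  by split; [apply: H1; exact: leq_maxl | apply: H2; apply: leq_trans Kn; exact: leq_maxr].
have h0 : \sum_(k < K) `|w k * z k n| @[n --> \oo] --> \sum_(k < K) `|w k * 0|.
  apply: (@cvg_sum_ord _ _ _ (fun k n => `|w k * z k n|) (fun k => `|w k * 0|)) => k _.
  by apply: cvg_norm; apply: cvgM; [exact: cvg_cst | exact: z0].
rewrite big1 in h0; last by move=> k _; rewrite mulr0 normr0.
have e20 : 0 < e / 2 by rewrite divr_gt0.
move/cvgr0Pnorm_le : h0 => /(_ _ e20) [m3 _ H3].
exists m3 => // n /= /H3; rewrite ger0_norm ?sumr_ge0// => {}H3 m.
apply: (le_trans (ler_norm_sum _ _ _)).
apply: (@le_trans _ _ (\sum_(k < K + m) `|w k * z k n|)).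
  rewrite (big_ord_widen _ (fun k => `|w k * z k n|) (leq_addl K m)) big_mkcond/=.
  by apply: ler_sum => k _; case: ifP.
have Km : (K <= K + m)%N by exact: leq_addr.
rewrite -(big_mkord xpredT (fun k => `|w k * z k n|)) (big_cat_nat (leq0n K) Km)/=.
rewrite big_mkord (splitr e); apply: lerD; first exact: H3.
apply: (@le_trans _ _ (\sum_(K <= k < K + m) `|w k| * B)).
  by apply: ler_sum => k _; rewrite normrM ler_wpM2l.
rewrite -mulr_suml; apply: (@le_trans _ _ (e / 2 / (B + 1) * (B + 1))).
  by apply: ler_pM => //; [exact: sumr_ge0 | exact/ltW/tail | rewrite lerDl].
by rewrite divfK// gt_eqF// ltr_pwDr.
Qed.

Lemma tannery0 (z : nat -> nat -> R) :
  (forall k n, `|z k n| <= B) -> (forall k, z k n @[n --> \oo] --> 0) ->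
  \sum_(k < n) w k * z k n @[n --> \oo] --> 0.
Proof.
move=> zB z0; apply/cvgr0Pnorm_le => e e0.
by apply: filterS (tannery_unif zB z0 e0) => n; apply.
Qed.

End tannery.

Lemma tannery_series (w : nat -> R) (z : nat -> nat -> R) (zeta s : nat -> R) (sigma W B : R) :
  (forall n, \sum_(k < n) `|w k| <= W) -> (forall k n, `|z k n| <= B) ->
  (forall k, z k n @[n --> \oo] --> zeta k) ->
  (forall n, \sum_(k < m) w k * z k n @[m --> \oo] --> s n) ->
  \sum_(k < m) w k * zeta k @[m --> \oo] --> sigma ->
  s n @[n --> \oo] --> sigma.
Proof.
move=> wW zB zz sn sg.
have zetaB k : `|zeta k| <= B.
  have H : `|z k n| @[n --> \oo] --> `|zeta k| by apply: cvg_norm; exact: zz.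
  rewrite -(cvg_lim _ H)//; apply: limr_le; first exact: (cvgP _ H).
  exact: nearW.
have zB2 k n : `|z k n - zeta k| <= B + B by rewrite (le_trans (ler_normB _ _))// lerD.
have z0 k : z k n - zeta k @[n --> \oo] --> 0.
  by rewrite -(subrr (zeta k)); apply: cvgB; [exact: zz | exact: cvg_cst].
apply/cvgrPdist_le => e e0.
apply: filterS (tannery_unif wW zB2 z0 e0) => n H.
have h : \sum_(k < m) w k * (z k n - zeta k) @[m --> \oo] --> s n - sigma.
  rewrite (_ : (fun m => _) = (fun m => \sum_(k < m) w k * z k n - \sum_(k < m) w k * zeta k)).
    by apply: cvgB.
  by apply/funext => m; rewrite -sumrB; apply: eq_bigr => k _; rewrite mulrBr.
have hn : `|\sum_(k < m) w k * (z k n - zeta k)| @[m --> \oo] --> `|s n - sigma| by exact: cvg_norm.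
rewrite distrC -(cvg_lim _ hn)//; apply: limr_le; first exact: (cvgP _ hn).
exact: nearW.
Qed.

End sums.

(** * Summation by parts against the kernel *)

Section summation_by_kernel.
Variable R : realType.
Local Notation mu := (@lebesgue_measure R).
Variables (a : R) (a01 : 0 < a < 1).
Let w := grunwald_weight a.
Let b := beta_const a.

Variables (d : nat -> R) (B : R).
Hypotheses (d0 : forall n, 0 <= d n) (dB : forall n, \sum_(i < n) d i <= B).
Hypothesis kb2 : forall n s, 0 <= s <= 1 ->
  `|\sum_(k < n.+1) w k * kappa2 a ((n - k)%:R + s) - b * (n%:R + s - a / 2)| <= d n.
Hypothesis kb1 : forall n, `|\sum_(k < n.+1) w k * kappa1 a (n - k)%:R - b| <= d n.

Variables (f f1 f2 : R -> R) (S B0 B1 BZ : R).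
Hypotheses (Df : forall t : R, is_derive t (1 : R) f (f1 t))
  (Df1 : forall t : R, is_derive t (1 : R) f1 (f2 t))
  (cf2 : continuous f2)
  (fB : forall t : R, `|f t| <= B0) (f1B : forall t : R, `|f1 t| <= B1)
  (f2S : forall t : R, `|f2 t| <= S).
Let Kf (k : nat) (t : R) := kappa a (t - k%:R) * f t.
Hypotheses (Ki : forall k, mu.-integrable `]k%:R, +oo[ (EFin \o Kf k))
  (KB : forall k, \int[mu]_(t in `]k%:R, +oo[) `|Kf k t| <= BZ).

Let Z k := \int[mu]_(t in `]k%:R, +oo[) Kf k t.
Let ZN k n := \int[mu]_(t in `]k%:R, n%:R]) Kf k t.
Let P1 n t := \sum_(k < n.+1) w k * kappa1 a (t - k%:R) - b.
Let P2 n t := \sum_(k < n.+1) w k * kappa2 a (t - k%:R) - b * (t - a / 2).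
Let T n := \sum_(k < n) w k * ZN k n.

Let kappa2_derive (k : nat) (t : R) : k%:R < t ->
  is_derive t (1 : R) (fun t => kappa2 a (t - k%:R)) (kappa1 a (t - k%:R)).
Proof.
move=> kt; case/andP: a01 => a0 a1.
have H2 := is_derive_powR_shift (a + 1) kt.
rewrite /kappa2 /kappa1; apply: is_derive_eq.
rewrite /GRing.scale/= (_ : a + 1 - 1 = a); last by ring.
by field; rewrite !gt_eqF// addr_gt0.
Qed.

Let kappa1_derive (k : nat) (t : R) : k%:R < t ->
  is_derive t (1 : R) (fun t => kappa1 a (t - k%:R)) (kappa a (t - k%:R)).
Proof.
move=> kt; case/andP: a01 => a0 a1.
have H2 := is_derive_powR_shift a kt.
rewrite /kappa /kappa1; apply: is_derive_eq.
by rewrite /GRing.scale/=; field; rewrite !gt_eqF.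
Qed.

Let sum_derive n (F F' : nat -> R -> R) (t : R) :
  (forall k, (k < n)%N -> is_derive t (1 : R) (F k) (F' k t)) ->
  is_derive t (1 : R) (fun t => \sum_(k < n) w k * F k t) (\sum_(k < n) w k * F' k t).
Proof.
elim: n => [|n ih] H.
  rewrite (_ : (fun t => _) = cst 0); last by apply/funext => x; rewrite big_ord0.
  by rewrite big_ord0; exact: is_derive_cst.
rewrite (_ : (fun t => _) = (fun t => \sum_(k < n) w k * F k t + w n * F n t)); last first.
  by apply/funext => x; rewrite big_ord_recr.
have H1 := ih (fun k kn => H k (ltnW kn)); have H2 := H n (ltnSn n).
by apply: is_derive_eq; rewrite big_ord_recr/= /GRing.scale/=; ring.
Qed.

Let P2_derive n (t : R) : n%:R < t -> is_derive t (1 : R) (P2 n) (P1 n t).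
Proof.
move=> nt; have H : is_derive t (1 : R) (fun t => \sum_(k < n.+1) w k * kappa2 a (t - k%:R))
   (\sum_(k < n.+1) w k * kappa1 a (t - k%:R)).
  apply: (@sum_derive n.+1 (fun k t => kappa2 a (t - k%:R)) (fun k t => kappa1 a (t - k%:R))) => k kn.
  by apply: kappa2_derive; apply: le_lt_trans nt; rewrite ler_nat -ltnS.
by rewrite /P2 /P1; apply: is_derive_eq; rewrite /GRing.scale/=; ring.
Qed.

Let P1_derive n (t : R) : n%:R < t ->
  is_derive t (1 : R) (P1 n) (\sum_(k < n.+1) w k * kappa a (t - k%:R)).
Proof.
move=> nt; have H : is_derive t (1 : R) (fun t => \sum_(k < n.+1) w k * kappa1 a (t - k%:R))
   (\sum_(k < n.+1) w k * kappa a (t - k%:R)).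
  apply: (@sum_derive n.+1 (fun k t => kappa1 a (t - k%:R)) (fun k t => kappa a (t - k%:R))) => k kn.
  by apply: kappa1_derive; apply: le_lt_trans nt; rewrite ler_nat -ltnS.
by rewrite /P1; apply: is_derive_eq; rewrite subr0.
Qed.

Let sum_cvg n (F : nat -> R -> R) (l : nat -> R) (c : R) :
  (forall k, (k < n)%N -> F k t @[t --> c^'+] --> l k) ->
  \sum_(k < n) w k * F k t @[t --> c^'+] --> \sum_(k < n) w k * l k.
Proof.
move=> h; apply: (@cvg_sum_ord _ _ _ _ (fun k t => w k * F k t) (fun k => w k * l k)) => k kn.
by apply: cvgM; [exact: cvg_cst | exact: h].
Qed.

Let P1_right n : P1 n t @[t --> n%:R^'+] --> P1 n n%:R.
Proof.
case/andP: a01 => a0 a1; apply: cvgB; last exact: cvg_cst.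
apply: (@sum_cvg n.+1 (fun k t => kappa1 a (t - k%:R)) (fun k => kappa1 a (n%:R - k%:R))) => k kn.
apply: cvgM; first exact: cvg_cst.
by apply: powR_shift_cvg_right => //; rewrite ler_nat.
Qed.

Let P2_right n : P2 n t @[t --> n%:R^'+] --> P2 n n%:R.
Proof.
case/andP: a01 => a0 a1; apply: cvgB; last first.
  apply: cvgM; first exact: cvg_cst.
  apply: cvgB; last exact: cvg_cst.
  exact: cvg_at_right_filter.
apply: (@sum_cvg n.+1 (fun k t => kappa2 a (t - k%:R)) (fun k => kappa2 a (n%:R - k%:R))) => k kn.
apply: cvgM; first exact: cvg_cst.
by apply: powR_shift_cvg_right => //; [rewrite addr_gt0|rewrite ler_nat].
Qed.

Let P2_le n (t : R) : n%:R <= t <= n.+1%:R -> `|P2 n t| <= d n.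
Proof.
move=> /andP[nt tn]; have s01 : 0 <= t - n%:R <= 1.
  by rewrite subr_ge0 nt/= lerBlDl natr1.
rewrite /P2; have := kb2 n s01; rewrite (addrC n%:R) subrK.
under eq_bigr => k _ do rewrite (natrB _ (leq_ord k : (k <= n)%N)) (addrC (n%:R - k%:R)) addrA subrK.
by [].
Qed.

Let P1_le n : `|P1 n n%:R| <= d n.
Proof.
have := kb1 n; under eq_bigr => k _ do rewrite (natrB _ (leq_ord k : (k <= n)%N)).
by [].
Qed.

Let P1_S n : P1 n n.+1%:R = P1 n.+1 n.+1%:R.
Proof.
rewrite /P1 [in RHS]big_ord_recr/= subrr /kappa1 powR0 ?mulr0 ?addr0//.
by case/andP: a01 => a0 _; rewrite gt_eqF.
Qed.

Let P2_S n : P2 n n.+1%:R = P2 n.+1 n.+1%:R.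
Proof.
rewrite /P2 [in RHS]big_ord_recr/= subrr /kappa2 powR0 ?mulr0 ?addr0//.
by case/andP: a01 => a0 _; rewrite gt_eqF// addr_gt0.
Qed.

Let KK n t := \sum_(k < n.+1) w k * Kf k t.

Let Ki_sub (k n m : nat) : (k <= n)%N -> mu.-integrable `]n%:R, m%:R[ (EFin \o Kf k).
Proof.
move=> kn; apply: (integrableS _ _ _ (Ki k)) => //.
move=> x /=; rewrite !in_itv/= andbT => /andP[nx _].
by apply: le_lt_trans nx; rewrite ler_nat.
Qed.

Let KK_int n : mu.-integrable `]n%:R, n.+1%:R[ (EFin \o KK n) /\
  \int[mu]_(t in `]n%:R, n.+1%:R[) KK n t = \sum_(k < n.+1) w k * \int[mu]_(t in `]n%:R, n.+1%:R[) Kf k t.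
Proof.
apply: Rintegral_sum_scale => // k kn; exact: Ki_sub.
Qed.

Let T_S n : T n.+1 = T n + \int[mu]_(t in `]n%:R, n.+1%:R[) KK n t.
Proof.
have [_ ->] := KK_int n.
have -> : T n = \sum_(k < n.+1) w k * ZN k n.
  by rewrite big_ord_recr/= [ZN n n]/ZN set_itvoc0 Rintegral_set0 mulr0 addr0.
rewrite -big_split/=; apply: eq_bigr => k _; rewrite -mulrDr; congr (_ * _).
have kn : (k <= n)%N by rewrite -ltnS.
rewrite Rintegral_itv_bndo_bndc; last exact: Ki_sub.
rewrite /ZN -(@Rintegral_itvB _ _ (BRight k%:R) (BRight n.+1%:R) n%:R) ?subrKC//.
- by apply: (integrableS _ _ _ (Ki k)) => // x /=; rewrite !in_itv/= andbT => /andP[].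
- by rewrite bnd_simp ler_nat.
- by rewrite bnd_simp ler_nat.
Qed.

Let H n t := P1 n t * f t - P2 n t * f1 t.

Let KK_cont n (t : R) : n%:R < t -> {for t, continuous (KK n)}.
Proof.
move=> nt; have Hk k : (k < n.+1)%N -> {for t, continuous (Kf k)}.
  move=> kn; have kt : k%:R < t by apply: le_lt_trans nt; rewrite ler_nat.
  apply: continuousM; last exact: (is_derive1_continuous (Df t)).
  apply: continuousM; first exact: cvg_cst.
  exact: (is_derive1_continuous (is_derive_powR_shift (a - 1) kt)).
apply: (@cvg_sum_ord _ _ _ _ (fun k t => w k * Kf k t) (fun k => w k * Kf k t)) => k kn.
by apply: cvgM; [exact: cvg_cst | exact: Hk].
Qed.

(** Between [n] and [n + 1] exactly the terms of index at most [n] contribute. Two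
    integrations by parts replace their sum by its second primitive, from which
    [b * (t - a / 2)] may be subtracted since it is annihilated by the second
    derivative. *)
Let piece n : `|T n.+1 - T n - (H n.+1 n.+1%:R - H n n%:R)| <= S * d n.
Proof.
have nn : n%:R < n.+1%:R :> R by rewrite ltr_nat.
pose g t := P2 n t * f2 t.
have cg (t : R) : n%:R < t < n.+1%:R -> {for t, continuous g}.
  move=> /andP[nt _]; apply: continuousM; last exact: cf2.
  exact: (is_derive1_continuous (P2_derive nt)).
have gi : mu.-integrable `]n%:R, n.+1%:R[ (EFin \o g).
  apply: (@integrable_dominated _ _ _ _ _ _ _ (cst (d n * S))) => //.
  - exact: measurable_fun_oo.
  - exact: integrable_cst_oo.
  - move=> t /=; rewrite in_itv/= => /andP[/ltW nt /ltW tn]; rewrite normrM ler_pM//.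
    by apply: P2_le; rewrite nt.
have [Ki1 Ke] := KK_int n.
have fi : mu.-integrable `]n%:R, n.+1%:R[ (EFin \o (fun t => KK n t - g t)) by exact: integrable_sub.
have FTC : (\int[mu]_(x in `]n%:R, n.+1%:R[) (KK n x - g x)%:E = (H n n.+1%:R - H n n%:R)%:E)%E.
  apply: (integral_FTC_oo nn (F := H n)) => //.
  - move=> x xn; apply: continuousB; [apply: KK_cont; by case/andP: xn | exact: cg].
  - move=> x /andP[nx _]; have H1 := P1_derive nx; have H2 := P2_derive nx.
    have H3 := Df x; have H4 := Df1 x; rewrite /H.
    apply: is_derive_eq; rewrite /GRing.scale/= /KK /g.
    rewrite (_ : \sum_(k < n.+1) w k * Kf k x = f x * \sum_(k < n.+1) w k * kappa a (x - k%:R)); last first.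
      by rewrite mulr_sumr; apply: eq_bigr => k _; rewrite /Kf; ring.
    by ring.
  - apply: cvgB; apply: cvgM => //; apply: cvg_at_right_filter.
      exact: (is_derive1_continuous (Df _)).
    exact: (is_derive1_continuous (Df1 _)).
  - apply: cvg_at_left_filter; apply: cvgB; apply: cvgM.
    + exact: (is_derive1_continuous (P1_derive nn)).
    + exact: (is_derive1_continuous (Df _)).
    + exact: (is_derive1_continuous (P2_derive nn)).
    + exact: (is_derive1_continuous (Df1 _)).
have E : \int[mu]_(t in `]n%:R, n.+1%:R[) KK n t - \int[mu]_(t in `]n%:R, n.+1%:R[) g t =
    H n n.+1%:R - H n n%:R.
  by rewrite -RintegralB// /Rintegral FTC.
have HS : H n n.+1%:R = H n.+1 n.+1%:R by rewrite /H P1_S P2_S.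
have -> : T n.+1 - T n = \int[mu]_(t in `]n%:R, n.+1%:R[) KK n t by rewrite T_S addrC addKr.
rewrite -HS -E opprB addrC subrK.
have <- : \int[mu]_(t in `]n%:R, n.+1%:R[) cst (d n * S) t = S * d n.
  have m1 : (mu `]n%:R, n.+1%:R[ = 1%:E :> \bar R)%E.
    by rewrite /= lebesgue_measure_itv/= lte_fin nn -EFinB -natr1 addrAC subrr add0r.
  by rewrite Rintegral_cst// [X in fine X]m1 /= mulr1 mulrC.
apply: (@Rintegral_dominated _ _ _ mu `]n%:R, n.+1%:R[%classic (measurable_itv _) g (cst (d n * S))) => //.
- exact: integrable_cst_oo.
- move=> t /=; rewrite in_itv/= => /andP[/ltW nt /ltW tn]; rewrite normrM ler_pM//.
  by apply: P2_le; rewrite nt.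
Qed.

(** The boundary terms of successive intervals cancel: the term of index [n + 1] that
    appears at [n + 1] vanishes there with [kappa1] and [kappa2]. *)
Let partial n : `|T n - H n n%:R - b * (f 0 + a / 2 * f1 0)| <= S * \sum_(k < n) d k.
Proof.
elim: n => [|n ih].
  rewrite /T !big_ord0 mulr0 /H /P1 /P2 !big_ord_recl !big_ord0 !subrr /kappa1 /kappa2.
  case/andP: a01 => a0 a1; rewrite !powR0 ?gt_eqF ?addr_gt0//.
  by rewrite normr_le0; apply/eqP; rewrite mulr0; ring.
rewrite (_ : \sum_(k < n.+1) d k = \sum_(k < n) d k + d n); last by rewrite big_ord_recr.
rewrite [leRHS]mulrDr; apply: le_trans (lerD ih (piece n)).
rewrite (_ : T n.+1 - H n.+1 n.+1%:R - b * (f 0 + a / 2 * f1 0) =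
  (T n - H n n%:R - b * (f 0 + a / 2 * f1 0)) + (T n.+1 - T n - (H n.+1 n.+1%:R - H n n%:R))).
  exact: ler_normD.
by ring.
Qed.

Let d_cvg : d n @[n --> \oo] --> 0.
Proof.
exact: cvg_series_cvg_0 (ge0_bounded_cvg_series d0 dB).
Qed.

Let H_cvg : H n n%:R @[n --> \oo] --> 0.
Proof.
have h : d n * (B0 + B1) @[n --> \oo] --> 0.
  by rewrite -(mul0r (B0 + B1)); apply: cvgM; [exact: d_cvg|exact: cvg_cst].
have h' : - (d n * (B0 + B1)) @[n --> \oo] --> 0 by rewrite -oppr0; apply: cvgN; exact: h.
apply: (squeeze_cvgr _ h' h); apply: nearW => n; rewrite -ler_norml.
rewrite mulrDr; apply: (le_trans (ler_normB _ _)); apply: lerD; rewrite normrM ler_pM//.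
by apply: P2_le; rewrite lexx ler_nat/=.
Qed.

Let normZ k : `|Z k| <= BZ.
Proof. by apply: le_trans (KB k); apply: le_normr_Rintegral. Qed.

Let ZN_cvg k : ZN k n @[n --> \oo] --> Z k.
Proof. exact: Rintegral_itv_cvg. Qed.

Let normZN k n : `|ZN k n| <= BZ.
Proof.
have sub : (`]k%:R, n%:R]%classic : set R) `<=` `]k%:R, +oo[%classic by move=> x /=; rewrite !in_itv/= andbT => /andP[].
have i : mu.-integrable `]k%:R, n%:R] (EFin \o Kf k) by apply: (integrableS _ _ _ (Ki k)).
apply: le_trans (KB k); apply: (le_trans (le_normr_Rintegral _ i)) => //.
rewrite /Rintegral fine_le//.
- by apply: integrable_fin_num => //; exact: integrable_norm i.
- by apply: integrable_fin_num => //; exact: integrable_norm (Ki k).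
- apply: ge0_subset_integral => //.
  by apply: measurable_int; exact: integrable_norm (Ki k).
Qed.

(** Cutting all integrals at [n] makes the sum finite and [partial] applicable. The
    cut is removed by Tannery's theorem, and the boundary term at [n] disappears
    because [d] tends to 0. *)
Lemma sum_kernel_bound : exists2 l : R,
  \sum_(k < n) w k * Z k @[n --> \oo] --> l & `|l - b * (f 0 + a / 2 * f1 0)| <= S * B.
Proof.
have c1 : cvgn (series (fun k => w k * Z k)).
  apply: (@norm_bounded_cvg_series _ _ (2 * BZ)) => n.
  apply: (@le_trans _ _ (\sum_(k < n) `|w k| * BZ)).
    by apply: ler_sum => k _; rewrite normrM ler_wpM2l.
  rewrite -mulr_suml ler_wpM2r ?sum_norm_grunwald_weight//.
  exact: le_trans (normZ 0%N).
exists (limn (series (fun k => w k * Z k))).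
  by move: c1; rewrite seriesEord.
set l := limn _; have cl : \sum_(k < n) w k * Z k @[n --> \oo] --> l.
  by have := c1; rewrite /l seriesEord.
have c2 : \sum_(k < n) w k * (ZN k n - Z k) @[n --> \oo] --> 0.
  apply: (@tannery0 _ w 2 (BZ + BZ) _ (fun k n => ZN k n - Z k)).
  - exact: sum_norm_grunwald_weight.
  - by move=> k n; apply: (le_trans (ler_normB _ _)); rewrite lerD.
  - by move=> k; rewrite -(subrr (Z k)); apply: cvgB => //; exact: cvg_cst.
have c3 : T n - H n n%:R - b * (f 0 + a / 2 * f1 0) @[n --> \oo] --> l - b * (f 0 + a / 2 * f1 0).
  apply: cvgB; last exact: cvg_cst.
  rewrite -[X in _ --> X]subr0; apply: cvgB => //.
  rewrite -[X in _ --> X]add0r (_ : T = fun n => \sum_(k < n) w k * (ZN k n - Z k) + \sum_(k < n) w k * Z k).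
    exact: cvgD.
  by apply/funext => n; rewrite -big_split/=; apply: eq_bigr => k _; rewrite mulrBr subrK.
have S0 : 0 <= S by exact: le_trans (f2S 0).
have c4 : `|T n - H n n%:R - b * (f 0 + a / 2 * f1 0)| @[n --> \oo] --> `|l - b * (f 0 + a / 2 * f1 0)|.
  exact: cvg_norm.
have : limn (fun n => `|T n - H n n%:R - b * (f 0 + a / 2 * f1 0)|) <= S * B.
  apply: limr_le; first exact: (cvgP _ c4).
  by apply: nearW => n; apply: (le_trans (partial n)); rewrite ler_wpM2l.
by have -> := cvg_lim _ c4.
Qed.

End summation_by_kernel.

(** The constant depends on [a] alone, so [f t] may be [g (x - h * t)]: the second
    derivative then supplies a factor [h ^+ 2]. *)
Lemma grunwald_kernel_estimate (R : realType) (a : R) (mu := @lebesgue_measure R) : 0 < a < 1 ->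
  exists2 C : R, 0 <= C & forall (f f1 f2 : R -> R) (S B0 B1 BZ : R),
  let Kf (k : nat) (t : R) := kappa a (t - k%:R) * f t in
  (forall t : R, is_derive t (1 : R) f (f1 t)) ->
  (forall t : R, is_derive t (1 : R) f1 (f2 t)) -> continuous f2 ->
  (forall t : R, `|f t| <= B0) -> (forall t : R, `|f1 t| <= B1) -> (forall t : R, `|f2 t| <= S) ->
  (forall k, mu.-integrable `]k%:R, +oo[ (EFin \o Kf k)) ->
  (forall k, \int[mu]_(t in `]k%:R, +oo[) `|Kf k t| <= BZ) ->
  exists2 l : R,
    \sum_(k < n) grunwald_weight a k * \int[mu]_(t in `]k%:R, +oo[) Kf k t @[n --> \oo] --> l &
    `|l - beta_const a * (f 0 + a / 2 * f1 0)| <= S * C.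
Proof.
move=> a01; have [d [B [d0 dB kb2 kb1]]] := kernel_bound a01.
exists B; first by apply: le_trans (dB 0%N); rewrite big_ord0.
by move=> f f1 f2 S B0 B1 BZ Kf *; apply: (sum_kernel_bound a01 d0 dB kb2 kb1) => //; eassumption.
Qed.

(** * Fractional integrals of an integrable function *)

Section fubini_real.
Variable R : realType.
Local Notation mu := (@lebesgue_measure R).

Lemma integrable_restrict (D : set R) (f : R -> R) : measurable D ->
  mu.-integrable D (EFin \o f) <-> mu.-integrable setT (EFin \o (f \_ D)).
Proof.
move=> mD; rewrite (_ : EFin \o (f \_ D) = (EFin \o f) \_ D); last first.
  by apply/funext => x; rewrite /= !patchE; case: ifP.
by rewrite -integrable_mkcond.
Qed.

(** The inner integrals in one order are given in closed form, and integrability on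
    the product follows from the iterated bound in that order. *)
Lemma fubini_real (f : R * R -> R) (G : R -> R) (l : R) : measurable_fun setT f ->
  (forall x, mu.-integrable setT (fun y => (f (x, y))%:E)) ->
  (forall y, (\int[mu]_x (f (x, y))%:E = (G y)%:E)%E) ->
  (\int[mu]_y \int[mu]_x `|f (x, y)|%:E <= l%:E)%E ->
  let F x := \int[mu]_y f (x, y) in
  [/\ mu.-integrable setT (EFin \o F), \int[mu]_x F x = \int[mu]_y G y
    & \int[mu]_x `|F x| <= l].
Proof.
move=> mf xi yG bnd F.
have mfE : measurable_fun setT (EFin \o f) by exact/measurable_EFinP.
have fi : (mu \x mu)%E.-integrable setT (EFin \o f).
  apply: (@integrable21ltyP _ _ _ _ R mu mu _ mfE).2; exact: le_lt_trans (ltry l).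
have FE : EFin \o F = fubini_F mu (EFin \o f).
  by apply/funext => x; rewrite /= /F EFin_Rintegral; [|exact: measurableT|exact: xi].
have GE : EFin \o G = fubini_G mu (EFin \o f).
  by apply/funext => y; rewrite /= -yG.
have iF : mu.-integrable setT (EFin \o F) by rewrite FE; exact: integrable_fubini_F.
split => //.
- rewrite /Rintegral; congr fine.
  have := Fubini fi; rewrite /= => H.
  transitivity (\int[mu]_x fubini_F mu (EFin \o f) x)%E; first by apply: eq_integral => x _; rewrite -FE.
  transitivity (\int[mu]_x fubini_G mu (EFin \o f) x)%E; last by apply: eq_integral => x _; rewrite -GE.
  exact: H.
- have iFn := integrable_norm iF.
  rewrite -lee_fin EFin_Rintegral//; apply: le_trans bnd.
  have mn : measurable_fun setT (fun z => `|f z|%:E).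
    by apply/measurable_EFinP; exact: measurableT_comp.
  rewrite -(@fubini_tonelli _ _ _ _ _ mu mu (fun z => `|f z|%:E))//.
  apply: ge0_le_integral => //.
  + by apply: measurable_int; exact: iFn.
  + exact: (@measurable_fun_fubini_tonelli_F _ _ _ _ _ mu (fun z => `|f z|%:E)).
  + move=> x _; rewrite /F -[X in (X <= _)%E]/(`|F x|%:E).
    have -> : (`|F x|%:E = `| \int[mu]_y (f (x, y))%:E |)%E by rewrite -(EFin_Rintegral measurableT (xi x)).
    apply: le_abse_integral => //.
    by apply: measurable_int; exact: xi.
Qed.

End fubini_real.

Section abel.
Variable R : realType.
Local Notation mu := (@lebesgue_measure R).
Variables (a : R) (a01 : 0 < a < 1).
Variable u : R -> R.

(** The fractional integral of order [1 - a], without the factor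
    [(Gamma (1 - a))^-1]. *)
Definition abel (x : R) : R := \int[mu]_(s in `]-oo, x[) ((x - s) `^ (- a) * u s).

Definition primitive (x : R) : R := \int[mu]_(s in `]-oo, x[) u s.

Hypothesis ui : mu.-integrable setT (EFin \o u).
Hypothesis ai : forall x, mu.-integrable `]-oo, x[ (EFin \o (fun s => (x - s) `^ (- a) * u s)).

(* Powers cut off at 0, so that both integrals range over the whole line. *)
Let pw (p z : R) : R := z `^ p * \1_(`]0, +oo[%classic : set R) z.

Let pw_ge0 p z : 0 <= pw p z.
Proof. by rewrite mulr_ge0 ?powR_ge0// indicE. Qed.

Let pw_pos p z : 0 < z -> pw p z = z `^ p.
Proof. by move=> z0; rewrite /pw indicE mem_set ?mulr1//= in_itv/= z0. Qed.

Let pw_neg p z : z <= 0 -> pw p z = 0.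
Proof. by move=> z0; rewrite /pw indicE memNset ?mulr0//= in_itv/= andbT ltNge z0. Qed.

Let measurable_pw p : measurable_fun setT (pw p).
Proof. by apply: measurable_funM => //; exact: measurable_powR. Qed.

Variables (c h x : R).
Hypothesis h0 : 0 < h.
Let b := beta_const a.

Let kern (t s : R) := pw (a - 1) (t - c) * pw (- a) (x - h * t - s).

Let kern_ge0 t s : 0 <= kern t s. Proof. by rewrite mulr_ge0. Qed.

Let measurable_kern : measurable_fun setT (fun z : R * R => kern z.1 z.2).
Proof.
apply: measurable_funM; apply: (measurableT_comp (measurable_pw _)).
  by apply: measurable_funB => //; exact: measurable_fst.
apply: measurable_funB; last exact: measurable_snd.
by apply: measurable_funB => //; apply: measurable_funM => //; exact: measurable_fst.
Qed.

Let measurable_kern1 s : measurable_fun setT (kern ^~ s).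
Proof.
apply: measurable_funM; apply: (measurableT_comp (measurable_pw _)).
  by apply: measurable_funB.
apply: measurable_funB => //.
by apply: measurable_funB => //; exact: measurable_funM.
Qed.

Let Q (s : R) := h `^ (- a) * b * \1_(`]-oo, x - h * c[%classic : set R) s.

Let Q_ge0 s : 0 <= Q s.
Proof. by rewrite !mulr_ge0 ?powR_ge0// ?indicE// /b ltW// beta_const_gt0. Qed.

(** A Beta integral over an interval that depends on [s], but whose value does not. *)
Let integral_kern s : (\int[mu]_t (kern t s)%:E = (Q s)%:E)%E.
Proof.
rewrite /Q indicE; have [sy|sy] := ltP s (x - h * c); last first.
  rewrite memNset ?mulr0; last by rewrite /= in_itv/= ltNge sy.
  apply: integral0_eq => t _; congr (_%:E); rewrite /kern.
  have [tc|tc] := leP t c; first by rewrite pw_neg ?mul0r// subr_le0.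
  rewrite [X in _ * X]pw_neg ?mulr0//.
  have : h * c < h * t by rewrite ltr_pM2l.
  lra.
rewrite mem_set ?mulr1; last by rewrite /= in_itv/= sy.
pose d := (x - s) / h.
have hd : h * d = x - s by rewrite /d mulrCA divff ?mulr1// gt_eqF.
have cd : c < d by rewrite /d ltr_pdivlMr//; lra.
rewrite (_ : (fun t => _) = (fun t => (h `^ (- a))%:E * (((t - c) `^ (a - 1) * (d - t) `^ (- a))%:E))%E \_ `]c, d[); last first.
  apply/funext => t; rewrite patchE; case: ifPn => [|/negP tcd].
    rewrite inE/= in_itv/= => /andP[ct td].
    rewrite /kern !pw_pos; [|nra|nra].
    rewrite (_ : x - h * t - s = h * (d - t)); last by rewrite mulrBr hd; ring.
    rewrite powRM ?(ltW h0) ?subr_ge0 ?(ltW td)// -EFinM mulrCA//.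
  congr (_%:E); rewrite /kern.
  have [tc|tc] := leP t c; first by rewrite pw_neg ?mul0r// subr_le0.
  rewrite [X in _ * X]pw_neg ?mulr0//.
  have dt : d <= t by rewrite leNgt; apply/negP => td; apply: tcd; rewrite inE/= in_itv/= tc td.
  by nra.
rewrite -integral_mkcond ge0_integralZl//.
- by rewrite beta_integral// -EFinM.
- apply/measurable_EFinP; apply: measurable_funTS; apply: measurable_funM.
    by apply: (measurableT_comp (@measurable_powR R (a - 1))); exact: measurable_funB.
  by apply: (measurableT_comp (@measurable_powR R (- a))); exact: measurable_funB.
- by move=> t _; rewrite lee_fin mulr_ge0 ?powR_ge0.
- by rewrite lee_fin powR_ge0.
Qed.

Let F (z : R * R) := kern z.1 z.2 * u z.2.

Let mF : measurable_fun setT F.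
Proof.
apply: measurable_funM => //.
have mu' : measurable_fun setT u by apply/measurable_EFinP; exact: measurable_int ui.
by apply: (measurableT_comp mu'); exact: measurable_snd.
Qed.

Let slice t s : F (t, s) = pw (a - 1) (t - c) *
  ((fun s => ((x - h * t) - s) `^ (- a) * u s) \_ `]-oo, x - h * t[) s.
Proof.
rewrite /F/= /kern -mulrA; congr (_ * _); rewrite patchE; case: ifPn => [|/negP n].
  by rewrite inE/= in_itv/= => st; rewrite pw_pos// subr_gt0.
rewrite pw_neg ?mul0r// subr_le0 leNgt; apply/negP => st.
by apply: n; rewrite inE/= in_itv.
Qed.

Let Fi t : mu.-integrable setT (fun s => (F (t, s))%:E).
Proof.
rewrite (_ : (fun s => _) = EFin \o (fun s => pw (a - 1) (t - c) *
  ((fun s => ((x - h * t) - s) `^ (- a) * u s) \_ `]-oo, x - h * t[) s)); last first.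
  by apply/funext => s; rewrite /= slice.
apply: integrable_scale => //.
by apply: (integrable_restrict _ _).1 => //; exact: ai.
Qed.

Let FG s : (\int[mu]_t (F (t, s))%:E = (Q s * u s)%:E)%E.
Proof.
have ki : mu.-integrable setT (EFin \o (kern ^~ s)).
  by apply: ge0_integrable_of_integral (integral_kern s) => //; exact: measurable_kern1.
rewrite mulrC EFinM -integral_kern -integralZl//.
by apply: eq_integral => t _; rewrite /F /= -EFinM mulrC.
Qed.

Let norm1 := \int[mu]_s `|u s|.

Let Fbound : (\int[mu]_s \int[mu]_t `|F (t, s)|%:E <= (h `^ (- a) * b * norm1)%:E)%E.
Proof.
have inner s : (\int[mu]_t `|F (t, s)|%:E = (Q s * `|u s|)%:E)%E.
  rewrite mulrC EFinM -integral_kern -ge0_integralZl//.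
  - by apply: eq_integral => t _; rewrite /F /= normrM (ger0_norm (kern_ge0 _ _)) -EFinM mulrC.
  - by apply: measurable_fun_EFin; exact: measurable_kern1.
  - by move=> t _; rewrite lee_fin kern_ge0.
under eq_integral do rewrite inner.
have C0 : 0 <= h `^ (- a) * b by rewrite mulr_ge0 ?powR_ge0// /b ltW// beta_const_gt0.
rewrite EFinM /norm1 EFin_Rintegral//; last exact: integrable_norm.
rewrite -ge0_integralZl//; last first.
- by apply: measurable_int; exact: (integrable_norm ui).
apply: ge0_le_integral => //.
- by move=> s _; rewrite lee_fin mulr_ge0.
- apply/measurable_EFinP; apply: measurable_funM.
    by apply: measurable_funM => //.
  by apply/measurable_EFinP; apply: measurable_int; exact: (integrable_norm ui).
- by apply: measurable_funeM; apply: measurable_int; exact: (integrable_norm ui).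
- move=> s _; rewrite -EFinM lee_fin ler_wpM2r// ler_piMr//.
Qed.

Let Gb := Gamma (1 - a).
Let Kf t := kappa a (t - c) * (abel (x - h * t) / Gb).

Let FE : (fun t => \int[mu]_s F (t, s)) = Kf \_ `]c, +oo[.
Proof.
apply/funext => t; rewrite (_ : \int[mu]_s F (t, s) = pw (a - 1) (t - c) * abel (x - h * t)); last first.
  rewrite /abel [in RHS]Rintegral_mkcond -RintegralZl//; last first.
    by apply: (integrable_restrict _ _).1 => //; exact: ai.
  by apply: eq_Rintegral => s _; rewrite slice.
rewrite patchE; case: ifPn => [|/negP n].
  rewrite inE/= in_itv/= andbT => ct; rewrite pw_pos ?subr_gt0// /Kf /kappa -/Gb.
  have Gb0 : Gb != 0 by case/andP: a01 => a0 a1; rewrite gt_eqF// Gamma_gt0//; lra.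
  by field.
rewrite pw_neg ?mul0r// subr_le0 leNgt; apply/negP => st.
by apply: n; rewrite inE/= in_itv/= st.
Qed.

Lemma integrable_kappa_abel : mu.-integrable `]c, +oo[ (EFin \o Kf).
Proof.
have [+ _ _] := fubini_real mF Fi FG Fbound.
by rewrite FE => H; apply: (integrable_restrict _ _).2.
Qed.

Lemma integral_norm_kappa_abel :
  \int[mu]_(t in `]c, +oo[) `|Kf t| <= h `^ (- a) * b * norm1.
Proof.
have [_ _ +] := fubini_real mF Fi FG Fbound.
rewrite (_ : (fun t => _) = (fun t => `| Kf t|) \_ `]c, +oo[); last first.
  apply/funext => t; rewrite -[\int[mu]_y _]/((fun t => \int[mu]_s F (t, s)) t) FE !patchE.
  by case: ifPn => // _; rewrite normr0.
by rewrite -Rintegral_mkcond.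
Qed.

(** Fractional integrals of orders [a] and [1 - a] compose to the ordinary primitive.
    Cutting the kernel at [c] translates the primitive by [h * c], so a weighted sum of
    translates of the primitive is an integral against a weighted sum of kernels. *)
Lemma integral_kappa_abel :
  \int[mu]_(t in `]c, +oo[) Kf t = h `^ (- a) * b * primitive (x - h * c).
Proof.
have [_ + _] := fubini_real mF Fi FG Fbound.
rewrite FE -Rintegral_mkcond => ->.
rewrite /primitive [in RHS]Rintegral_mkcond -RintegralZl//; last first.
  apply: (integrable_restrict _ _).1 => //.
  by apply: (integrableS _ _ _ ui).
apply: eq_Rintegral => s _; rewrite /Q -mulrA; congr (_ * _); rewrite patchE indicE.
by case: (_ \in _); rewrite ?mul1r ?mul0r.
Qed.

End abel.

(** * Integrable functions with integrable trigonometric transforms *)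

Section poisson.
Variable R : realType.
Local Notation mu := (@lebesgue_measure R).
Implicit Types (v f : R -> R).

Lemma Rintegral_cvg_dominated (fn : nat -> R -> R) f (g : R -> R) :
  (forall n, measurable_fun setT (fn n)) -> measurable_fun setT f ->
  {ae mu, forall x, fn n x @[n --> \oo] --> f x} ->
  mu.-integrable setT (EFin \o g) -> (forall n x, `|fn n x| <= g x) ->
  \int[mu]_x fn n x @[n --> \oo] --> \int[mu]_x f x.
Proof.
move=> mfn mf fnf gi fng.
have [||||| fi _ H] := @dominated_convergence _ _ _ mu setT measurableT (fun n => EFin \o fn n) (EFin \o f)
  (EFin \o g).
- by move=> n; apply/measurable_EFinP; exact: mfn.
- exact/measurable_EFinP.
- apply: filterS fnf; first exact: (ae_filter_ringOfSetsType mu).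
  by move=> x h _; apply: cvg_EFin h; exact: nearW.
- exact: gi.
- by apply: aeW => x n _; exact: fng.
apply: fine_cvg; rewrite fineK; first exact: H.
exact: integrable_fin_num.
Qed.

Lemma norm_cvg_le (un : nat -> R) (l B : R) : un n @[n --> \oo] --> l ->
  (forall n, `|un n| <= B) -> `|l| <= B.
Proof.
move=> ul uB; have Hn : `|un n| @[n --> \oo] --> `|l| by exact: cvg_norm.
rewrite -(cvg_lim _ Hn)//; apply: limr_le; first exact: (cvgP _ Hn).
exact: nearW.
Qed.

Lemma expR_scale_cvg0 (e : R) : 0 < e -> expR (- (e * w)) @[w --> +oo] --> 0.
Proof.
move=> e0; apply: (@cvg_comp _ _ _ (fun w => e * w) (fun z => expR (- z)) _ (pinfty_nbhs R)).
  exact: gt0_cvgMry.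
exact: cvgr_expR.
Qed.

Lemma integrable_expR_scale (e : R) : 0 < e ->
  mu.-integrable `]0%R, +oo[ (EFin \o (fun w : R => expR (- (e * w)))).
Proof.
move=> e0; have := @integrable_Gamma_integrand R 1 e ltr01 e0.
rewrite (_ : (fun y : R => _ * _) = (fun y => expR (- (e * y)))) //.
by apply/funext => y; rewrite subrr powRr0 mul1r.
Qed.

Let expR_cos_continuous (e X w : R) :
  {for w, continuous (fun w => expR (- (e * w)) * cos (w * X))}.
Proof.
have H1 : is_derive w (1 : R) (fun w => w * X) X by apply: is_derive_eq; rewrite /GRing.scale/=; ring.
have H2 := @is_derive1_comp _ cos (fun w => w * X) w _ _ (is_derive_cos _) H1.
have H3 : is_derive w (1 : R) (fun w => expR (- (e * w))) (expR (- (e * w)) * (- e)).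
  by apply: is_derive_eq; rewrite /GRing.scale/=; ring.
by apply: continuousM; [exact: (is_derive1_continuous H3) | exact: (is_derive1_continuous H2)].
Qed.

Lemma integrable_expR_cos (e X : R) : 0 < e ->
  mu.-integrable `]0%R, +oo[ (EFin \o (fun w : R => expR (- (e * w)) * cos (w * X))).
Proof.
move=> e0; apply: (integrable_dominated _ _ (integrable_expR_scale e0)) => //.
- by apply: measurable_fun_0y => w _; exact: expR_cos_continuous.
- move=> w _; rewrite normrM ger0_norm ?expR_ge0// ler_piMr ?expR_ge0//.
  by rewrite ler_norml cos_geN1 cos_le1.
Qed.

Lemma laplace_cos (e X : R) : 0 < e ->
  (\int[mu]_(w in `]0%R, +oo[) (expR (- (e * w)) * cos (w * X))%:E = (e / (e ^+ 2 + X ^+ 2))%:E)%E.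
Proof.
move=> e0; have q0 : 0 < e ^+ 2 + X ^+ 2 by rewrite ltr_wpDr ?sqr_ge0// exprn_gt0.
pose F w := expR (- (e * w)) * ((X * sin (w * X) - e * cos (w * X)) / (e ^+ 2 + X ^+ 2)).
have dF w : is_derive w (1 : R) F (expR (- (e * w)) * cos (w * X)).
  have H1 : is_derive w (1 : R) (fun w => w * X) X by apply: is_derive_eq; rewrite /GRing.scale/=; ring.
  have H2 := @is_derive1_comp _ cos (fun w => w * X) w _ _ (is_derive_cos _) H1.
  have H3 := @is_derive1_comp _ sin (fun w => w * X) w _ _ (is_derive_sin _) H1.
  rewrite /F; apply: is_derive_eq; rewrite /GRing.scale/=.
  by field; rewrite gt_eqF.
have -> : e / (e ^+ 2 + X ^+ 2) = 0 - F 0.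
  by rewrite /F mulr0 mul0r oppr0 expR0 sin0 cos0; field; rewrite gt_eqF.
apply: (integral_FTC_0y (F := F)).
- by move=> w _; exact: expR_cos_continuous.
- exact: integrable_expR_cos.
- by apply: cvg_at_right_filter; exact: (is_derive1_continuous (dF 0)).
- pose K := (`|X| + e) / (e ^+ 2 + X ^+ 2).
  have h : expR (- (e * w)) * K @[w --> +oo] --> 0.
    by rewrite -[X in _ --> X](mul0r K); apply: cvgM; [exact: expR_scale_cvg0 | exact: cvg_cst].
  have h' : - (expR (- (e * w)) * K) @[w --> +oo] --> 0 by rewrite -[X in _ --> X]oppr0; apply: cvgN.
  apply: (squeeze_cvgr _ h' h); apply: nearW => w; rewrite -ler_norml.
  rewrite /F normrM ger0_norm ?expR_ge0// ler_wpM2l ?expR_ge0//.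
  rewrite normrM [`|_^-1|]gtr0_norm ?invr_gt0// ler_wpM2r ?invr_ge0 ?(ltW q0)//.
  apply: (le_trans (ler_normB _ _)); rewrite !normrM (gtr0_norm e0).
  apply: lerD; rewrite ler_piMr ?(ltW e0)// ler_norml.
    by rewrite sin_geN1 sin_le1.
  by rewrite cos_geN1 cos_le1.
Qed.

Variable v : R -> R.
Hypothesis vi : mu.-integrable setT (EFin \o v).
Let c w := \int[mu]_y (cos (w * y) * v y).
Let s w := \int[mu]_y (sin (w * y) * v y).
Hypothesis ci : mu.-integrable setT (EFin \o c).
Hypothesis si : mu.-integrable setT (EFin \o s).
Let M0 := \int[mu]_w (`|c w| + `|s w|).

Let mv : measurable_fun setT v.
Proof. by apply/measurable_EFinP; exact: measurable_int vi. Qed.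

Let measurable_sin : measurable_fun setT (@sin R).
Proof. by apply: continuous_measurable_fun; exact: continuous_sin. Qed.

Let measurable_cos : measurable_fun setT (@cos R).
Proof. by apply: continuous_measurable_fun; exact: continuous_cos. Qed.

Let measurable_expR : measurable_fun setT (@expR R).
Proof. by apply: continuous_measurable_fun; exact: continuous_expR. Qed.

Let trig_int (t : R -> R) (w : R) : measurable_fun setT t -> (forall x, `|t x| <= 1) ->
  mu.-integrable setT (EFin \o (fun y : R => t (w * y) * v y)).
Proof.
move=> mt t1; apply: (integrable_dominated _ _ (integrable_norm vi)) => //.
- apply: measurable_funM => //; apply: (measurableT_comp mt); exact: measurable_funM.
- by move=> y _ /=; rewrite normrM ler_piMl.
Qed.

Let cos1 (x : R) : `|cos x| <= 1. Proof. by rewrite ler_norml cos_geN1 cos_le1. Qed.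
Let sin1 (x : R) : `|sin x| <= 1. Proof. by rewrite ler_norml sin_geN1 sin_le1. Qed.

Let E (e w : R) := expR (- (e * w)) * \1_(`]0, +oo[%classic : set R) w.

Let EE e w : E e w = if w \in (`]0, +oo[%classic : set R) then expR (- (e * w)) else 0.
Proof. by rewrite /E indicE; case: (w \in _); rewrite ?mulr1 ?mulr0. Qed.

Let E_ge0 e w : 0 <= E e w.
Proof. by rewrite mulr_ge0 ?expR_ge0// indicE. Qed.

Let E_le1 e w : 0 < e -> E e w <= 1.
Proof.
move=> e0; rewrite EE; case: ifPn => //.
rewrite inE/= in_itv/= andbT => w0; by rewrite -expR0 ler_expR oppr_le0 mulr_ge0 ?ltW.
Qed.

(** The Poisson kernel is the cosine transform of [expR (- (e * w))]. By Fubini's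
    theorem the Poisson integral is an integral of the trigonometric transforms of [v]
    against factors of absolute value at most 1. *)
Lemma poisson_bound (e x0 : R) : 0 < e ->
  `|\int[mu]_y (e / (e ^+ 2 + (y - x0) ^+ 2) * v y)| <= M0.
Proof.
move=> e0.
pose f (z : R * R) := E e z.1 * cos (z.1 * (z.2 - x0)) * v z.2.
have mE : measurable_fun setT (E e).
  apply: measurable_funM => //; apply: (measurableT_comp measurable_expR).
  by apply: measurableT_comp => //; exact: measurable_funM.
have mf : measurable_fun setT f.
  apply: measurable_funM; last by apply: (measurableT_comp mv); exact: measurable_snd.
  apply: measurable_funM; first by apply: (measurableT_comp mE); exact: measurable_fst.
  apply: (measurableT_comp measurable_cos); apply: measurable_funM; first exact: measurable_fst.
  by apply: measurable_funB => //; exact: measurable_snd.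
have addition w y : f (w, y) = E e w * (cos (w * x0) * (cos (w * y) * v y) + sin (w * x0) * (sin (w * y) * v y)).
  by rewrite /f/= mulrBr cosB; ring.
have csi w : mu.-integrable setT (EFin \o (fun y => cos (w * x0) * (cos (w * y) * v y) + sin (w * x0) * (sin (w * y) * v y))).
  by apply: integrable_add => //; apply: integrable_scale => //; exact: trig_int.
have fi w : mu.-integrable setT (fun y => (f (w, y))%:E).
  rewrite (_ : (fun y => _) = EFin \o (fun y => E e w *
      (cos (w * x0) * (cos (w * y) * v y) + sin (w * x0) * (sin (w * y) * v y)))).
    by apply: integrable_scale => //.
  by apply/funext => y; rewrite addition.
have FE w : \int[mu]_y f (w, y) = E e w * (cos (w * x0) * c w + sin (w * x0) * s w).
  rewrite (_ : (fun y => f (w, y)) = (fun y => E e w *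
      (cos (w * x0) * (cos (w * y) * v y) + sin (w * x0) * (sin (w * y) * v y)))); last first.
    by apply/funext => y; exact: addition.
  rewrite RintegralZl// RintegralD//; try by apply: integrable_scale => //; exact: trig_int.
  by rewrite !RintegralZl//; exact: trig_int.
have Ecos X : EFin \o (fun w => E e w * cos (w * X)) = (EFin \o (fun w => expR (- (e * w)) * cos (w * X))) \_ `]0%R, +oo[.
  apply/funext => w; rewrite /= patchE EE; case: ifPn => // _.
  by rewrite mul0r.
have Eci X : mu.-integrable setT (EFin \o (fun w => E e w * cos (w * X))).
  by rewrite Ecos -integrable_mkcond//; exact: integrable_expR_cos.
have G y : (\int[mu]_w (f (w, y))%:E = (e / (e ^+ 2 + (y - x0) ^+ 2) * v y)%:E)%E.
  rewrite [in RHS]mulrC EFinM -laplace_cos// [in RHS]integral_mkcond -Ecos -integralZl//.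
  by apply: eq_integral => w _; rewrite /f/= -EFinM; congr (_%:E); ring.
have bnd : (\int[mu]_y \int[mu]_w `|f (w, y)|%:E <= (e^-1 * \int[mu]_y `|v y|)%:E)%E.
  have Ei : (\int[mu]_w (E e w)%:E = (e^-1)%:E)%E.
    have := laplace_cos 0 e0; rewrite expr0n/= addr0 expr2 invfM mulrA divff ?mul1r ?gt_eqF// => <-.
    rewrite [RHS]integral_mkcond; apply: eq_integral => w _; rewrite patchE EE mulr0 cos0 mulr1.
    by case: ifPn.
  rewrite EFinM EFin_Rintegral//; last exact: integrable_norm.
  rewrite -ge0_integralZl//; last 2 first.
  - by apply: measurable_int; exact: (integrable_norm vi).
  - by rewrite lee_fin invr_ge0 ltW.
  apply: ge0_le_integral => //.
  - by move=> y _; exact: integral_ge0.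
  - apply: (@measurable_fun_fubini_tonelli_G _ _ _ _ _ mu (fun z => `|f z|%:E)) => //.
    by apply: measurable_fun_EFin; exact: measurableT_comp.
  - by apply: measurable_funeM; apply: measurable_int; exact: (integrable_norm vi).
  - move=> y _; rewrite muleC -Ei -ge0_integralZl//; last 2 first.
      by apply: measurable_fun_EFin.
      by move=> w _; rewrite lee_fin E_ge0.
    apply: ge0_le_integral => //.
    + by apply: measurable_fun_EFin; apply: measurableT_comp => //; exact: measurableT_comp mf (pair2_measurable y).
    + by apply: measurable_funeM; exact: measurable_fun_EFin.
    + move=> w _; rewrite -EFinM lee_fin /f/= [leRHS]mulrC normrM ler_wpM2r//.
      by rewrite normrM (ger0_norm (E_ge0 _ _)) ler_piMr.
have [iF IF _] := fubini_real mf fi G bnd.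
rewrite -IF; have csn : mu.-integrable setT (EFin \o (fun w => `|c w| + `|s w|)).
  by apply: integrable_add => //; exact: integrable_norm.
apply: (Rintegral_dominated _ iF csn) => // w _; rewrite FE.
rewrite normrM (ger0_norm (E_ge0 _ _)); apply: (@le_trans _ _ (1 * `|cos (w * x0) * c w + sin (w * x0) * s w|)).
  by rewrite ler_wpM2r// E_le1.
rewrite mul1r; apply: (le_trans (ler_normD _ _)); rewrite !normrM.
by apply: lerD; rewrite ler_piMl.
Qed.

Let pk (e x y : R) := e / (e ^+ 2 + (y - x) ^+ 2).

Let pk_den (e z : R) : 0 < e -> 0 < e ^+ 2 + z ^+ 2.
Proof. by move=> e0; rewrite ltr_wpDr ?sqr_ge0// exprn_gt0. Qed.

Let pk_ge0 (e x y : R) : 0 < e -> 0 <= pk e x y.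
Proof. by move=> e0; rewrite divr_ge0 ?(ltW e0)// ltW// pk_den. Qed.

Let pk_le (e x y : R) : 0 < e -> pk e x y <= e^-1.
Proof.
move=> e0; rewrite /pk ler_pdivrMr ?pk_den// mulrDr expr2 mulKf ?gt_eqF//.
by rewrite lerDl mulr_ge0 ?sqr_ge0// invr_ge0 ltW.
Qed.

Let atan_pk (e y x : R) : 0 < e ->
  is_derive x (1 : R) (fun x => atan ((x - y) / e)) (pk e x y).
Proof.
move=> e0; have H : is_derive x (1 : R) (fun x => (x - y) / e) e^-1.
  by apply: is_derive_eq; rewrite /GRing.scale/=; ring.
have := @is_derive1_comp _ (@atan R) (fun x => (x - y) / e) x _ _ (is_derive1_atan _) H.
rewrite (_ : _ / e = pk e x y)//.
rewrite /pk -(opprB x y) sqrrN.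
have d0 := pk_den (x - y) e0; field; rewrite !gt_eqF//.
Qed.

Let D (e p q y : R) : R := atan ((q - y) / e) - atan ((p - y) / e).

(** Integrating over the centre [x] turns the Poisson kernel into a difference of
    arctangents, which stays bounded as [e] tends to 0. *)
Lemma poisson_integrated (e p q : R) : 0 < e -> p < q ->
  `|\int[mu]_y (D e p q y * v y)| <= M0 * (q - p).
Proof.
move=> e0 pq; pose I (x : R) : R := \1_(`[p, q]%classic : set R) x.
pose f (z : R * R) := I z.1 * (pk e z.1 z.2 * v z.2).
have I_ge0 x : 0 <= I x by rewrite /I indicE.
have I_le1 x : I x <= 1 by rewrite /I indicE; case: (x \in _).
have mpk : measurable_fun setT (fun z : R * R => pk e z.1 z.2).
  have -> : (fun z : R * R => pk e z.1 z.2) = (fun z => e * (e ^+ 2 + (z.2 - z.1) ^+ 2) `^ (-1)).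
    by apply/funext => z; rewrite powR_inv1// ltW// pk_den.
  apply: measurable_funM => //; apply: (measurableT_comp (@measurable_powR R (-1))).
  apply: measurable_funD => //; apply: measurable_funX.
  by apply: measurable_funB; [exact: measurable_snd | exact: measurable_fst].
have mI : measurable_fun setT I by exact: measurable_indic.
have mf : measurable_fun setT f.
  apply: measurable_funM; first by apply: (measurableT_comp mI); exact: measurable_fst.
  by apply: measurable_funM => //; apply: (measurableT_comp mv); exact: measurable_snd.
have pvi x : mu.-integrable setT (EFin \o (fun y => pk e x y * v y)).
  apply: (integrable_dominated _ _ (integrable_scale measurableT e^-1 (integrable_norm vi))) => //.
    by apply: measurable_funM => //; exact: measurableT_comp mpk (pair1_measurable x).
  by move=> y _; rewrite normrM (ger0_norm (pk_ge0 _ _ e0)) ler_wpM2r// pk_le.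
have fi x : mu.-integrable setT (fun y => (f (x, y))%:E).
  by have := integrable_scale measurableT (I x) (pvi x).
have ID y : (\int[mu]_x (I x * pk e x y)%:E = (D e p q y)%:E)%E.
  have -> : (fun x => (I x * pk e x y)%:E) = (EFin \o (pk e ^~ y)) \_ `[p, q].
    apply/funext => x; rewrite patchE /I indicE.
    by case: (_ \in _); rewrite ?mul1r// mul0r.
  rewrite -integral_mkcond; apply: (integral_seg_FTC pq (F := fun x => atan ((x - y) / e))).
  - by move=> x _; exact: atan_pk.
  - move=> x _; apply: cvgM; first exact: cvg_cst.
    apply: cvgV; first by rewrite gt_eqF// pk_den.
    have H : is_derive x (1 : R) (fun x => e ^+ 2 + (y - x) ^+ 2) (- (2 * (y - x))).
      by apply: is_derive_eq; rewrite /GRing.scale/=; ring.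
    exact: (is_derive1_continuous H).
have D_ge0 y : 0 <= D e p q y.
  by rewrite subr_ge0; apply: le_atan; rewrite ler_pM2r ?invr_gt0// lerB// ltW.
have mIpk y : measurable_fun setT (fun x => I x * pk e x y).
  by apply: measurable_funM => //; exact: measurableT_comp mpk (pair2_measurable y).
have Ipk_ge0 x y : 0 <= I x * pk e x y by rewrite mulr_ge0// pk_ge0.
have G y : (\int[mu]_x (f (x, y))%:E = (D e p q y * v y)%:E)%E.
  rewrite mulrC EFinM -ID -integralZl//; last by apply: ge0_integrable_of_integral (ID y) => //; exact: mIpk.
  by apply: eq_integral => x _; rewrite /f/= -EFinM; congr (_%:E); ring.
have bnd : (\int[mu]_y \int[mu]_x `|f (x, y)|%:E <= (pi * \int[mu]_y `|v y|)%:E)%E.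
  rewrite EFinM EFin_Rintegral//; last exact: integrable_norm.
  rewrite -ge0_integralZl//; last 2 first.
  - by apply: measurable_int; exact: (integrable_norm vi).
  - by rewrite lee_fin pi_ge0.
  apply: ge0_le_integral => //.
  - by move=> y _; exact: integral_ge0.
  - apply: (@measurable_fun_fubini_tonelli_G _ _ _ _ _ mu (fun z => `|f z|%:E)) => //.
    by apply: measurable_fun_EFin; exact: measurableT_comp.
  - by apply: measurable_funeM; apply: measurable_int; exact: (integrable_norm vi).
  - move=> y _; apply: (@le_trans _ _ (`|v y|%:E * (D e p q y)%:E)%E); last first.
      rewrite muleC -!EFinM lee_fin ler_wpM2r// /D.
      have := atan_ltpi2 ((q - y) / e); have := atan_gtNpi2 ((p - y) / e); lra.
    rewrite -ID -ge0_integralZl//; last 2 first.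
    + by apply: measurable_fun_EFin; exact: mIpk.
    + by move=> x _; rewrite lee_fin Ipk_ge0.
    apply: ge0_le_integral => //.
    + by apply: measurable_fun_EFin; apply: measurableT_comp => //; exact: measurableT_comp mf (pair2_measurable y).
    + by apply: measurable_funeM; apply: measurable_fun_EFin; exact: mIpk.
    + by move=> x _; rewrite -EFinM lee_fin /f/= mulrA normrM (ger0_norm (Ipk_ge0 _ _)) mulrC.
have [iF IF _] := fubini_real mf fi G bnd.
rewrite -IF.
have Ii0 : mu.-integrable setT (EFin \o I).
  rewrite (_ : EFin \o I = (cst 1%:E) \_ `[p, q]).
    rewrite -integrable_mkcond//; apply: (continuous_compact_integrable (f := cst 1)); first exact: segment_compact.
    by apply: continuous_in_subspaceT => x _; exact: cst_continuous.
  by apply/funext => x; rewrite /= patchE /I indicE; case: (_ \in _).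
have Ii : mu.-integrable setT (EFin \o (fun x => M0 * I x)) by exact: integrable_scale.
apply: (@le_trans _ _ (\int[mu]_x (M0 * I x))).
  apply: (Rintegral_dominated _ iF Ii) => // x _.
  rewrite (_ : \int[mu]_y f (x, y) = I x * \int[mu]_y (pk e x y * v y)); last by rewrite -RintegralZl.
  rewrite normrM (ger0_norm (I_ge0 _)) mulrC ler_wpM2r//.
  exact: poisson_bound.
have m1 : (mu `[p, q] = (q - p)%:E :> \bar R)%E.
  by rewrite /= lebesgue_measure_itv/= lte_fin pq -EFinB.
by rewrite RintegralZl// /Rintegral integral_indic// setIT [X in fine X]m1.
Qed.

(** As [e] tends to 0 the difference of arctangents tends to [pi] inside the interval
    and to 0 outside, so [poisson_integrated] passes to the limit. *)
Lemma integral_le_of_trig_transforms (p q : R) : p < q ->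
  `|\int[mu]_(y in `]p, q[) v y| <= M0 / pi * (q - p).
Proof.
move=> pq; pose ep (n : nat) : R := n.+1%:R^-1.
have ep0 n : 0 < ep n by rewrite invr_gt0.
have mD e : measurable_fun setT (D e p q).
  by apply: measurable_funB; apply: (measurableT_comp (continuous_measurable_fun (@continuous_atan R)));
    apply: measurable_funM => //; exact: measurable_funB.
pose L (y : R) : R := pi * (v \_ `]p, q[) y.
have lim_atan (x y : R) : y < x -> atan ((x - y) / ep n) @[n --> \oo] --> (pi / 2 : R).
  move=> yx; apply: (@cvg_comp _ _ _ (fun n => (x - y) / ep n) (@atan R) _ (pinfty_nbhs R)); last exact: cvgy_atan.
  rewrite (_ : (fun n => _) = (fun n => (x - y) * n.+1%:R)); last by apply/funext => n; rewrite /ep invrK.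
  apply: (@cvg_comp _ _ _ (fun n : nat => n.+1%:R) (fun z => (x - y) * z) _ (pinfty_nbhs R)).
    apply/cvgryPge => A; near=> n.
    apply: (@le_trans _ _ n%:R); last by rewrite ler_nat.
    by near: n; exact: nbhs_infty_ger.
  have xy0 : 0 < x - y by rewrite subr_gt0.
  exact: gt0_cvgMry.
have lim_atanN (x y : R) : x < y -> atan ((x - y) / ep n) @[n --> \oo] --> (- (pi / 2) : R).
  move=> xy; rewrite (_ : (fun n => _) = (fun n => - atan ((y - x) / ep n))).
    by apply: cvgN; exact: lim_atan.
  by apply/funext => n; rewrite -atanN -mulNr opprB.
have lim : {ae mu, forall y, D (ep n) p q y * v y @[n --> \oo] --> L y}.
  have N : mu.-negligible ([set p] `|` [set q]).
    by apply: negligibleU; apply/negligibleP => //; exact: lebesgue_measure_set1.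
  apply: (negligibleS _ N) => y /= h; apply: contrapT => /not_orP[yp yq].
  apply: h => {N}; have [yp'|py|ypE] := ltgtP y p; last by exfalso; apply: yp.
  - rewrite /L patchE memNset; last by rewrite /= in_itv/= (ltNge p) (ltW yp').
    rewrite mulr0 -(mul0r (v y)); apply: cvgM; last exact: cvg_cst.
    rewrite -(subrr (pi / 2)); apply: cvgB; apply: lim_atan => //; exact: lt_trans pq.
  - have [yq'|qy|yqE] := ltgtP y q; last by exfalso; apply: yq.
    + rewrite /L patchE mem_set; last by rewrite /= in_itv/= py.
      apply: cvgM; last exact: cvg_cst.
      have -> : (pi : R) = pi / 2 - (- (pi / 2)) by field.
      by apply: cvgB; [exact: lim_atan | exact: lim_atanN].
    + rewrite /L patchE memNset; last by rewrite /= in_itv/= py/= (ltNge y) (ltW qy).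
      rewrite mulr0 -(mul0r (v y)); apply: cvgM; last exact: cvg_cst.
      rewrite -(subrr (- (pi / 2))); apply: cvgB; apply: lim_atanN => //.
have vpq : mu.-integrable setT (EFin \o (v \_ `]p, q[)).
  by apply: (integrable_restrict _ _).1 => //; apply: (integrableS _ _ _ vi).
have Di : mu.-integrable setT (EFin \o (fun y => pi * `|v y|)).
  by apply: integrable_scale => //; exact: integrable_norm.
have := @Rintegral_cvg_dominated (fun n y => D (ep n) p q y * v y) L (fun y => pi * `|v y|).
move=> /(_ _ _ lim Di) H.
have {}H : \int[mu]_y (D (ep n) p q y * v y) @[n --> \oo] --> \int[mu]_y L y.
  apply: H.
  - by move=> n; exact: measurable_funM.
  - apply: measurable_funM => //; apply/measurable_EFinP; exact: measurable_int vpq.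
  - move=> n y; rewrite normrM ler_wpM2r// /D ler_norml.
    have := atan_ltpi2 ((q - y) / ep n); have := atan_gtNpi2 ((p - y) / ep n).
    have := atan_ltpi2 ((p - y) / ep n); have := atan_gtNpi2 ((q - y) / ep n).
    by move=> h1 h2 h3 h4; apply/andP; split; lra.
have E1 : \int[mu]_y L y = pi * \int[mu]_(y in `]p, q[) v y.
  by rewrite [in RHS]Rintegral_mkcond /L RintegralZl.
have : `|\int[mu]_y L y| <= M0 * (q - p).
  by apply: (norm_cvg_le H) => n; exact: poisson_integrated.
rewrite E1 normrM (ger0_norm (pi_ge0 R)) mulrAC ler_pdivlMr ?pi_gt0//.
by rewrite mulrC.
Unshelve. all: by end_near. Qed.

End poisson.

(** * Lebesgue points and derivatives bounded almost everywhere *)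

Section lebesgue_points.
Variable R : realType.
Local Notation mu := (@lebesgue_measure R).
Implicit Types (u F v : R -> R).

Lemma is_derive_of_derive1 (F : R -> R) (x d : R) :
  derivable F x 1 /\ derive1 F x = d -> is_derive x (1 : R) F d.
Proof. by move=> [dF E]; apply: DeriveDef => //; rewrite -derive1E. Qed.

Lemma negligible_shift (N : set R) (c : R) :
  mu.-negligible N -> mu.-negligible [set x | N (x + c)].
Proof.
move=> [A [mA A0 NA]].
have ms : measurable_fun setT (fun x : measurableTypeR R => (x + c : measurableTypeR R)).
  exact: measurable_funD.
pose nu : {measure set (measurableTypeR R) -> \bar R} :=
  measure_function_pushforward__canonical__measure_function_Measure mu ms.
exists ((fun x : R => x + c) @^-1` A); split.
- by rewrite -[X in measurable X]setTI; exact: (ms measurableT A mA).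
- transitivity (nu A) => //; rewrite -A0; apply/esym.
  apply: (lebesgue_measure_unique (mu := nu)) => // _ [[p q] _ <-] /=.
  rewrite /nu/= /pushforward.
  have -> : (fun x : R => x + c) @^-1` `]p, q] = `]p - c, q - c]%classic.
    by apply/seteqP; split => x /=; rewrite !in_itv/= ltrBlDr lerBrDr.
  rewrite !lebesgue_measure_itv/= !lte_fin ltrD2r; case: ifPn => // _.
  by rewrite -!EFinB; congr (_%:E); ring.
- by move=> x /=; exact: NA.
Qed.

Variable u : R -> R.
Hypothesis ui : mu.-integrable setT (EFin \o u).

Let iy (y : R) : mu.-integrable `]-oo, y] (EFin \o u).
Proof. by apply: (integrableS _ _ _ ui). Qed.

Let primitiveE : primitive u = (fun x => \int[mu]_(t in `]-oo, x]) u t).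
Proof.
apply/funext => x; rewrite /primitive Rintegral_itv_bndo_bndc//.
by apply: (integrableS _ _ _ ui).
Qed.

Lemma primitive_is_derive_ae :
  {ae mu, forall x, is_derive x (1 : R) (primitive u) (u x)}.
Proof.
have := FTC1Ny iy (open_integrable_locally openT ui).
apply: filterS; first exact: (ae_filter_ringOfSetsType mu).
by rewrite primitiveE => x; exact: is_derive_of_derive1.
Qed.

Lemma primitive_is_derive_continuous x : {for x, continuous u} ->
  is_derive x (1 : R) (primitive u) (u x).
Proof.
move=> cx; have xx : x < x + 1 by rewrite ltrDl.
have := @continuous_FTC1 R u -oo%O x (x + 1) xx (iy _) _ cx.
rewrite ltNyr => /(_ isT); rewrite primitiveE; exact: is_derive_of_derive1.
Qed.

Lemma primitive_sub p q : p < q ->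
  primitive u q - primitive u p = \int[mu]_(y in `]p, q[) u y.
Proof.
move=> pq; rewrite primitiveE (Rintegral_itvB (a := -oo%O)) ?bnd_simp ?ltW//.
rewrite Rintegral_itv_bndo_bndc//.
by apply: (integrableS _ _ _ ui).
Qed.

Lemma derive_quot_right (f : R -> R) (x d : R) : is_derive x (1 : R) f d ->
  h^-1 * (f (x + h) - f x) @[h --> 0^'+] --> d.
Proof.
move=> [dx <-]; have := cvg_dnbhs_at_right dx; rewrite -/(derive f x 1).
apply: cvg_trans; apply: near_eq_cvg; apply: nearW => h /=.
by rewrite /shift/= /GRing.scale/= mulr1 (addrC x).
Qed.

Lemma derive_quot_seq (f : R -> R) (x d : R) : is_derive x (1 : R) f d ->
  n.+1%:R * (f (x + n.+1%:R^-1) - f x) @[n --> \oo] --> d.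
Proof.
move=> /derive_quot_right /cvg_at_rightP /(_ (fun n => n.+1%:R^-1)) H.
have -> : (fun n => n.+1%:R * (f (x + n.+1%:R^-1) - f x)) =
    (fun n => n.+1%:R^-1^-1 * (f (x + n.+1%:R^-1) - f x)) by apply/funext => n; rewrite invrK.
apply: H; split; first by move=> n; rewrite invr_gt0.
exact: cvg_harmonic.
Qed.

Lemma le_norm_ae_of_integral (M : R) :
  (forall p q, p < q -> `|\int[mu]_(y in `]p, q[) u y| <= M * (q - p)) ->
  {ae mu, forall x, `|u x| <= M}.
Proof.
move=> uM; have := primitive_is_derive_ae.
apply: filterS; first exact: (ae_filter_ringOfSetsType mu).
move=> x /derive_quot_seq H; apply: (norm_cvg_le H) => n.
have xn : x < x + n.+1%:R^-1 by rewrite ltrDl invr_gt0.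
rewrite normrM normr_nat primitive_sub// mulrC -ler_pdivlMr ?ltr0n//.
by apply: (le_trans (uM _ _ xn)); rewrite addrC addKr.
Qed.

End lebesgue_points.

Section ae_bounded_derivative.
Variable R : realType.
Local Notation mu := (@lebesgue_measure R).
Variables (F v : R -> R) (M e p q : R).
Hypotheses (dF : forall x : R, is_derive x (1 : R) F (v x))
  (vM : {ae mu, forall x, v x <= M}) (M0 : 0 <= M) (e0 : 0 < e) (pq : p < q).

Let cover : exists V : nat -> set R,
  [/\ forall n, open (V n), forall n, (mu (V n) <= (e / (2 ^ n.+1)%:R)%:E)%E &
     forall x n, ~ V n x -> v x <= M].
Proof.
have [A [mA A0 NA]] := vM.
have h n : exists V : set R, [/\ open V, A `<=` V & (mu V <= (e / (2 ^ n.+1)%:R)%:E)%E].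
  have en : 0 < e / (2 ^ n.+1)%:R by rewrite divr_gt0// ltr0n expn_gt0.
  have Aoo : (mu A < +oo)%E by rewrite [X in (X < _)%E]A0.
  have [V [oV AV mV]] := lebesgue_regularity_outer mA Aoo en.
  exists V; split => //; have mV' : measurable V by exact: open_measurable.
  have mVA : measurable (V `\` A) by exact: measurableD.
  have -> : V = A `|` (V `\` A) by rewrite setDUK.
  apply: (le_trans (measureU2 _ mA mVA)).
  by rewrite [X in (X + _)%E]A0 add0e; exact: ltW.
have [V HV] := choice h; exists V; split => [n|n|x n Vx]; try by have [] := HV n.
by apply: contrapT => vx; apply: Vx; have [_ + _] := HV n; apply; apply: NA.
Qed.

(** Cover the exceptional null set by open sets [V n] of total measure at most [e], and
    let [psi x] be the sum of the measures of their traces on [`]p, x]]. It stays below [e]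
    and grows at an infinite rate at the points common to all the [V n], where the
    derivative may exceed [M]. Hence the largest [x] in [`[p, q]] such that
    [F x - F p - (M + e) * (x - p)] is at most [psi x] can only be [q]. *)
Lemma le_of_ae_derive_le_eps : F q - F p <= (M + e) * (q - p) + e.
Proof.
have [V [oV mV VM]] := cover.
have mVm n : measurable (V n) by exact: open_measurable.
pose psi (x : R) : \bar R := (\sum_(n <oo) mu (V n `&` `]p, x]))%E.
have mVI n (x y : R) : measurable (V n `&` `]x, y]) by exact: measurableI.
have psi_ge0 x : (0 <= psi x)%E by apply: nneseries_ge0.
have psi_le x y : x <= y -> (psi x <= psi y)%E.
  move=> xy; apply: lee_nneseries => // n _; apply: le_measure; rewrite ?inE; [exact: mVI|exact: mVI|].
  by apply: setIS; apply: subset_itvl; rewrite bnd_simp.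
have psi_e x : (psi x <= e%:E)%E.
  apply: le_trans (@epsilon_trick0 _ e xpredT (ltW e0)).
  apply: lee_nneseries => // n _; apply: le_trans (mV n).
  by apply: le_measure; rewrite ?inE; [exact: mVI|exact: mVm|exact: subIsetl].
pose Phi (x : R) := F x - F p - (M + e) * (x - p).
have cPhi (x : R) : {for x, continuous Phi}.
  have H := dF x; have H2 : is_derive x (1 : R) Phi (v x - (M + e)).
    by rewrite /Phi; apply: is_derive_eq; rewrite /GRing.scale/=; ring.
  exact: (is_derive1_continuous H2).
pose S := [set x : R | p <= x <= q /\ ((Phi x)%:E <= psi x)%E].
have Sp : S p by split; [rewrite lexx ltW | rewrite /Phi !subrr mulr0 subr0].
have supS : has_sup S by split; [exists p | exists q => x [/andP[]]].
pose c := sup S.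
have pc : p <= c by exact: sup_upper_bound.
have cq : c <= q by apply: ge_sup; [exists p | move=> x [/andP[]]].
have psic : (psi c < +oo)%E by exact: le_lt_trans (psi_e c) (ltry e).
have psicE : psi c = (fine (psi c))%:E by rewrite fineK// ge0_fin_numE.
have Sc : S c.
  split; first by rewrite pc cq.
  rewrite psicE lee_fin leNgt; apply/negP => lt.
  have /nbhs_ballP[d /= d0 Hd] : \forall x \near c, fine (psi c) < Phi x.
    exact: (cvgr_gt (Phi c) (cPhi c)).
  have [x Sx cx] := sup_adherent d0 supS.
  have xc : x <= c by exact: sup_upper_bound.
  have : fine (psi c) < Phi x.
    by apply: Hd; rewrite /ball/= ger0_norm ?subr_ge0//; rewrite -/c in cx; lra.
  rewrite ltNge => /negP; apply; case: Sx => _ Sx.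
  by rewrite -lee_fin -psicE; apply: (le_trans Sx); exact: psi_le.
suff cqE : c = q.
  have [_] := Sc; rewrite cqE => h; have := le_trans h (psi_e q).
  by rewrite lee_fin /Phi; lra.
apply/eqP; rewrite eq_le cq/= leNgt; apply/negP => {}cq.
have [K vK] : exists K : nat, v c < K%:R.
  exists (Num.truncn `|v c|).+1; apply: le_lt_trans (ler_norm _) _.
  exact: Num.Theory.truncnS_gt.
have step (L : R) : v c < L -> \forall h \near (0 : R)^'+, F (c + h) - F c <= L * h.
  move=> vL; have := derive_quot_right (dF c) => H.
  near=> h; have h0 : 0 < h by [].
  rewrite -ler_pdivrMr// mulrC; apply: ltW.
  by near: h; exact: (cvgr_lt _ H).
have hq : \forall h \near (0 : R)^'+, c + h <= q.
  near=> h; rewrite -lerBrDl; near: h.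
  by apply: nbhs_right_le; rewrite subr_gt0.
have noS (h : R) : 0 < h -> c + h <= q -> ((Phi (c + h)%R)%:E <= psi (c + h)%R)%E -> False.
  move=> h0 hcq hS; have : c + h <= c.
    by apply: sup_upper_bound => //; split => //; rewrite hcq andbT (le_trans pc)// lerDl ltW.
  by rewrite gerDl leNgt h0.
(* At a point [c] outside some [V n] the derivative is at most [M]; otherwise the first
   [K] of the open sets contain a right neighbourhood of [c], and [psi] grows there at a
   rate at least [K], which exceeds the derivative. *)
have [/existsNP[n Vn]|allV] := pselect (~ forall n, V n c); last first.
  have {}allV n : V n c by apply: contrapT => h; apply: allV => /(_ n).
  have nV : \forall h \near (0 : R)^'+, forall i, (i < K)%N -> `]c, c + h] `<=` V i.
    have H0 : forall m, exists2 d : R, 0 < d & forall i, (i < m)%N -> forall y, c < y < c + d -> V i y.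
      elim=> [|m [d d0 Hd]]; first by exists 1.
      have /nbhs_ballP[d2 /= d20 Hd2] : nbhs c (V m) by exact: open_nbhs_nbhs.
      exists (Num.min d d2); first by rewrite lt_min d0.
      move=> i; rewrite ltnS leq_eqVlt => /predU1P[->|im] y /andP[cy yd].
        apply: Hd2; rewrite /ball/= distrC ger0_norm ?subr_ge0 ?(ltW cy)// ltrBlDl.
        by apply: (lt_le_trans yd); rewrite lerD2l ge_min lexx orbT.
      apply: Hd => //; rewrite cy/=; apply: (lt_le_trans yd).
      by rewrite lerD2l ge_min lexx.
    have [d d0 Hd] := H0 K; near=> h => i iK y /=; rewrite in_itv/= => /andP[cy yh].
    apply: (Hd i iK); rewrite cy/=; apply: (le_lt_trans yh); rewrite ltrD2l.
    by near: h; exact: nbhs_right_lt.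
  near (0 : R)^'+ => h.
  have h0 : 0 < h by [].
  apply: (noS h h0); first by near: h.
  have Fh : F (c + h) - F c <= K%:R * h by near: h; exact: step.
  have Vh : forall i, (i < K)%N -> `]c, c + h] `<=` V i by near: h.
  have Phi_h : Phi (c + h) <= Phi c + K%:R * h.
    rewrite /Phi; have : 0 <= (M + e) * h.
      by apply: mulr_ge0; [apply: addr_ge0 => //; exact: ltW | exact: ltW].
    by rewrite mulrDl; lra.
  apply: (@le_trans _ _ (psi c + (K%:R * h)%:E)%E).
    have [_ h1] := Sc; apply: (@le_trans _ _ ((Phi c)%:E + (K%:R * h)%:E)%E); last by rewrite leeD2r.
    by rewrite -EFinD lee_fin.
  have split_psi : psi (c + h) = (psi c + \sum_(n <oo) mu (V n `&` `]c, (c + h)%R]))%E.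
    rewrite /psi -nneseriesD//; apply: eq_eseriesr => n _.
    have -> : V n `&` `]p, (c + h)%R] = (V n `&` `]p, c]) `|` (V n `&` `]c, (c + h)%R]).
      rewrite -setIUr; congr (_ `&` _).
      apply/seteqP; split => x /=; rewrite !in_itv/=.
        by move=> /andP[px xh]; have [xc|cx] := leP x c; [left; rewrite px | right].
      move=> [/andP[-> xc]|/andP[cx ->]]; rewrite ?andbT/=; last exact: le_lt_trans cx.
      by rewrite (le_trans xc)// lerDl ltW.
    apply: measureU; [exact: mVI | exact: mVI |].
    apply/seteqP; split => // x [[_ /=]]; rewrite !in_itv/= => /andP[_ xc] [_ /andP[cx _]].
    by move: cx; rewrite ltNge xc.
  rewrite split_psi leeD2l//.
  apply: (@le_trans _ _ (\sum_(0 <= i < K) mu (V i `&` `]c, (c + h)%R]))%E); last first.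
    by apply: nneseries_lim_ge.
  rewrite (_ : (\sum_(0 <= i < K) mu (V i `&` `]c, (c + h)%R]))%E = (\sum_(0 <= i < K) h%:E)%E); last first.
    apply: eq_big_nat => i /andP[_ iK]; rewrite setIidr; last exact: Vh.
    by rewrite lebesgue_measure_itv/= lte_fin ltrDl h0 -EFinB addrAC subrr add0r.
  by rewrite sumEFin lee_fin sumr_const_nat subn0 mulr_natl.
have vc : v c < M + e by rewrite (le_lt_trans (VM _ _ Vn))// ltrDl.
near (0 : R)^'+ => h.
have h0 : 0 < h by [].
apply: (noS h h0); first by near: h.
have Fh : F (c + h) - F c <= (M + e) * h by near: h; exact: step.
have [_ h1] := Sc; apply: (@le_trans _ _ (Phi c)%:E).
  by rewrite lee_fin /Phi; lra.
by apply: (le_trans h1); apply: psi_le; rewrite lerDl ltW.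
Unshelve. all: by end_near. Qed.

End ae_bounded_derivative.

(** A value of a derivative is a limit of difference quotients, and these are controlled
    by the bound almost everywhere. *)
Lemma norm_derive_le_of_ae (R : realType) (F v : R -> R) (M : R) :
  (forall x : R, is_derive x (1 : R) F (v x)) ->
  {ae @lebesgue_measure R, forall x, `|v x| <= M} -> 0 <= M ->
  forall x : R, `|v x| <= M.
Proof.
move=> dF vM M0 x.
have key (G w : R -> R) (p q : R) : (forall x : R, is_derive x (1 : R) G (w x)) ->
    {ae @lebesgue_measure R, forall x, w x <= M} -> p < q -> G q - G p <= M * (q - p).
  move=> dG wM pq; apply/ler_addgt0Pr => e e0.
  have c0 : 0 < q - p + 1 by rewrite ltr_pwDr// subr_ge0 ltW.
  have e'0 : 0 < e / (q - p + 1) by rewrite divr_gt0.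
  have := le_of_ae_derive_le_eps dG wM M0 e'0 pq.
  have -> : (M + e / (q - p + 1)) * (q - p) + e / (q - p + 1) = M * (q - p) + e.
    by field; rewrite gt_eqF.
  by [].
apply: (norm_cvg_le (derive_quot_seq (dF x))) => n.
have xn : x < x + n.+1%:R^-1 by rewrite ltrDl invr_gt0.
have E : x + n.+1%:R^-1 - x = n.+1%:R^-1 by rewrite addrC addKr.
have up : F (x + n.+1%:R^-1) - F x <= M * n.+1%:R^-1.
  rewrite -[X in _ <= M * X]E; apply: (key F v) => //.
  apply: filterS vM; first exact: (ae_filter_ringOfSetsType (@lebesgue_measure R)).
  by move=> y; rewrite ler_norml => /andP[].
have down : - F (x + n.+1%:R^-1) - - F x <= M * n.+1%:R^-1.
  rewrite -[X in _ <= M * X]E; apply: (key (fun y => - F y) (fun y => - v y)) => //.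
  apply: filterS vM; first exact: (ae_filter_ringOfSetsType (@lebesgue_measure R)).
  by move=> y; rewrite ler_norml => /andP[+ _]; rewrite lerNl.
rewrite normrM normr_nat mulrC -ler_pdivlMr ?ltr0n// ler_norml.
by rewrite up andbT lerNl opprB addrC; move: down; rewrite opprK.
Qed.

(** * Landau's inequality *)

Section landau.
Variable R : realType.
Local Notation mu := (@lebesgue_measure R).

Let cubic (a0 a1 a2 a3 t : R) := a0 + a1 * t + a2 * t ^+ 2 + a3 * t ^+ 3.

Let is_derive_pow (t : R) n : is_derive t (1 : R) (fun s : R => s ^+ n.+1) (n.+1%:R * t ^+ n).
Proof.
have := is_deriveX n.+1 (is_derive_id t (1 : R)).
rewrite /GRing.scale/= mulr1.
by have -> : (id : R -> R) ^+ n.+1 = (fun s => s ^+ n.+1) by rewrite exprfctE.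
Qed.

Let integral_cubic_mul (a0 a1 a2 a3 c0 c1 c2 c3 : R) :
  mu.-integrable `]0, 1[ (EFin \o (fun t : R => cubic a0 a1 a2 a3 t * cubic c0 c1 c2 c3 t)) /\
  \int[mu]_(t in `]0, 1[) (cubic a0 a1 a2 a3 t * cubic c0 c1 c2 c3 t) =
  a0 * (c0 + c1 / 2 + c2 / 3 + c3 / 4) + a1 * (c0 / 2 + c1 / 3 + c2 / 4 + c3 / 5) +
  a2 * (c0 / 3 + c1 / 4 + c2 / 5 + c3 / 6) + a3 * (c0 / 4 + c1 / 5 + c2 / 6 + c3 / 7).
Proof.
pose F (t : R) : R := a0 * c0 * t ^+ 1 + (a0 * c1 + a1 * c0) / 2 * t ^+ 2 +
  (a0 * c2 + a1 * c1 + a2 * c0) / 3 * t ^+ 3 +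
  (a0 * c3 + a1 * c2 + a2 * c1 + a3 * c0) / 4 * t ^+ 4 +
  (a1 * c3 + a2 * c2 + a3 * c1) / 5 * t ^+ 5 + (a2 * c3 + a3 * c2) / 6 * t ^+ 6 +
  a3 * c3 / 7 * t ^+ 7.
have dF (t : R) : is_derive t (1 : R) F (cubic a0 a1 a2 a3 t * cubic c0 c1 c2 c3 t).
  have H1 := is_derive_pow t 0; have H2 := is_derive_pow t 1; have H3 := is_derive_pow t 2.
  have H4 := is_derive_pow t 3; have H5 := is_derive_pow t 4; have H6 := is_derive_pow t 5.
  have H7 := is_derive_pow t 6.
  by rewrite /F; apply: is_derive_eq; rewrite /GRing.scale/= /cubic; field.
have cq (t : R) : {for t, continuous (fun t : R => cubic a0 a1 a2 a3 t * cubic c0 c1 c2 c3 t)}.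
  have H1 := is_derive_pow t 0; have H2 := is_derive_pow t 1; have H3 := is_derive_pow t 2.
  have Hc (b0 b1 b2 b3 : R) : is_derive t (1 : R) (cubic b0 b1 b2 b3) (b1 + b2 * (2 * t) + b3 * (3 * t ^+ 2)).
    by rewrite /cubic; apply: is_derive_eq; rewrite /GRing.scale/=; ring.
  apply: continuousM; exact: (is_derive1_continuous (Hc _ _ _ _)).
have ic : mu.-integrable `]0, 1[ (EFin \o (fun t : R => cubic a0 a1 a2 a3 t * cubic c0 c1 c2 c3 t)).
  by apply: integrable_oo_of_continuous => t _; exact: cq.
split => //; apply: EFin_inj; rewrite EFin_Rintegral//.
rewrite (integral_FTC_oo ltr01 (F := F) (l0 := F 0) (l1 := F 1)) //; last 2 first.
- by apply: cvg_at_right_filter; exact: (is_derive1_continuous (dF 0)).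
- by apply: cvg_at_left_filter; exact: (is_derive1_continuous (dF 1)).
by congr (_%:E); rewrite /F; field.
Qed.

Variables (g g1 g2 g3 g4 : R -> R) (M B : R).
Hypotheses (dg : forall x : R, is_derive x (1 : R) g (g1 x))
  (dg1 : forall x : R, is_derive x (1 : R) g1 (g2 x))
  (dg2 : forall x : R, is_derive x (1 : R) g2 (g3 x))
  (dg3 : forall x : R, is_derive x (1 : R) g3 (g4 x))
  (g4M : forall x, `|g4 x| <= M)
  (gB : forall x, \int[mu]_(t in `]0, 1[) `|g (x - t)| <= B).

Let remainder x t : 0 <= t <= 1 ->
  `|g (x - t) - cubic (g x) (- g1 x) (g2 x / 2) (- (g3 x / 6)) t| <= M.
Proof.
move=> /andP[t0 t1]; have := taylor4 x (x - t) dg dg1 dg2 dg3 g4M.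
have -> : x - t - x = - t by ring.
rewrite normrN (ger0_norm t0) => T; have M0 := le_trans (normr_ge0 _) (g4M 0).
rewrite (_ : g (x - t) - cubic _ _ _ _ _ =
  g (x - t) - g x - - t * g1 x - (- t) ^+ 2 / 2 * g2 x - (- t) ^+ 3 / 6 * g3 x); last first.
  by rewrite /cubic; field.
apply: (le_trans T); apply: (@le_trans _ _ (M * 1)); last by rewrite mulr1.
by apply: ler_pM; rewrite ?exprn_ge0 ?exprn_ile1//; lra.
Qed.

(** The left-hand side is the integral over the unit interval of the cubic times the
    Taylor polynomial of [g] at [x], whose [L^1] norm is at most [B + M]. *)
Let dual (a0 a1 a2 a3 K x : R) : (forall t : R, 0 <= t <= 1 -> `|cubic a0 a1 a2 a3 t| <= K) ->
  let c0 := g x in let c1 := - g1 x in let c2 := g2 x / 2 in let c3 := - (g3 x / 6) in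
  `|a0 * (c0 + c1 / 2 + c2 / 3 + c3 / 4) + a1 * (c0 / 2 + c1 / 3 + c2 / 4 + c3 / 5) +
  a2 * (c0 / 3 + c1 / 4 + c2 / 5 + c3 / 6) + a3 * (c0 / 4 + c1 / 5 + c2 / 6 + c3 / 7)| <= K * (B + M).
Proof.
move=> aK /=; have [ic <-] := integral_cubic_mul a0 a1 a2 a3 (g x) (- g1 x) (g2 x / 2) (- (g3 x / 6)).
have K0 : 0 <= K by apply: le_trans (aK 0 _); rewrite ?lexx ?ler01.
have gi : mu.-integrable `]0, 1[ (EFin \o (fun t => `|g (x - t)|)).
  apply: integrable_norm; apply: integrable_oo_of_continuous => t _.
  exact: (is_derive1_continuous (is_derive_reflect (dg _))).
have Mi := @integrable_cst_oo R 0 1 M.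
have gMi : mu.-integrable `]0, 1[ (EFin \o (fun t => `|g (x - t)| + cst M t)) by exact: integrable_add.
have si : mu.-integrable `]0, 1[ (EFin \o (fun t => K * (`|g (x - t)| + cst M t))) by exact: integrable_scale.
apply: (@le_trans _ _ (\int[mu]_(t in `]0, 1[) (K * (`|g (x - t)| + cst M t)))).
  apply: (Rintegral_dominated _ ic si) => // t /=; rewrite in_itv/= => /andP[t0 t1].
  have t01 : 0 <= t <= 1 by rewrite !ltW.
  rewrite normrM; apply: ler_pM => //; first exact: aK.
  rewrite -lerBlDl; apply: le_trans (remainder x t01).
  by rewrite distrC; exact: lerB_dist.
rewrite RintegralZl//.
rewrite RintegralD// ler_wpM2l// lerD// Rintegral_cst//.
have m1 : (mu `]0%R, 1%R[ = 1%:E :> \bar R)%E by rewrite /= lebesgue_measure_itv/= lte_fin ltr01 -EFinB subr0.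
by rewrite [X in fine X]m1 mulr1.
Qed.

Let cubic_le (a0 a1 a2 a3 t : R) : 0 <= t <= 1 -> `|cubic a0 a1 a2 a3 t| <= `|a0| + `|a1| + `|a2| + `|a3|.
Proof.
move=> /andP[t0 t1]; rewrite /cubic.
apply: (le_trans (ler_normD _ _)); apply: lerD; last by rewrite normrM ler_piMr// ger0_norm ?exprn_ge0// exprn_ile1.
apply: (le_trans (ler_normD _ _)); apply: lerD; last by rewrite normrM ler_piMr// ger0_norm ?exprn_ge0// exprn_ile1.
apply: (le_trans (ler_normD _ _)); apply: lerD => //.
by rewrite normrM ler_piMr// ger0_norm.
Qed.

(** On the unit interval [4 - 30 t + 60 t^2 - 35 t^3] is orthogonal to [t], [t^2] and
    [t^3] and has integral 1/4, so [dual] isolates the value of [g]. The sum of the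
    absolute values of its coefficients is 129. *)
Lemma landau_bound x : `|g x| <= 4 * (129 * (B + M)).
Proof.
have /= := @dual 4 (-30) 60 (-35) 129 x.
set E := (X in `|X| <= _) => H; have -> : g x = 4 * E by rewrite /E; field.
rewrite normrM ger0_norm// ler_wpM2l//.
apply: H => t t01; apply: (le_trans (cubic_le _ _ _ _ t01)).
by rewrite !normrN !normr_nat; lra.
Qed.

(** Likewise [- 2 + 20 t - 45 t^2 + 28 t^3] is orthogonal to 1, [t^2] and [t^3], and its
    product with [t] has integral 1/60. *)
Lemma landau_bound1 x : `|g1 x| <= 60 * (95 * (B + M)).
Proof.
have /= := @dual (-2) 20 (-45) 28 95 x.
set E := (X in `|X| <= _) => H; have -> : g1 x = - (60 * E) by rewrite /E; field.
rewrite normrN normrM normr_nat ler_wpM2l//.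
apply: H => t t01; apply: (le_trans (cubic_le _ _ _ _ t01)).
by rewrite !normrN !normr_nat; lra.
Qed.

End landau.

(** * The expansion of the shifted operator for a non-integer order *)

Section estimate.
Variable R : realType.
Local Notation mu := (@lebesgue_measure R).

Lemma is_derive_line1 (f : R -> R) (x c d : R) : is_derive (x - c) (1 : R) f d ->
  is_derive x (1 : R) (fun x => f (x - c)) d.
Proof.
move=> H; by have := @is_derive1_comp _ f (fun t => t - c) x _ _ H (is_derive_shift c x); rewrite mulr1.
Qed.

Lemma exists_antiderivative (g : R -> R) (c d : R) : continuous g ->
  exists G : R -> R, forall y : R, c < y < d -> is_derive y (1 : R) G (g y).
Proof.
move=> cg; exists (fun y => \int[mu]_(t in `[c, y]) g t) => y /andP[cy yd].
have gi : mu.-integrable `[c, d] (EFin \o g).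
  apply: continuous_compact_integrable; first exact: segment_compact.
  by apply: continuous_in_subspaceT => t _; exact: cg.
exact: is_derive_of_derive1 (@continuous_FTC1_closed R g c y d yd gi cy (cg y)).
Qed.

Lemma line_in_itv (c d p q s : R) : 0 <= s <= 1 -> c < p < d -> c < q < d ->
  c < p + s * (q - p) < d.
Proof.
move=> /andP[s0 s1] /andP[cp pd] /andP[cq qd].
have [pq|/ltW qp] := leP p q.
- have h1 : 0 <= s * (q - p) by rewrite mulr_ge0// subr_ge0.
  have h2 : s * (q - p) <= q - p by rewrite ler_piMl// subr_ge0.
  by apply/andP; split; lra.
- have h1 : 0 <= s * (p - q) by rewrite mulr_ge0// subr_ge0.
  have h2 : s * (p - q) <= p - q by rewrite ler_piMl// subr_ge0.
  by apply/andP; split; lra.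
Qed.

Variables (a : R) (a01 : 0 < a < 1) (g U : R -> R) (Gb b norm1 : R).
Hypotheses (GbE : Gb = Gamma (1 - a)) (bE : b = beta_const a) (Gb0 : 0 < Gb) (b0 : 0 < b).

Let Kf (x h c t : R) := kappa a (t - c) * g (x - h * t).

Hypothesis Kf_int : forall x h c : R, 0 < h -> mu.-integrable `]c, +oo[ (EFin \o Kf x h c).
Hypothesis Kf_norm : forall x h c : R, 0 < h ->
  \int[mu]_(t in `]c, +oo[) `|Kf x h c t| <= h `^ (- a) * b * norm1.
Hypothesis Kf_eq : forall x h c : R, 0 < h ->
  \int[mu]_(t in `]c, +oo[) Kf x h c t = h `^ (- a) * b * U (x - h * c).

Variables (g1 g2 g3 g4 : R -> R) (M : R).
Hypotheses (dg : forall x : R, is_derive x (1 : R) g (g1 x))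
  (dg1 : forall x : R, is_derive x (1 : R) g1 (g2 x))
  (dg2 : forall x : R, is_derive x (1 : R) g2 (g3 x))
  (dg3 : forall x : R, is_derive x (1 : R) g3 (g4 x))
  (g4M : forall x, `|g4 x| <= M).

Let cg : continuous g.
Proof. by move=> x; exact: (is_derive1_continuous (dg x)). Qed.

Let gi01 (x : R) : mu.-integrable `]0, 1[ (EFin \o (fun t => g (x - t))).
Proof.
apply: integrable_oo_of_continuous => t _.
exact: (is_derive1_continuous (is_derive_reflect (dg _))).
Qed.

(** On the unit interval [kappa a] is at least [Gb], so the weighted bound controls the
    plain integral. *)
Let local_bound (x : R) : \int[mu]_(t in `]0, 1[) `|g (x - t)| <= Gb^-1 * (b * norm1).
Proof.
have := Kf_norm x 0 ltr01; rewrite powR1 mul1r => H.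
have Ki := integrable_norm (Kf_int x 0 ltr01).
have Ki1 : mu.-integrable `]0, 1[ (EFin \o (fun t => Gb^-1 * `|Kf x 1 0 t|)).
  apply: integrable_scale => //; apply: (integrableS _ _ _ Ki) => //.
  by move=> t /=; rewrite !in_itv/= andbT => /andP[].
apply: (@le_trans _ _ (\int[mu]_(t in `]0, 1[) (Gb^-1 * `|Kf x 1 0 t|))).
  apply: (le_trans (ler_norm _)).
  apply: (Rintegral_dominated _ (integrable_norm (gi01 x)) Ki1) => // t /=.
  rewrite in_itv/= => /andP[t0 t1]; rewrite normr_id /Kf mul1r subr0 /kappa -GbE.
  rewrite !normrM (gtr0_norm Gb0) (ger0_norm (powR_ge0 _ _)) -mulrA mulKf ?gt_eqF//.
  rewrite ler_peMl//; case/andP: a01 => a0 a1.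
  apply: (@le_trans _ _ (1 `^ (a - 1))); first by rewrite powR1.
  by apply: ler_powR_npos; rewrite ?t0 ?(ltW t1)//; lra.
rewrite RintegralZl//; last first.
  by apply: (integrableS _ _ _ Ki) => // t /=; rewrite !in_itv/= andbT => /andP[].
rewrite ler_wpM2l ?invr_ge0 ?(ltW Gb0)//; apply: le_trans H.
rewrite /Rintegral fine_le//.
- apply: integrable_fin_num => //; apply: (integrableS _ _ _ Ki) => //.
  by move=> t /=; rewrite !in_itv/= andbT => /andP[].
- exact: integrable_fin_num.
- apply: ge0_subset_integral => //; first by apply: measurable_int; exact: Ki.
  by move=> t /=; rewrite !in_itv/= andbT => /andP[].
Qed.

Let bounded_g : exists G0 : R, [/\ 0 <= G0, forall x, `|g x| <= G0 & forall x, `|g1 x| <= G0].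
Proof.
have H0 := landau_bound dg dg1 dg2 dg3 g4M local_bound.
have H1 := landau_bound1 dg dg1 dg2 dg3 g4M local_bound.
exists (4 * (129 * (Gb^-1 * (b * norm1) + M)) + 60 * (95 * (Gb^-1 * (b * norm1) + M))).
have h0 := le_trans (normr_ge0 _) (H0 0); have h1 := le_trans (normr_ge0 _) (H1 0).
split; first exact: addr_ge0.
- by move=> x; apply: (le_trans (H0 x)); rewrite lerDl.
- by move=> x; apply: (le_trans (H1 x)); rewrite lerDr.
Qed.

Let integral_kappa01 : mu.-integrable `]0, 1[ (EFin \o kappa a) /\
  \int[mu]_(t in `]0, 1[) kappa a t = Gb / a.
Proof.
case/andP: a01 => a0 a1.
have E : (\int[mu]_(t in `]0%R, 1%R[) (kappa a t)%:E = (Gb / a)%:E)%E.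
  have -> : Gb / a = kappa1 a 1 - kappa1 a 0 by rewrite /kappa1 -GbE powR1 powR0 ?gt_eqF// mulr0 subr0 mulr1.
  have d1 (t : R) : 0 < t -> is_derive t (1 : R) (kappa1 a) (kappa a t).
    move=> t0; have H := is_derive1_powR a t0.
    by rewrite /kappa1 /kappa; apply: is_derive_eq; rewrite /GRing.scale/=; field; rewrite gt_eqF.
  apply: (ge0_integral_FTC_oo ltr01 (f := kappa a) (F := kappa1 a) (l0 := kappa1 a 0) (l1 := kappa1 a 1)).
  - move=> t /andP[t0 _]; apply: cvgM; first exact: cvg_cst.
    exact: (is_derive1_continuous (is_derive1_powR _ t0)).
  - by move=> t _; rewrite mulr_ge0 ?powR_ge0// -GbE ltW.
  - by move=> t /andP[t0 _]; exact: d1.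
  - apply: cvgM; first exact: cvg_cst.
    have := @powR_shift_cvg_right R a 0 0 a0 (lexx _); rewrite subr0.
    by rewrite (_ : (fun x => _) = (fun x : R => x `^ a))//; apply/funext => x; rewrite subr0.
  - by apply: cvg_at_left_filter; exact: (is_derive1_continuous (d1 1 ltr01)).
split; last by rewrite /Rintegral E.
apply: ge0_integrable_of_integral E => //.
- apply: measurable_funM => //; apply: measurable_funTS; exact: measurable_powR.
- by move=> t _; rewrite mulr_ge0 ?powR_ge0// -GbE ltW.
Qed.

Section lipschitz.
Variables (G0 x x' : R).
Hypotheses (G00 : 0 <= G0) (gG : forall x, `|g x| <= G0) (g1G : forall x, `|g1 x| <= G0).

Let f t := g (x - t) - g (x' - t).

Let f_le t : `|f t| <= G0 * `|x - x'|.
Proof.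
rewrite /f (_ : x - x' = (x - t) - (x' - t)); last by ring.
by apply: (@taylor1 _ g g1) => s _.
Qed.

Let cf : continuous f.
Proof.
by move=> t; apply: cvgB; exact: (is_derive1_continuous (is_derive_reflect (dg _))).
Qed.

(** Beyond 1 the kernel is monotone but not integrable, so bounding [f] pointwise is not
    enough. The function [q] is an antiderivative of [- f] that is again a difference of two
    values of [G] at distance [`|x - x'|]; integrating by parts moves the derivative to
    the kernel, whose total variation is finite. *)
Let tail_le (N : R) : 1 < N -> `|\int[mu]_(t in `]1, N[) (kappa a t * f t)| <= 2 * Gb * (G0 * `|x - x'|).
Proof.
move=> N1; case/andP: a01 => a0 a1.
pose c := Num.min x x' - N - 1; pose d := Num.max x x' + 1.
have [G dG] := exists_antiderivative c d cg.
have range (t : R) : 0 < t <= N -> c < x - t < d /\ c < x' - t < d.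
  move=> /andP[t0 tN]; rewrite /c /d.
  have h1 : Num.min x x' <= x by rewrite ge_min lexx.
  have h2 : Num.min x x' <= x' by rewrite ge_min lexx orbT.
  have h3 : x <= Num.max x x' by rewrite le_max lexx.
  have h4 : x' <= Num.max x x' by rewrite le_max lexx orbT.
  by split; apply/andP; split; lra.
pose q t := G (x - t) - G (x' - t).
have q_le t : 0 < t <= N -> `|q t| <= G0 * `|x - x'|.
  move=> tN; rewrite /q (_ : x - x' = (x - t) - (x' - t)); last by ring.
  have [r1 r2] := range t tN.
  apply: (@taylor1 _ G g) => s s01; last exact: gG.
  by apply: dG; exact: line_in_itv.
have dq (t : R) : 0 < t <= N -> is_derive t (1 : R) q (- f t).
  move=> tN; have [r1 r2] := range t tN.
  have H2 := is_derive_reflect (dG _ r1); have H3 := is_derive_reflect (dG _ r2).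
  by rewrite /q; apply: is_derive_eq; rewrite /f opprK opprB addrC.
pose k' (t : R) := Gb * (a - 1) * t `^ (a - 2).
have dk (t : R) : 0 < t -> is_derive t (1 : R) (kappa a) (k' t).
  move=> t0; have H := is_derive1_powR (a - 1) t0.
  rewrite /kappa /k'; apply: is_derive_eq; rewrite /GRing.scale/= (_ : a - 1 - 1 = a - 2); last by ring.
  by rewrite -GbE; ring.
have ck' (t : R) : 0 < t -> {for t, continuous k'}.
  move=> t0; apply: cvgM; first exact: cvg_cst.
  exact: (is_derive1_continuous (is_derive1_powR _ t0)).
have pos (t : R) : 1 <= t -> 0 < t by apply: lt_le_trans.
have seg_int (r : R -> R) : (forall t : R, 1 <= t <= N -> {for t, continuous r}) ->
    mu.-integrable `]1, N[ (EFin \o r) by exact: integrable_oo_of_continuous.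
have ckf (t : R) : 1 <= t <= N -> {for t, continuous (fun t => kappa a t * f t)}.
  move=> /andP[t1 _]; apply: continuousM; last exact: cf.
  exact: (is_derive1_continuous (dk _ (pos _ t1))).
have ckq (t : R) : 1 <= t <= N -> {for t, continuous (fun t => k' t * q t)}.
  move=> /andP[t1 tN]; apply: continuousM; first exact: ck' (pos _ t1).
  by apply: (is_derive1_continuous (dq _ _)); rewrite (pos _ t1).
have i1 := seg_int _ ckf; have i2 := seg_int _ ckq.
have i3 : mu.-integrable `]1, N[ (EFin \o (fun t => - k' t)).
  by apply: seg_int => t /andP[t1 _]; apply: cvgN; exact: ck' (pos _ t1).
have dkq (t : R) : 1 <= t <= N -> is_derive t (1 : R) (fun t => kappa a t * q t) (k' t * q t - kappa a t * f t).
  move=> /andP[t1 tN]; have H1 := dk _ (pos _ t1).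
  have H2 : is_derive t (1 : R) q (- f t) by apply: dq; rewrite (pos _ t1).
  by apply: is_derive_eq; rewrite /GRing.scale/=; ring.
have FTC : (\int[mu]_(t in `]1%R, N[) (k' t * q t - kappa a t * f t)%:E = (kappa a N * q N - kappa a 1 * q 1)%:E)%E.
  apply: (integral_FTC_oo N1 (f := fun t => k' t * q t - kappa a t * f t) (F := fun t => kappa a t * q t)
    (l0 := kappa a 1 * q 1) (l1 := kappa a N * q N)).
  - by move=> t /andP[t1 tN]; apply: continuousB; [apply: ckq | apply: ckf]; rewrite !ltW.
  - exact: integrable_sub.
  - by move=> t /andP[t1 tN]; apply: dkq; rewrite !ltW.
  - by apply: cvg_at_right_filter; apply: (is_derive1_continuous (dkq _ _)); rewrite lexx ltW.
  - by apply: cvg_at_left_filter; apply: (is_derive1_continuous (dkq _ _)); rewrite lexx ltW.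
have FTC2 : (\int[mu]_(t in `]1%R, N[) (- k' t)%:E = (- kappa a N - - kappa a 1)%:E)%E.
  apply: (integral_FTC_oo N1 (f := fun t => - k' t) (F := fun t => - kappa a t) (l0 := - kappa a 1) (l1 := - kappa a N)) => //.
  - by move=> t /andP[t1 tN]; apply: cvgN; exact: ck' (lt_trans ltr01 t1).
  - by move=> t /andP[t1 tN]; have H := dk _ (lt_trans ltr01 t1); apply: is_derive_eq.
  - by apply: cvg_at_right_filter; apply: cvgN; exact: (is_derive1_continuous (dk _ ltr01)).
  - by apply: cvg_at_left_filter; apply: cvgN; exact: (is_derive1_continuous (dk _ (lt_trans ltr01 N1))).
have E1 : \int[mu]_(t in `]1, N[) (k' t * q t) - \int[mu]_(t in `]1, N[) (kappa a t * f t) =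
    kappa a N * q N - kappa a 1 * q 1 by rewrite -RintegralB// /Rintegral FTC.
have E2 : \int[mu]_(t in `]1, N[) - k' t = kappa a 1 - kappa a N.
  by rewrite /Rintegral FTC2/= opprK addrC.
set D := G0 * `|x - x'| in q_le *; have D0 : 0 <= D by rewrite mulr_ge0.
have B1 : `|\int[mu]_(t in `]1, N[) (k' t * q t)| <= D * (kappa a 1 - kappa a N).
  rewrite -E2 -RintegralZl//; apply: Rintegral_dominated => //.
    by apply: integrable_scale.
  move=> t /=; rewrite in_itv/= => /andP[t1 tN]; rewrite normrM mulrC.
  have t0 := lt_trans ltr01 t1.
  have k'0 : k' t <= 0 by rewrite /k' mulr_le0_ge0 ?powR_ge0// mulr_ge0_le0 ?(ltW Gb0)//; lra.
  rewrite (ler0_norm k'0) ler_wpM2r ?oppr_ge0//; apply: q_le.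
  by rewrite t0 ltW.
have kN : 0 <= kappa a N by rewrite mulr_ge0 ?powR_ge0// -GbE ltW.
have k1 : kappa a 1 = Gb by rewrite /kappa -GbE powR1 mulr1.
have qN : `|kappa a N * q N| <= D * kappa a N.
  by rewrite normrM (ger0_norm kN) mulrC ler_wpM2r// q_le// lexx (lt_trans ltr01).
have q1 : `|kappa a 1 * q 1| <= D * Gb.
  by rewrite normrM k1 (gtr0_norm Gb0) mulrC ler_wpM2r ?(ltW Gb0)// q_le// ltr01 ltW.
have -> : \int[mu]_(t in `]1, N[) (kappa a t * f t) =
    \int[mu]_(t in `]1, N[) (k' t * q t) - kappa a N * q N + kappa a 1 * q 1.
  by rewrite -addrA (addrC (- (kappa a N * q N))) -opprB -E1 subKr.
apply: (le_trans (ler_normD _ _)); apply: (le_trans (lerD (ler_normB _ _) (lexx _))).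
have -> : 2 * Gb * D = D * (kappa a 1 - kappa a N) + D * kappa a N + D * Gb by rewrite k1; ring.
exact: lerD (lerD B1 qN) q1.
Qed.

Let KfB t : 0 < t -> Kf x 1 0 t - Kf x' 1 0 t = kappa a t * f t.
Proof. by move=> t0; rewrite /Kf subr0 !mul1r /f mulrBr. Qed.

Lemma primitive_lipschitz_aux :
  `|U x - U x'| <= (Gb / a + 2 * Gb) * G0 / b * `|x - x'|.
Proof.
case/andP: a01 => a0 a1.
have i1 := Kf_int x 0 ltr01; have i2 := Kf_int x' 0 ltr01.
have i3 : mu.-integrable `]0, +oo[ (EFin \o (fun t => Kf x 1 0 t - Kf x' 1 0 t)) by exact: integrable_sub.
have E : b * (U x - U x') = \int[mu]_(t in `]0, +oo[) (Kf x 1 0 t - Kf x' 1 0 t).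
  by rewrite RintegralB// !Kf_eq// powR1 mulr0 !subr0; ring.
have cv := Rintegral_itv_cvg i3.
have cv2 : \int[mu]_(t in `]0, n.+2%:R]) (Kf x 1 0 t - Kf x' 1 0 t) @[n --> \oo] --> b * (U x - U x').
  rewrite E; have := cv; rewrite -(cvg_shiftS (fun n : nat => \int[mu]_(t in `]0, n%:R]) (Kf x 1 0 t - Kf x' 1 0 t))).
  by rewrite -(cvg_shiftS (fun n : nat => \int[mu]_(t in `]0, n.+1%:R]) (Kf x 1 0 t - Kf x' 1 0 t))).
rewrite mulrAC ler_pdivlMr// mulrC -{1}(gtr0_norm b0) -normrM.
apply: (norm_cvg_le cv2) => n; set N : R := n.+2%:R.
have N1 : 1 < N by rewrite ltr1n.
pose r t := Kf x 1 0 t - Kf x' 1 0 t.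
have sub (s : set R) : measurable s -> s `<=` `]0, +oo[ -> mu.-integrable s (EFin \o r).
  by move=> ms s0; apply: (integrableS _ _ _ i3).
have i0N : mu.-integrable `]0, N] (EFin \o r).
  by apply: sub => // t /=; rewrite !in_itv/= andbT => /andP[].
have -> : \int[mu]_(t in `]0, N]) r t = \int[mu]_(t in `]0, 1[) r t + \int[mu]_(t in `]1, N[) r t.
  rewrite [X in X + _]Rintegral_itv_bndo_bndc; last first.
    by apply: sub => // t /=; rewrite !in_itv/= andbT => /andP[].
  rewrite [X in _ + X]Rintegral_itv_bndo_bndc; last first.
    by apply: sub => // t /=; rewrite !in_itv/= andbT => /andP[t1 _]; exact: lt_trans t1.
  rewrite -(@Rintegral_itvB _ r (BRight 0) (BRight N) 1) ?subrKC ?bnd_simp ?ltW//.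
apply: (le_trans (ler_normD _ _)).
have -> : (Gb / a + 2 * Gb) * G0 * `|x - x'| = Gb / a * (G0 * `|x - x'|) + 2 * Gb * (G0 * `|x - x'|) by ring.
apply: lerD.
  have [ik Ek] := integral_kappa01.
  rewrite -Ek mulrC -RintegralZl//; apply: Rintegral_dominated => //.
  - by apply: sub => // t /=; rewrite !in_itv/= andbT => /andP[].
  - exact: integrable_scale.
  - move=> t /=; rewrite in_itv/= => /andP[t0 _]; rewrite /r KfB// normrM mulrC.
    have k0 : 0 <= kappa a t by rewrite mulr_ge0 ?powR_ge0// -GbE ltW.
    by rewrite (ger0_norm k0) ler_wpM2r.
rewrite (_ : \int[mu]_(t in `]1, N[) r t = \int[mu]_(t in `]1, N[) (kappa a t * f t)); first exact: tail_le N1.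
apply: eq_Rintegral => t; rewrite inE/= in_itv/= => /andP[t1 _].
by rewrite /r KfB// (lt_trans ltr01).
Qed.

End lipschitz.

(** The primitive is the fractional integral of order [a] of [g]: near 0 the kernel is
    integrable and [g] is Lipschitz, and the rest is [tail_le]. *)
Let primitive_lipschitz : exists2 L : R, 0 <= L & forall x x', `|U x - U x'| <= L * `|x - x'|.
Proof.
have [G0 [G00 gG g1G]] := bounded_g; case/andP: a01 => a0 a1.
exists ((Gb / a + 2 * Gb) * G0 / b).
  by rewrite !mulr_ge0 ?invr_ge0 ?(ltW b0)// addr_ge0 ?divr_ge0 ?mulr_ge0 ?(ltW Gb0) ?(ltW a0).
by move=> x x'; exact: primitive_lipschitz_aux.
Qed.

Section one_step.
Variables (h y : R) (u : R -> R) (C L G0 : R).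
Hypothesis h0 : 0 < h.
Hypothesis good : forall k : nat, is_derive (y - k%:R * h) (1 : R) U (u (y - k%:R * h)).
Hypotheses (L0 : 0 <= L) (UL : forall x x', `|U x - U x'| <= L * `|x - x'|).
Hypotheses (G00 : 0 <= G0) (gG : forall x, `|g x| <= G0) (g1G : forall x, `|g1 x| <= G0).
Hypothesis C0 : 0 <= C.
Hypothesis kernel_estimate : forall (f f1 f2 : R -> R) (S B0 B1 BZ : R),
  let Kf (k : nat) (t : R) := kappa a (t - k%:R) * f t in
  (forall t : R, is_derive t (1 : R) f (f1 t)) ->
  (forall t : R, is_derive t (1 : R) f1 (f2 t)) -> continuous f2 ->
  (forall t : R, `|f t| <= B0) -> (forall t : R, `|f1 t| <= B1) -> (forall t : R, `|f2 t| <= S) ->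
  (forall k, mu.-integrable `]k%:R, +oo[ (EFin \o Kf k)) ->
  (forall k, \int[mu]_(t in `]k%:R, +oo[) `|Kf k t| <= BZ) ->
  exists2 l : R,
    \sum_(k < n) grunwald_weight a k * \int[mu]_(t in `]k%:R, +oo[) Kf k t @[n --> \oo] --> l &
    `|l - b * (f 0 + a / 2 * f1 0)| <= S * C.

Let w := grunwald_weight a.
Let diff (f : R -> R) (z : R) := f z - f (z - h).
Let uk (k : nat) := u (y - k%:R * h).
Let ha := h `^ (- a).

Let ha0 : 0 < ha. Proof. exact: powR_gt0. Qed.

Let M0 : 0 <= M. Proof. exact: le_trans (g4M 0). Qed.

Let is_derive_rescale (f : R -> R) (z t d : R) : is_derive (z - h * t) (1 : R) f d ->
  is_derive t (1 : R) (fun t => f (z - h * t)) (- h * d).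
Proof.
move=> H; have H1 : is_derive t (1 : R) (fun t => z - h * t) (- h).
  by apply: is_derive_eq; rewrite /GRing.scale/=; ring.
by have := @is_derive1_comp _ f (fun t => z - h * t) t _ _ H H1; rewrite mulrC.
Qed.

Let u_le z : is_derive z (1 : R) U (u z) -> `|u z| <= L.
Proof.
move=> H; apply: (norm_cvg_le (derive_quot_seq H)) => n.
rewrite normrM normr_nat mulrC -ler_pdivlMr ?ltr0n//.
by apply: (le_trans (UL _ _)); rewrite addrC addKr ger0_norm// invr_ge0.
Qed.

Let diff2_lip p q : `|diff g2 p - diff g2 q| <= M * h * `|p - q|.
Proof.
apply: (@taylor1 _ (diff g2) (diff g3)) => s _.
  have H1 := dg2 (q + s * (p - q)).
  have H2 := is_derive_line1 (dg2 (q + s * (p - q) - h)).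
  by rewrite /diff; apply: is_derive_eq.
have := @taylor1 _ g3 g4 M (q + s * (p - q) - h) (q + s * (p - q)).
rewrite opprB subrKC (ger0_norm (ltW h0)); apply => r _; exact: g4M.
Qed.

(** The kernel estimate for the second difference of [g] with steps [e] and [h], divided
    by [e]. Its four terms are integrals against translates of [g], and the bound is
    uniform in [e] because [g4] is bounded. *)
Let quotient_estimate (e : R) : 0 < e ->
  let D (k : nat) := (U (y + e - k%:R * h) - U (y + e - k.+1%:R * h) -
     (U (y - k%:R * h) - U (y - k.+1%:R * h))) / e in
  exists2 l : R, \sum_(k < n) w k * D k @[n --> \oo] --> l &
    `|ha * l - (e^-1 * (diff g (y + e) - diff g y)
      - a / 2 * h * (e^-1 * (diff g1 (y + e) - diff g1 y)))| <= h ^+ 3 * M * C / b.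
Proof.
move=> e0 D.
pose f t := diff g (y + e - h * t) - diff g (y - h * t).
pose f1 t := - h * (diff g1 (y + e - h * t) - diff g1 (y - h * t)).
pose f2 t := h ^+ 2 * (diff g2 (y + e - h * t) - diff g2 (y - h * t)).
have ddiff (F F' : R -> R) (z t : R) : (forall x : R, is_derive x (1 : R) F (F' x)) ->
    is_derive t (1 : R) (fun t => diff F (z - h * t)) (- h * diff F' (z - h * t)).
  move=> dF; have H1 := is_derive_rescale (dF (z - h * t)).
  have H2 : is_derive t (1 : R) (fun t => F (z - h * t - h)) (- h * F' (z - h * t - h)).
    have := @is_derive_rescale F (z - h) t (F' (z - h - h * t)) (dF _).
    by under eq_fun do rewrite addrAC; rewrite addrAC.
  by rewrite /diff; apply: is_derive_eq; ring.
have df (t : R) : is_derive t (1 : R) f (f1 t).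
  have H1 := ddiff _ _ (y + e) t dg; have H2 := ddiff _ _ y t dg.
  by rewrite /f /f1; apply: is_derive_eq; ring.
have df1 (t : R) : is_derive t (1 : R) f1 (f2 t).
  have H1 := ddiff _ _ (y + e) t dg1; have H2 := ddiff _ _ y t dg1.
  by rewrite /f1 /f2; apply: is_derive_eq; rewrite /GRing.scale/=; ring.
have cf2 : continuous f2.
  move=> t; have H1 := ddiff _ _ (y + e) t dg2; have H2 := ddiff _ _ y t dg2.
  apply: cvgM; first exact: cvg_cst.
  by apply: cvgB; [exact: (is_derive1_continuous H1) | exact: (is_derive1_continuous H2)].
have diffB (F : R -> R) z : (forall x, `|F x| <= G0) -> `|diff F z| <= 2 * G0.
  by move=> FG; apply: (le_trans (ler_normB _ _)); have := FG z; have := FG (z - h); lra.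
have fB t : `|f t| <= 4 * G0.
  apply: (le_trans (ler_normB _ _)); have := diffB g (y + e - h * t) gG; have := diffB g (y - h * t) gG; lra.
have f1B t : `|f1 t| <= h * (4 * G0).
  rewrite normrM normrN (gtr0_norm h0) ler_wpM2l ?(ltW h0)//.
  apply: (le_trans (ler_normB _ _)); have := diffB g1 (y + e - h * t) g1G; have := diffB g1 (y - h * t) g1G; lra.
have f2S t : `|f2 t| <= h ^+ 3 * M * e.
  rewrite normrM ger0_norm ?exprn_ge0 ?(ltW h0)//.
  have := diff2_lip (y + e - h * t) (y - h * t).
  rewrite (_ : y + e - h * t - (y - h * t) = e); last by ring.
  rewrite (gtr0_norm e0) => H; apply: (@le_trans _ _ (h ^+ 2 * (M * h * e))).
    by rewrite ler_wpM2l// exprn_ge0// ltW.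
  by rewrite le_eqVlt; apply/orP; left; apply/eqP; ring.
have fE k t : kappa a (t - k%:R) * f t =
    (Kf (y + e) h k%:R t - Kf (y + e - h) h k%:R t) - (Kf y h k%:R t - Kf (y - h) h k%:R t).
  rewrite /Kf /f /diff.
  rewrite (_ : y + e - h * t - h = y + e - h - h * t); last by ring.
  by rewrite (_ : y - h * t - h = y - h - h * t); ring.
have Ki k z := Kf_int z k%:R h0.
have KI k : mu.-integrable `]k%:R, +oo[ (EFin \o (fun t => kappa a (t - k%:R) * f t)) /\
    \int[mu]_(t in `]k%:R, +oo[) (kappa a (t - k%:R) * f t) = ha * b * (e * D k).
  rewrite (_ : (fun t => kappa a (t - k%:R) * f t) =
      (fun t => (Kf (y + e) h k%:R t - Kf (y + e - h) h k%:R t) - (Kf y h k%:R t - Kf (y - h) h k%:R t))); last first.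
    by apply/funext => t; exact: fE.
  have i1 : mu.-integrable `]k%:R, +oo[ (EFin \o (fun t => Kf (y + e) h k%:R t - Kf (y + e - h) h k%:R t)).
    by apply: integrable_sub => //; exact: Ki.
  have i2 : mu.-integrable `]k%:R, +oo[ (EFin \o (fun t => Kf y h k%:R t - Kf (y - h) h k%:R t)).
    by apply: integrable_sub => //; exact: Ki.
  split; first exact: integrable_sub.
  rewrite !RintegralB//.
  rewrite !Kf_eq// -/ha /D (mulrC e) divfK ?gt_eqF// -!natr1.
  rewrite (_ : y + e - h - h * k%:R = y + e - (k%:R + 1) * h); last by ring.
  rewrite (_ : y - h - h * k%:R = y - (k%:R + 1) * h); last by ring.
  by rewrite !(mulrC h); ring.
have KN k : \int[mu]_(t in `]k%:R, +oo[) `|kappa a (t - k%:R) * f t| <= 4 * (ha * b * norm1).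
  have n z : mu.-integrable `]k%:R, +oo[ (EFin \o (fun t => `|Kf z h k%:R t|)).
    by apply: integrable_norm; exact: Ki.
  have n2 z z' : mu.-integrable `]k%:R, +oo[ (EFin \o (fun t => `|Kf z h k%:R t| + `|Kf z' h k%:R t|)).
    by apply: integrable_add => //; exact: n.
  have n4 : mu.-integrable `]k%:R, +oo[ (EFin \o (fun t =>
      (`|Kf (y + e) h k%:R t| + `|Kf (y + e - h) h k%:R t|) + (`|Kf y h k%:R t| + `|Kf (y - h) h k%:R t|))).
    by apply: integrable_add => //; exact: n2.
  apply: (@le_trans _ _ (\int[mu]_(t in `]k%:R, +oo[)
      ((`|Kf (y + e) h k%:R t| + `|Kf (y + e - h) h k%:R t|) + (`|Kf y h k%:R t| + `|Kf (y - h) h k%:R t|)))).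
    apply: (le_trans (ler_norm _)); apply: (Rintegral_dominated _ (integrable_norm (proj1 (KI k))) n4) => // t _.
    rewrite normr_id fE; apply: (le_trans (ler_normB _ _)).
    by apply: lerD; exact: ler_normB.
  rewrite !RintegralD//.
  have := Kf_norm (y + e) k%:R h0; have := Kf_norm (y + e - h) k%:R h0.
  have := Kf_norm y k%:R h0; have := Kf_norm (y - h) k%:R h0; rewrite -/ha; lra.
have [l0 cl0 bl0] := kernel_estimate df df1 cf2 fB f1B f2S (fun k => proj1 (KI k)) KN.
exists (l0 / (ha * b * e)).
  rewrite (_ : (fun n => _) = (fun n =>
      (\sum_(k < n) w k * \int[mu]_(t in `]k%:R, +oo[) (kappa a (t - k%:R) * f t)) * (ha * b * e)^-1)).
    by apply: cvgM; [exact: cl0 | exact: cvg_cst].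
  apply/funext => n; rewrite mulr_suml; apply: eq_bigr => k _; rewrite (proj2 (KI k)).
  by field; rewrite !gt_eqF.
have -> : ha * (l0 / (ha * b * e)) - (e^-1 * (diff g (y + e) - diff g y)
      - a / 2 * h * (e^-1 * (diff g1 (y + e) - diff g1 y))) =
    (l0 - b * (f 0 + a / 2 * f1 0)) / (b * e).
  by rewrite /f /f1 !mulr0 !subr0; field; rewrite !gt_eqF.
have be0 : 0 < b * e by rewrite mulr_gt0.
rewrite normrM [`|_^-1|]gtr0_norm ?invr_gt0// ler_pdivrMr//; apply: (le_trans bl0).
rewrite le_eqVlt; apply/orP; left; apply/eqP.
by field; rewrite gt_eqF.
Qed.

Let uk_le k : `|uk k| <= L. Proof. by apply: u_le; exact: good. Qed.

(** As [e] tends to 0, the difference quotients of [U] tend to [u] at every node and are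
    bounded by the Lipschitz constant of [U], so the limit passes under the sum. *)
Let diff_estimate : exists2 l : R,
  \sum_(k < n) w k * (uk k - uk k.+1) @[n --> \oo] --> l &
  `|ha * l - (diff g1 y - a / 2 * h * diff g2 y)| <= h ^+ 3 * M * C / b.
Proof.
pose ep (n : nat) : R := n.+1%:R^-1.
have ep0 n : 0 < ep n by rewrite invr_gt0.
pose D n (k : nat) := (U (y + ep n - k%:R * h) - U (y + ep n - k.+1%:R * h) -
     (U (y - k%:R * h) - U (y - k.+1%:R * h))) / ep n.
have [s Hs] := choice (fun n => let: ex_intro2 l A B := quotient_estimate (ep0 n) in
  ex_intro (fun l => (\sum_(k < m) w k * D n k @[m --> \oo] --> l) /\
    `|ha * l - ((ep n)^-1 * (diff g (y + ep n) - diff g y)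
      - a / 2 * h * ((ep n)^-1 * (diff g1 (y + ep n) - diff g1 y)))| <= h ^+ 3 * M * C / b) l (conj A B)).
have DB k n : `|D n k| <= 2 * L.
  rewrite /D normrM [`|_^-1|]gtr0_norm ?invr_gt0// ler_pdivrMr//.
  rewrite (_ : _ - _ = (U (y + ep n - k%:R * h) - U (y - k%:R * h)) -
    (U (y + ep n - k.+1%:R * h) - U (y - k.+1%:R * h))); last by ring.
  apply: (le_trans (ler_normB _ _)).
  have h1 := UL (y + ep n - k%:R * h) (y - k%:R * h).
  have h2 := UL (y + ep n - k.+1%:R * h) (y - k.+1%:R * h).
  have e1 (z : R) : y + ep n - z - (y - z) = ep n by ring.
  rewrite !e1 (gtr0_norm (ep0 n)) in h1 h2; lra.
have Dk k : D n k @[n --> \oo] --> uk k - uk k.+1.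
  have q j := derive_quot_seq (good j).
  rewrite (_ : (fun n => D n k) = (fun n => n.+1%:R * (U (y - k%:R * h + n.+1%:R^-1) - U (y - k%:R * h))
     - n.+1%:R * (U (y - k.+1%:R * h + n.+1%:R^-1) - U (y - k.+1%:R * h)))).
    by apply: cvgB; exact: q.
  apply/funext => n; rewrite /D /ep invrK.
  rewrite (addrAC y) (addrAC y (n.+1%:R^-1)); ring.
have cl : cvgn (series (fun k => w k * (uk k - uk k.+1))).
  apply: (@norm_bounded_cvg_series _ _ (2 * (2 * L))) => n.
  apply: (@le_trans _ _ (\sum_(k < n) `|w k| * (2 * L))).
    apply: ler_sum => k _; rewrite normrM ler_wpM2l//.
    by apply: (le_trans (ler_normB _ _)); have := uk_le k; have := uk_le k.+1; lra.
  by rewrite -mulr_suml ler_wpM2r ?mulr_ge0// sum_norm_grunwald_weight.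
exists (limn (series (fun k => w k * (uk k - uk k.+1)))); first by move: cl; rewrite seriesEord.
set l := limn _; have cl2 : \sum_(k < n) w k * (uk k - uk k.+1) @[n --> \oo] --> l.
  by have := cl; rewrite /l seriesEord.
have sl : s n @[n --> \oo] --> l.
  apply: (@tannery_series _ w (fun k n => D n k) (fun k => uk k - uk k.+1) s l 2 (2 * L)) => //.
  - by move=> n; exact: sum_norm_grunwald_weight.
  - by move=> n; exact: (proj1 (Hs n)).
have ddiff (F F' : R -> R) : (forall x : R, is_derive x (1 : R) F (F' x)) ->
    (ep n)^-1 * (diff F (y + ep n) - diff F y) @[n --> \oo] --> diff F' y.
  move=> dF; rewrite (_ : (fun n => _) = (fun n => n.+1%:R * (F (y + n.+1%:R^-1) - F y)
     - n.+1%:R * (F (y - h + n.+1%:R^-1) - F (y - h)))).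
    by apply: cvgB; exact: derive_quot_seq (dF _).
  apply/funext => n; rewrite /diff /ep invrK (addrAC y); ring.
have lim : ha * s n - ((ep n)^-1 * (diff g (y + ep n) - diff g y)
      - a / 2 * h * ((ep n)^-1 * (diff g1 (y + ep n) - diff g1 y))) @[n --> \oo] -->
    ha * l - (diff g1 y - a / 2 * h * diff g2 y).
  apply: cvgB; first by apply: cvgM => //; exact: cvg_cst.
  apply: cvgB; first exact: ddiff.
  by apply: cvgM; [exact: cvg_cst | exact: ddiff].
by apply: (norm_cvg_le lim) => n; exact: (proj2 (Hs n)).
Qed.

(** By Pascal's rule the weights of order [1 + a] are differences of the weights of order
    [a], and summation by parts moves the difference to [u]. The remaining differences of
    [g1] and [g2] over a step [h] are expanded by Taylor's formula. *)
Lemma grunwald_one_step (p x : R) : y = x + p * h ->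
  cvgn (series (grunwald_term (1 + a) h p u x)) /\
  `|grunwald (1 + a) h p u x - (g2 y - (1 + a) / 2 * h * g3 y)|
    <= (C / b + 6^-1 + a / 4) * M * h ^+ 2.
Proof.
move=> yE; case/andP: a01 => a0 a1.
have termE k : grunwald_term (1 + a) h p u x k = grunwald_weight (1 + a) k * uk k.
  by rewrite /grunwald_term /uk; congr (_ * u _); rewrite yE; ring.
have partial n : \sum_(k < n.+1) grunwald_weight (1 + a) k * uk k =
    \sum_(k < n) w k * (uk k - uk k.+1) + w n * uk n.
  elim: n => [|n ih].
    by rewrite big_ord_recl !big_ord0 addr0 add0r /w !grunwald_weight0.
  rewrite big_ord_recr/= ih [in RHS]big_ord_recr/= grunwald_weight_pascal -/w; ring.
have [l cl bl] := diff_estimate.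
have w0 : w n @[n --> \oo] --> 0.
  apply: cvg_series_cvg_0; apply: norm_bounded_cvg_series.
  exact: sum_norm_grunwald_weight.
have wu0 : w n * uk n @[n --> \oo] --> 0.
  have w1 : `|w n| * L @[n --> \oo] --> 0.
    rewrite -[X in _ --> X](mul0r L); apply: cvgM; last exact: cvg_cst.
    by rewrite -[X in _ --> X](@normr0 _ R); exact: cvg_norm.
  have w2 : - (`|w n| * L) @[n --> \oo] --> 0 by rewrite -[X in _ --> X]oppr0; apply: cvgN.
  apply: (squeeze_cvgr _ w2 w1); apply: nearW => n; rewrite -ler_norml normrM.
  by rewrite ler_wpM2l.
have cs : series (grunwald_term (1 + a) h p u x) n @[n --> \oo] --> l.
  have cp : \sum_(k < n) w k * (uk k - uk k.+1) + w n * uk n @[n --> \oo] --> l.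
    by rewrite -[X in _ --> X]addr0; exact: cvgD.
  rewrite -(cvg_shiftS (series (grunwald_term (1 + a) h p u x))).
  rewrite (_ : (fun n => _) = (fun n => \sum_(k < n) w k * (uk k - uk k.+1) + w n * uk n)) //.
  apply/funext => n; rewrite -partial seriesEord/=.
  by apply: eq_bigr => k _; exact: termE.
split; first exact: (cvgP _ cs).
rewrite /grunwald (cvg_lim _ cs)//.
have hE : (h `^ (1 + a))^-1 = h^-1 * ha.
  rewrite /ha powRD ?(gt_eqF h0) ?implybT// powRr1 ?ltW// invfM powRN//.
rewrite hE -mulrA.
have t3 := @taylor3 _ g1 g2 g3 g4 M y (y - h) (fun _ _ => dg1 _) (fun _ _ => dg2 _) (fun _ _ => dg3 _) (fun _ _ => g4M _).
have t2 := @taylor2 _ g2 g3 g4 M y (y - h) (fun _ _ => dg2 _) (fun _ _ => dg3 _) (fun _ _ => g4M _).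
have yh : y - h - y = - h by ring.
rewrite !yh !normrN (gtr0_norm h0) in t2 t3.
pose r3 := g1 (y - h) - g1 y - - h * g2 y - (- h) ^+ 2 / 2 * g3 y.
pose r2 := g2 (y - h) - g2 y - - h * g3 y.
pose rl := ha * l - (diff g1 y - a / 2 * h * diff g2 y).
have -> : h^-1 * (ha * l) - (g2 y - (1 + a) / 2 * h * g3 y) = h^-1 * (rl - r3 + a / 2 * h * r2).
  by rewrite /rl /r3 /r2 /diff; field; rewrite gt_eqF.
rewrite normrM gtr0_norm ?invr_gt0// mulrC ler_pdivrMr//.
apply: (le_trans (ler_normD _ _)); apply: (le_trans (lerD (ler_normB _ _) (lexx _))).
have hr2 : `|a / 2 * h * r2| <= a / 2 * h * (M / 2 * h ^+ 2).
  have ah : 0 <= a / 2 * h by rewrite mulr_ge0 ?(ltW h0)// divr_ge0// ltW.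
  by rewrite normrM (ger0_norm ah) ler_wpM2l.
have -> : (C / b + 6^-1 + a / 4) * M * h ^+ 2 * h =
    h ^+ 3 * M * C / b + M / 6 * h ^+ 3 + a / 2 * h * (M / 2 * h ^+ 2).
  by field; rewrite gt_eqF.
by apply: lerD => //; exact: lerD.
Qed.

End one_step.

Lemma grunwald_estimate_aux : exists K : R, forall (u : R -> R) (h p x : R), 0 < h ->
  (forall k : nat, is_derive (x + p * h - k%:R * h) (1 : R) U (u (x + p * h - k%:R * h))) ->
  cvgn (series (grunwald_term (1 + a) h p u x)) /\
  `|grunwald (1 + a) h p u x - (g2 (x + p * h) - (1 + a) / 2 * h * g3 (x + p * h))| <= K * h ^+ 2.
Proof.
have [C C0 HC] := grunwald_kernel_estimate a01; rewrite -bE in HC.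
have [L L0 UL] := primitive_lipschitz; have [G0 [G00 gG g1G]] := bounded_g.
exists ((C / b + 6^-1 + a / 4) * M) => u h p x h0 good.
exact: (@grunwald_one_step h (x + p * h) u C L G0).
Qed.

End estimate.

Lemma grunwald_estimate (R : realType) (a : R) (u g1 g2 g3 g4 : R -> R) (M : R)
    (mu := @lebesgue_measure R) (g := fun x => abel a u x / Gamma (1 - a)) :
  0 < a < 1 -> mu.-integrable setT (EFin \o u) ->
  (forall x : R, mu.-integrable `]-oo, x[ (EFin \o (fun s : R => (x - s) `^ (- a) * u s))) ->
  (forall x : R, is_derive x (1 : R) g (g1 x)) ->
  (forall x : R, is_derive x (1 : R) g1 (g2 x)) ->
  (forall x : R, is_derive x (1 : R) g2 (g3 x)) ->
  (forall x : R, is_derive x (1 : R) g3 (g4 x)) -> (forall x, `|g4 x| <= M) ->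
  exists K : R, forall h p x : R, 0 < h ->
  (forall k : nat, is_derive (x + p * h - k%:R * h) (1 : R) (primitive u) (u (x + p * h - k%:R * h))) ->
  cvgn (series (grunwald_term (1 + a) h p u x)) /\
  `|grunwald (1 + a) h p u x - (g2 (x + p * h) - (1 + a) / 2 * h * g3 (x + p * h))| <= K * h ^+ 2.
Proof.
move=> a01 ui ai dg dg1 dg2 dg3 g4M.
have Gb0 : 0 < Gamma (1 - a) by case/andP: a01 => a0 a1; apply: Gamma_gt0; lra.
have [K HK] := @grunwald_estimate_aux R a a01 g (primitive u) _ _ _ erefl erefl Gb0 (beta_const_gt0 a01)
  (fun x h c h0 => integrable_kappa_abel a01 ui ai c x h0)
  (fun x h c h0 => integral_norm_kappa_abel a01 ui ai c x h0)
  (fun x h c h0 => integral_kappa_abel a01 ui ai c x h0) g1 g2 g3 g4 M dg dg1 dg2 dg3 g4M.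
by exists K => h p x; exact: HK.
Qed.

(** * From one shift to the weighted operator *)

Section conclusion.
Variable R : realType.
Local Notation mu := (@lebesgue_measure R).

(** The averages of [v] are bounded by [integral_le_of_trig_transforms]; so are its values
    at Lebesgue points, and then all of them since [v] is a derivative. *)
Lemma bounded_of_fourier_integrable (F v : R -> R) :
  (forall x : R, is_derive x (1 : R) F (v x)) -> inL1 v -> complex_inL1 (fourier v) ->
  exists M : R, forall x, `|v x| <= M.
Proof.
move=> dF vi [ci si].
pose c w := \int[mu]_y (cos (w * y) * v y); pose s w := \int[mu]_y (sin (w * y) * v y).
have reE : (fun w => complex.Re (fourier v w)) = c.
  apply/funext => w; apply: eq_Rintegral => y _.
  by rewrite /expi/= cosN !mulr0 subr0.
have imE : (fun w => complex.Im (fourier v w)) = (fun w => \int[mu]_y (- 1 * (sin (w * y) * v y))).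
  apply/funext => w; apply: eq_Rintegral => y _.
  by rewrite /expi/= sinN mulr0 add0r; ring.
have mv : measurable_fun setT v by apply/measurable_EFinP; exact: measurable_int vi.
have sint w : mu.-integrable setT (EFin \o (fun y : R => sin (w * y) * v y)).
  apply: (integrable_dominated _ _ (integrable_norm vi)) => //.
    apply: measurable_funM => //; apply: (measurableT_comp (continuous_measurable_fun (@continuous_sin R))).
    exact: measurable_funM.
  by move=> y _ /=; rewrite normrM ler_piMl// ler_norml sin_geN1 sin_le1.
have sE : (fun w => complex.Im (fourier v w)) = (fun w => - 1 * s w).
  by rewrite imE; apply/funext => w; rewrite RintegralZl.
rewrite reE in ci; rewrite sE in si.
have {}si : mu.-integrable setT (EFin \o s).
  have := integrable_scale measurableT (-1) si.
  by rewrite (_ : (fun x => -1 * (-1 * s x)) = s)//; apply/funext => w; rewrite !mulN1r opprK.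
have bnd := integral_le_of_trig_transforms vi ci si.
exists (\int[mu]_w (`|c w| + `|s w|) / pi).
apply: (norm_derive_le_of_ae dF); first exact: (le_norm_ae_of_integral vi).
by rewrite divr_ge0 ?pi_ge0//; apply: Rintegral_ge0 => w _; exact: addr_ge0.
Qed.

(** Expanding about [x], the two linear conditions on the weights match the terms of order
    0 and 1 in [h]. *)
Lemma WSGD_estimate (m : nat) (alpha K M h x : R) (p lambda : 'I_m -> R) (u G2 G3 G4 : R -> R) :
  0 < h -> (forall x : R, is_derive x (1 : R) G2 (G3 x)) ->
  (forall x : R, is_derive x (1 : R) G3 (G4 x)) -> (forall x, `|G4 x| <= M) ->
  \sum_(j < m) lambda j = 1 -> \sum_(j < m) lambda j * (p j - alpha / 2) = 0 ->
  (forall j, `|grunwald alpha h (p j) u x -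
     (G2 (x + p j * h) - alpha / 2 * h * G3 (x + p j * h))| <= K * h ^+ 2) ->
  `|WSGD alpha p lambda h u x - G2 x| <=
    (\sum_(j < m) `|lambda j| * (K + M / 2 * p j ^+ 2 + `|alpha / 2| * (M * `|p j|))) * h ^+ 2.
Proof.
move=> h0 dG2 dG3 G4M s1 s2 est.
pose r j := grunwald alpha h (p j) u x - (G2 x + h * G3 x * (p j - alpha / 2)).
have -> : WSGD alpha p lambda h u x - G2 x = \sum_(j < m) lambda j * r j.
  rewrite -[G2 x]mul1r -{1}s1 mulr_suml /WSGD -sumrB.
  have e : \sum_(j < m) h * G3 x * (lambda j * (p j - alpha / 2)) = 0 by rewrite -mulr_sumr s2 mulr0.
  transitivity (\sum_(j < m) (lambda j * grunwald alpha h (p j) u x - lambda j * G2 x) -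
    \sum_(j < m) h * G3 x * (lambda j * (p j - alpha / 2))); first by rewrite e subr0.
  by rewrite -sumrB; apply: eq_bigr => j _; rewrite /r; ring.
apply: (le_trans (ler_norm_sum _ _ _)); rewrite mulr_suml; apply: ler_sum => j _.
rewrite normrM -mulrA ler_wpM2l//.
pose y := x + p j * h; have yx : y - x = p j * h by rewrite /y; ring.
have t2 := @taylor2 _ G2 G3 G4 M x y (fun _ _ => dG2 _) (fun _ _ => dG3 _) (fun _ _ => G4M _).
have t1 := @taylor1 _ G3 G4 M x y (fun _ _ => dG3 _) (fun _ _ => G4M _).
rewrite yx normrM (gtr0_norm h0) in t1 t2.
have -> : r j = (grunwald alpha h (p j) u x - (G2 y - alpha / 2 * h * G3 y)) +
   (G2 y - G2 x - p j * h * G3 x) - alpha / 2 * h * (G3 y - G3 x) by rewrite /r; ring.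
apply: (le_trans (ler_normB _ _)); rewrite !mulrDl.
apply: lerD; last first.
  rewrite normrM (normrM _ h) (gtr0_norm h0) (_ : _ * h ^+ 2 = `|alpha / 2| * h * (M * (`|p j| * h))); last by ring.
  by rewrite ler_wpM2l// mulr_ge0// ltW.
apply: (le_trans (ler_normD _ _)); apply: lerD; first exact: est.
apply: (le_trans t2); rewrite exprMn -normrX ger0_norm ?sqr_ge0//.
by rewrite le_eqVlt; apply/orP; left; apply/eqP; ring.
Qed.

(** For a given [h] the expansion requires the primitive of [u] to have derivative [u] at
    countably many translates of [x]: this excludes a null set of points in general, and
    no point when [u] is continuous. *)
Lemma second_order_of_estimate (m : nat) (alpha K M : R) (p lambda : 'I_m -> R) (u G2 G3 G4 : R -> R) :
  inL1 u -> (forall x : R, is_derive x (1 : R) G2 (G3 x)) ->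
  (forall x : R, is_derive x (1 : R) G3 (G4 x)) -> (forall x, `|G4 x| <= M) ->
  \sum_(j < m) lambda j = 1 -> \sum_(j < m) lambda j * (p j - alpha / 2) = 0 ->
  (forall h q x : R, 0 < h ->
     (forall k : nat, is_derive (x + q * h - k%:R * h) (1 : R) (primitive u) (u (x + q * h - k%:R * h))) ->
     cvgn (series (grunwald_term alpha h q u x)) /\
     `|grunwald alpha h q u x - (G2 (x + q * h) - alpha / 2 * h * G3 (x + q * h))| <= K * h ^+ 2) ->
  exists C : R, \forall h \near (0 : R)^'+,
    {ae mu, forall x : R, (forall j : 'I_m, cvgn (series (grunwald_term alpha h (p j) u x))) /\
      `|WSGD alpha p lambda h u x - G2 x| <= C * h ^+ 2} /\
    (continuous u -> forall x : R, (forall j : 'I_m, cvgn (series (grunwald_term alpha h (p j) u x))) /\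
      `|WSGD alpha p lambda h u x - G2 x| <= C * h ^+ 2).
Proof.
move=> ui dG2 dG3 G4M s1 s2 est.
exists (\sum_(j < m) `|lambda j| * (K + M / 2 * p j ^+ 2 + `|alpha / 2| * (M * `|p j|))).
near=> h; have h0 : 0 < h by [].
have at_good x : (forall (j : 'I_m) (k : nat),
    is_derive (x + p j * h - k%:R * h) (1 : R) (primitive u) (u (x + p j * h - k%:R * h))) ->
    (forall j : 'I_m, cvgn (series (grunwald_term alpha h (p j) u x))) /\
      `|WSGD alpha p lambda h u x - G2 x| <=
      (\sum_(j < m) `|lambda j| * (K + M / 2 * p j ^+ 2 + `|alpha / 2| * (M * `|p j|))) * h ^+ 2.
  move=> good; split; first by move=> j; case: (est h (p j) x h0 (good j)).
  by apply: (WSGD_estimate h0 dG2 dG3 G4M s1 s2) => j; case: (est h (p j) x h0 (good j)).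
split; last first.
  by move=> cu x; apply: at_good => j k; apply: (primitive_is_derive_continuous ui); exact: cu.
have H : {ae mu, forall x : R, forall (j : 'I_m) (k : nat),
    is_derive (x + p j * h - k%:R * h) (1 : R) (primitive u) (u (x + p j * h - k%:R * h))}.
  apply: filter_forall => j; apply: ae_foralln => k.
  have := negligible_shift (p j * h - k%:R * h) (primitive_is_derive_ae ui).
  apply: negligibleS => x /=; by rewrite addrA.
by apply: filterS H; [exact: (ae_filter_ringOfSetsType mu) | move=> x; exact: at_good].
Unshelve. all: by end_near. Qed.

Lemma grunwald_weight2_eq0 k : (3 <= k)%N -> grunwald_weight (2 : R) k = 0.
Proof.
elim: k => // k ih; rewrite leq_eqVlt => /predU1P[<-|k3]; last by rewrite grunwald_weightS ih ?mul0r.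
by rewrite grunwald_weightS subrr mul0r mulr0.
Qed.

(** For the order 2 the series stops after three terms. *)
Lemma grunwald2 (h q x : R) (u : R -> R) : 0 < h ->
  cvgn (series (grunwald_term 2 h q u x)) /\
  grunwald 2 h q u x = (h ^+ 2)^-1 * (u (x + q * h) - 2 * u (x + q * h - h) + u (x + q * h - 2 * h)).
Proof.
move=> h0.
have part n : series (grunwald_term 2 h q u x) n.+3 =
    u (x + q * h) - 2 * u (x + q * h - h) + u (x + q * h - 2 * h).
  rewrite seriesEord/=; elim: n => [|n ih].
    rewrite !big_ord_recr big_ord0/= /grunwald_term !grunwald_weightS grunwald_weight0.
    rewrite (_ : x - (0%:R - q) * h = x + q * h); last by ring.
    rewrite (_ : x - (1%:R - q) * h = x + q * h - h); last by ring.
    rewrite (_ : x - (2%:R - q) * h = x + q * h - 2 * h); last by ring.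
    by field.
  by rewrite big_ord_recr/= ih /grunwald_term grunwald_weight2_eq0// mul0r addr0.
have cs : series (grunwald_term 2 h q u x) n @[n --> \oo] -->
    u (x + q * h) - 2 * u (x + q * h - h) + u (x + q * h - 2 * h).
  apply: cvg_near_cst; exists 3%N => // n /= n3.
  by rewrite -(subnKC n3) !addSn add0n part.
split; first exact: (cvgP _ cs).
by rewrite /grunwald (cvg_lim _ cs)// powR_mulrn// ltW.
Qed.

Lemma grunwald2_estimate (u u1 u2 u3 u4 : R -> R) (M : R) :
  (forall x : R, is_derive x (1 : R) u (u1 x)) -> (forall x : R, is_derive x (1 : R) u1 (u2 x)) ->
  (forall x : R, is_derive x (1 : R) u2 (u3 x)) -> (forall x : R, is_derive x (1 : R) u3 (u4 x)) ->
  (forall x, `|u4 x| <= M) ->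
  forall h q x : R, 0 < h -> cvgn (series (grunwald_term 2 h q u x)) /\
  `|grunwald 2 h q u x - (u2 (x + q * h) - 2 / 2 * h * u3 (x + q * h))| <= M * h ^+ 2.
Proof.
move=> du du1 du2 du3 u4M h q x h0; have [cs ->] := grunwald2 q x u h0; split => //.
set y := x + q * h.
have M0 : 0 <= M by exact: le_trans (u4M 0).
have T1 := taylor4 y (y - h) du du1 du2 du3 u4M.
have T2 := taylor4 y (y - 2 * h) du du1 du2 du3 u4M.
have e1 : y - h - y = - h by ring.
have e2 : y - 2 * h - y = - (2 * h) by ring.
rewrite e1 e2 !normrN (gtr0_norm h0) in T1 T2.
rewrite (gtr0_norm (mulr_gt0 _ h0))// in T2.
have h20 : 0 < h ^+ 2 by rewrite exprn_gt0.
set r1 := (X in `|X| <= _) in T1; set r2 := (X in `|X| <= _) in T2.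
have -> : (h ^+ 2)^-1 * (u y - 2 * u (y - h) + u (y - 2 * h)) - (u2 y - 2 / 2 * h * u3 y) =
   (r2 - 2 * r1) / h ^+ 2.
  by rewrite /r1 /r2; field; rewrite gt_eqF.
rewrite normrM [`|_^-1|]gtr0_norm ?invr_gt0// ler_pdivrMr//.
apply: (le_trans (ler_normB _ _)); rewrite normrM normr_nat.
apply: (le_trans (lerD T2 (ler_wpM2l (ler0n _ 2) T1))).
have Mh : 0 <= M * h ^+ 4 by rewrite mulr_ge0// exprn_ge0// ltW.
have -> : M / 24 * (2 * h) ^+ 4 + 2 * (M / 24 * h ^+ 4) = 3 / 4 * (M * h ^+ 4) by field.
rewrite (_ : M * h ^+ 2 * h ^+ 2 = M * h ^+ 4); last by ring.
by rewrite ler_piMl//; lra.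
Qed.

Lemma is_derive_derive1n (F : R -> R) (n k : nat) (x : R) : nderivable n F -> (k < n)%N ->
  is_derive x (1 : R) (derive1n k F) (derive1n k.+1 F x).
Proof. by move=> nF kn; apply: is_derive_of_derive1; split; first exact: nF. Qed.

End conclusion.

(** * The two regimes of the order *)

Section regimes.
Variable R : realType.
Local Notation mu := (@lebesgue_measure R).

Lemma grunwald_estimate_integer (u : R -> R) : inL1 u ->
  RL_derivable (2 + 2) u -> inL1 (RL_derivative (2 + 2) u) ->
  complex_inL1 (fourier (RL_derivative (2 + 2) u)) ->
  RL_derivable 2 u /\ exists G3 G4 : R -> R, exists M K : R,
  [/\ forall x : R, is_derive x (1 : R) (RL_derivative 2 u) (G3 x),
     forall x : R, is_derive x (1 : R) G3 (G4 x), forall x, `|G4 x| <= M &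
     forall h q x : R, 0 < h -> cvgn (series (grunwald_term 2 h q u x)) /\
     `|grunwald 2 h q u x - (RL_derivative 2 u (x + q * h) - 2 / 2 * h * G3 (x + q * h))| <= K * h ^+ 2].
Proof.
have -> : 2 + 2 = 4%:R :> R by rewrite -natrD.
rewrite /RL_derivable /RL_derivative !Num.Theory.natr_nat !Num.Theory.natrK => ui d4 vi Fvi.
have dk k (k4 : (k < 4)%N) x := is_derive_derive1n x d4 k4.
have [M vM] := bounded_of_fourier_integrable (dk 3 isT) vi Fvi.
split; first by move=> k k2; apply: d4; exact: ltn_trans k2 _.
exists (derive1n 3 u), (derive1n 4 u), M, M; split.
- by move=> x; exact: dk.
- by move=> x; exact: dk.
- exact: vM.
- move=> h q x h0.
  exact: (grunwald2_estimate (dk 0 isT) (dk 1 isT) (dk 2 isT) (dk 3 isT) vM).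
Qed.

(** The derivatives of orders [1 + a] and [3 + a] are the second and fourth derivatives of
    one and the same fractional integral, of order [1 - a]. *)
Lemma grunwald_estimate_fractional (a : R) (u : R -> R) : 0 < a < 1 -> inL1 u ->
  RL_derivable (1 + a + 2) u -> inL1 (RL_derivative (1 + a + 2) u) ->
  complex_inL1 (fourier (RL_derivative (1 + a + 2) u)) ->
  RL_derivable (1 + a) u /\ exists G3 G4 : R -> R, exists M K : R,
  [/\ forall x : R, is_derive x (1 : R) (RL_derivative (1 + a) u) (G3 x),
     forall x : R, is_derive x (1 : R) G3 (G4 x), forall x, `|G4 x| <= M &
     forall h q x : R, 0 < h ->
     (forall k : nat, is_derive (x + q * h - k%:R * h) (1 : R) (primitive u) (u (x + q * h - k%:R * h))) ->
     cvgn (series (grunwald_term (1 + a) h q u x)) /\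
     `|grunwald (1 + a) h q u x -
       (RL_derivative (1 + a) u (x + q * h) - (1 + a) / 2 * h * G3 (x + q * h))| <= K * h ^+ 2].
Proof.
move=> a01; case/andP: (a01) => a0 a1.
have t1 : Num.truncn (1 + a) = 1%N by apply: Num.Theory.truncn_def; apply/andP; split; lra.
have t3 : Num.truncn (1 + a + 2) = 3%N by apply: Num.Theory.truncn_def; apply/andP; split; lra.
have n1 : (1 + a \is a Num.nat) = false.
  by apply/negbTE/negP => /Num.Theory.truncnK; rewrite t1; lra.
have n3 : (1 + a + 2 \is a Num.nat) = false.
  by apply/negbTE/negP => /Num.Theory.truncnK; rewrite t3; lra.
have e1 : (RL_n (1 + a))%:R - (1 + a) = 1 - a by rewrite /RL_n t1; lra.
have e3 : (RL_n (1 + a + 2))%:R - (1 + a + 2) = 1 - a by rewrite /RL_n t3; lra.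
have ma : 1 - a - 1 = - a by ring.
rewrite /RL_derivable /RL_derivative n1 n3 /RL_integral /RL_integrand e1 e3 ma /RL_n t1 t3.
rewrite -/(abel a u) => ui [ai d4] vi Fvi.
set Gb := Gamma (1 - a) in vi Fvi *.
have dk k (k4 : (k < 4)%N) x : is_derive x (1 : R) (fun x => Gb^-1 * derive1n k (abel a u) x)
    (Gb^-1 * derive1n k.+1 (abel a u) x).
  have H := is_derive_derive1n x d4 k4.
  by apply: is_derive_eq.
have [M vM] := bounded_of_fourier_integrable (dk 3 isT) vi Fvi.
split.
  by split => // k k2; apply: d4; exact: ltn_trans k2 _.
have dg x : is_derive x (1 : R) (fun x => abel a u x / Gb) (Gb^-1 * derive1n 1 (abel a u) x).
  rewrite (_ : (fun x => _) = (fun x => Gb^-1 * derive1n 0 (abel a u) x)); first exact: dk.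
  by apply/funext => y; rewrite mulrC.
have [K HK] := grunwald_estimate a01 ui ai dg (dk 1 isT) (dk 2 isT) (dk 3 isT) vM.
exists (fun x => Gb^-1 * derive1n 3 (abel a u) x), (fun x => Gb^-1 * derive1n 4 (abel a u) x), M, K.
by split; [move=> x; exact: dk | move=> x; exact: dk | exact: vM | exact: HK].
Qed.

End regimes.

Theorem theorem2 (R : realType) (alpha : R) (u : R -> R)
    (m : nat) (p lambda : 'I_m -> R) :
  1 < alpha <= 2 ->
  inL1 u ->
  RL_derivable (alpha + 2) u ->
  inL1 (RL_derivative (alpha + 2) u) ->
  complex_inL1 (fourier (RL_derivative (alpha + 2) u)) ->
  (2 <= m)%N ->
  \sum_(j < m) lambda j = 1 ->
  \sum_(j < m) lambda j * (p j - alpha / 2) = 0 ->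
  let second_order_at (C h x : R) :=
    (forall j : 'I_m, cvgn (series (grunwald_term alpha h (p j) u x))) /\
    `|WSGD alpha p lambda h u x - RL_derivative alpha u x| <= C * h ^+ 2 in
  RL_derivable alpha u /\
  exists C : R, \forall h \near (0 : R)^'+,
    {ae @lebesgue_measure R, forall x : R, second_order_at C h x} /\
    (continuous u -> forall x : R, second_order_at C h x).
Proof.
move=> /andP[alpha1]; rewrite le_eqVlt => /predU1P[->|alpha2] ui d vi Fvi _ s1 s2.
- have [d2 [G3 [G4 [M [K [dG2 dG3 G4M est]]]]]] := grunwald_estimate_integer ui d vi Fvi.
  split => //; apply: (second_order_of_estimate ui dG2 dG3 G4M s1 s2) => h q x h0 _.
  exact: est.
- pose a := alpha - 1; have a01 : 0 < a < 1 by rewrite /a; apply/andP; split; lra.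
  have aE : alpha = 1 + a by rewrite /a; ring.
  move: d vi Fvi s2; rewrite aE => d vi Fvi s2.
  have [d2 [G3 [G4 [M [K [dG2 dG3 G4M est]]]]]] := grunwald_estimate_fractional a01 ui d vi Fvi.
  by split => //; exact: (second_order_of_estimate ui dG2 dG3 G4M s1 s2 est).
Qed.
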